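(* The only distributive law of the operad $\mathcal{P}_1=\mathcal{C}om$ over the operad $\mathcal{P}_2=\mathcal{L}ie$ is the trivial one, $\mathcal{D}=0$.
   Context: Fix a field $\Bbbk$ of characteristic $0$; operads are symmetric operads in $\Bbbk$-vector spaces, and all generating operations have degree $0$. For a $\Sigma_2$-module $E$, $\mathcal{F}(E)$ is the free operad generated by $E$ placed in arity $2$; for a $\Sigma_3$-submodule $R\subseteq\mathcal{F}(E)(3)$, $\langle E;R\rangle=\mathcal{F}(E)/(R)$, where $(R)$ is the operad ideal generated by $R$. Let $\mathcal{P}_1=\langle E_1;R_1\rangle$, $\mathcal{P}_2=\langle E_2;R_2\rangle$ and $E=E_1\oplus E_2$. For $i,j\in\{1,2\}$ let $\mathcal{F}(E)(3)_{ij}\subseteq\mathcal{F}(E)(3)$ be the $\Sigma_3$-submodule generated by the compositions $\mu(1,\nu)$, $\mu(\nu,1)$ with $\mu\in E_i$ (root operation) and $\nu\in E_j$. Given a $\Sigma_3$-equivariant linear map $\mathcal{D}\colon\mathcal{F}(E)(3)_{12}\to\mathcal{F}(E)(3)_{21}$, let $R_{\mathcal{D}}$ be the submodule of all $x-\mathcal{D}(x)$, $x\in\mathcal{F}(E)(3)_{12}$, and let $\mathcal{P}=\langle E_1\oplus E_2;\,R_1\oplus R_{\mathcal{D}}\oplus R_2\rangle$. The canonical maps $\mathcal{P}_i\to\mathcal{P}$ and operadic composition in $\mathcal{P}$ induce, via $(\mu;\nu_1,\dots,\nu_l)\mapsto\mu(\nu_1,\dots,\nu_l)$ with $\mu\in\mathcal{P}_2(l)$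 and $\nu_s\in\mathcal{P}_1(m_s)$, $m_1+\cdots+m_l=n$, an equivariant map $\xi(n)\colon(\mathcal{P}_2\circ\mathcal{P}_1)(n)\to\mathcal{P}(n)$, where $\mathcal{P}_2\circ\mathcal{P}_1$ is the composite product of $\Sigma$-modules. The map $\mathcal{D}$ is called a distributive law of $\mathcal{P}_1$ over $\mathcal{P}_2$ if $\xi(n)$ is an isomorphism for every $n\ge2$. The map $\mathcal{D}=0$ is always a distributive law, called the trivial one. $\mathcal{C}om$ is the operad of commutative associative algebras: $E$ is the one-dimensional trivial $\Sigma_2$-module (one commutative binary operation) and $R$ is generated by the associativity relation. $\mathcal{L}ie$ is the operad of Lie algebras: $E$ is the one-dimensional sign $\Sigma_2$-module (one anticommutative binary operation) and $R$ is generated by the Jacobi identity. *)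

(* Defs.v *)
From HB Require Import structures.
From mathcomp Require Import all_boot all_order all_fingroup all_algebra.
From mathcomp Require Import generic_quotient.
From mathcomp Require Import finmap.
From mathcomp Require Import boolp classical_sets.
From mathcomp Require Import monalg.

Set Implicit Arguments.
Unset Strict Implicit.
Unset Printing Implicit Defensive.

Import GRing.Theory.
Local Open Scope ring_scope.
Local Open Scope quotient_scope.

Section Span.
Variables (K : fieldType) (V : lmodType K).
Implicit Types (S U : set V).

Definition submodule U : Prop :=
  U 0 /\ forall (a : K) x y, U x -> U y -> U (a *: x + y).

Definition span S : set V :=
  fun v => forall U, submodule U -> (forall x, S x -> U x) -> U v.

Definition spanb S : {pred V} := fun v => `[< span S v >].

Lemma span_submodule S : submodule (span S).
Proof.
split=> [U [] //|a x y Sx Sy U subU SU].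
by apply: subU.2; [exact: Sx|exact: Sy].
Qed.

Lemma sub_span S x : S x -> span S x.
Proof. by move=> Sx U _; apply. Qed.

Lemma spanb_closed S : submod_closed (spanb S).
Proof.
have [S0 SD] := span_submodule S; split; first exact/asboolP.
by move=> a x y /asboolP Sx /asboolP Sy; apply/asboolP; apply: SD.
Qed.

HB.instance Definition _ S := GRing.isSubmodClosed.Build K V (spanb S)
  (spanb_closed S).

Record subspace S := SubSpace { sub_val :> V; _ : sub_val \in spanb S }.
HB.instance Definition _ S := [isSub for @sub_val S].
HB.instance Definition _ S := [Choice of subspace S by <:].
HB.instance Definition _ S := [SubChoice_isSubLmodule of subspace S by <:].

Definition quotmod S := Quotient.quot (spanb S).
HB.instance Definition _ S := GRing.Zmodule.on (quotmod S).
HB.instance Definition _ S := EqQuotient.on (quotmod S).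

Definition qscale S (a : K) (x : quotmod S) : quotmod S :=
  \pi_(quotmod S) (a *: repr x).

Lemma qeqP S (x y : V) :
  reflect (span S (x - y)) (\pi_(quotmod S) x == \pi_(quotmod S) y).
Proof. by rewrite -Quotient.idealrBE; apply: asboolP. Qed.

Lemma pi_qscale S a (x : V) :
  \pi_(quotmod S) (a *: x) = qscale a (\pi_(quotmod S) x).
Proof.
apply/eqP/qeqP; rewrite -scalerBr -[_ *: _]addr0.
have [S0 SD] := span_submodule S; apply: SD => //.
by apply/qeqP; rewrite reprK.
Qed.

Lemma qscaleA S a b (x : quotmod S) : qscale a (qscale b x) = qscale (a * b) x.
Proof. by rewrite -[x]reprK -!pi_qscale scalerA reprK. Qed.

Lemma qscale1 S : left_id 1 (@qscale S).
Proof. by move=> x; rewrite -[x]reprK -pi_qscale scale1r. Qed.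

Lemma qscaleDr S : right_distributive (@qscale S) +%R.
Proof.
by move=> a x y; rewrite -[x]reprK -[y]reprK -raddfD -!pi_qscale scalerDr raddfD.
Qed.

Lemma qscaleDl S x : {morph (@qscale S)^~ x : a b / a + b}.
Proof. by move=> a b; rewrite -[x]reprK -!pi_qscale scalerDl raddfD. Qed.

HB.instance Definition _ S := GRing.Zmodule_isLmodule.Build K (quotmod S)
  (@qscaleA S) (@qscale1 S) (@qscaleDr S) (@qscaleDl S).

Definition qpi S : V -> quotmod S := \pi_(quotmod S).

Lemma qpi_is_linear S : linear (qpi S).
Proof. by move=> a x y; rewrite /qpi raddfD /= pi_qscale. Qed.

HB.instance Definition _ S := GRing.isLinear.Build K V (quotmod S) _ (qpi S)
  (@qpi_is_linear S).

(* The map induced by [f] on the quotient; it is well defined as soon as [f]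
   vanishes on [S], see [qlift_pi]. *)
Definition qlift S (W : Type) (f : V -> W) (x : quotmod S) : W := f (repr x).

Lemma qlift_pi S (W : lmodType K) (f : {linear V -> W}) :
  (forall x, S x -> f x = 0) -> forall x, qlift f (qpi S x) = f x.
Proof.
move=> fS x; rewrite /qlift; apply/eqP; rewrite -subr_eq0 -linearB; apply/eqP.
have : span S (repr (qpi S x) - x) by apply/qeqP; rewrite reprK.
move=> /(_ [set v | f v = 0]%classic); apply=> //; split=> [|a u v]; first exact: linear0.
by rewrite /mkset linearP => -> ->; rewrite scaler0 addr0.
Qed.

Lemma qlift_is_linear S (W : lmodType K) (f : {linear V -> W}) :
  (forall x, S x -> f x = 0) -> linear (@qlift S W f).
Proof.
have pK x : x = qpi S (repr x) by rewrite /qpi reprK.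
move=> fS a x y; rewrite (pK x) (pK y) -linearP !(qlift_pi fS).
by rewrite linearP.
Qed.

End Span.

Arguments qpi {K V} S x.

Section LinearExtension.
Variables (K : fieldType) (W : lmodType K).

(* [{malg K[T]}] is the free [K]-module on [T], with basis [<< t >>]. *)
Definition linext (T : choiceType) (f : T -> W) (x : {malg K[T]}) : W :=
  \sum_(t <- msupp x) x@_t *: f t.

Lemma linextE (T : choiceType) (f : T -> W) (D : {fset T}) (x : {malg K[T]}) :
  (msupp x `<=` D)%fset -> linext f x = \sum_(t <- D) x@_t *: f t.
Proof.
move=> xD; rewrite /linext; apply: big_fset_incl => // t _ /mcoeff_outdom ->.
by rewrite scale0r.
Qed.

Lemma linext_is_linear (T : choiceType) (f : T -> W) : linear (linext f).
Proof.
move=> a x y; pose D := (msupp x `|` msupp y `|` msupp (a *: x + y))%fset.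
rewrite !(@linextE _ _ D) ?fsubsetUr //.
- rewrite scaler_sumr -big_split /=; apply: eq_bigr => t _.
  by rewrite mcoeffD mcoeffZ scalerDl scalerA.
- by apply: fsubset_trans (fsubsetUl _ _); exact: fsubsetUr.
- by apply: fsubset_trans (fsubsetUl _ _); exact: fsubsetUl.
Qed.

HB.instance Definition _ T f := GRing.isLinear.Build K {malg K[T]} W _
  (@linext T f) (@linext_is_linear T f).

Lemma linextU (T : choiceType) (f : T -> W) t : linext f << t >> = f t.
Proof. by rewrite /linext msuppU oner_eq0 big_seq_fset1 mcoeffUU scale1r. Qed.

(* The multilinear extension of a map defined on tuples of basis vectors. *)
Definition multiext (T0 : choiceType) (L : finType) (T : L -> choiceType)
    (f : T0 -> (forall s, T s) -> W)
    (x : {malg K[T0]}) (y : forall s, {malg K[T s]}) : W :=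
  \sum_(t <- msupp x) \sum_(u : {dffun forall s : L, msupp (y s)})
    (x@_t * \prod_s (y s)@_(val (u s))) *: f t (fun s => val (u s)).

End LinearExtension.

(* A bijection, seen as a renaming of labels. *)
Record renaming (A B : Type) := Renaming {
  rename :> A -> B;
  renameP : bijective rename
}.

Definition perm_renaming (A : finType) (s : {perm A}) : renaming A A :=
  Renaming (Bijective (permK s) (permKV s)).

(* A module over the symmetric group on two letters; [swap] is the action of
   the transposition. *)
Record sigma2 (K : fieldType) := Sigma2 {
  ops :> lmodType K;
  swap : {linear ops -> ops};
  swapK : involutive swap
}.
Arguments swap {K s}.
Arguments swapK {K s}.

Section DirectSum.
Variables (K : fieldType) (E1 E2 : sigma2 K).

Definition pair_swap (e : E1 * E2) : E1 * E2 := (swap e.1, swap e.2).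

Lemma pair_swap_is_linear : linear pair_swap.
Proof. by move=> a [x1 x2] [y1 y2]; rewrite /pair_swap /= !linearP. Qed.

HB.instance Definition _ := GRing.isLinear.Build K (E1 * E2)%type
  (E1 * E2)%type _ pair_swap pair_swap_is_linear.

Lemma pair_swapK : involutive pair_swap.
Proof. by move=> [x y]; rewrite /pair_swap /= !swapK. Qed.

Definition sigma2_sum : sigma2 K :=
  @Sigma2 K (E1 * E2)%type pair_swap pair_swapK.

Definition inl_op (e : E1) : sigma2_sum := (e, 0).
Definition inr_op (e : E2) : sigma2_sum := (0, e).

End DirectSum.

Inductive tree (G L : Type) : Type :=
| Leaf of L
| Node of G & tree G L & tree G L.
Arguments Leaf {G L}.

HB.instance Definition _ G L := gen_eqMixin (tree G L).
HB.instance Definition _ G L := gen_choiceMixin (tree G L).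

Section Trees.
Variable G : Type.

Fixpoint leaves L (t : tree G L) : seq L :=
  match t with Leaf i => [:: i] | Node _ l r => leaves l ++ leaves r end.

Fixpoint tmap_leaf L L' (f : L -> L') (t : tree G L) : tree G L' :=
  match t with
  | Leaf i => Leaf (f i)
  | Node e l r => Node e (tmap_leaf f l) (tmap_leaf f r)
  end.

Fixpoint tmap_op G' L (h : G -> G') (t : tree G L) : tree G' L :=
  match t with
  | Leaf i => Leaf i
  | Node e l r => Node (h e) (tmap_op h l) (tmap_op h r)
  end.

Fixpoint tgraft L (M : L -> Type) (t : tree G L) (u : forall s, tree G (M s)) :
    tree G {s : L & M s} :=
  match t with
  | Leaf s => tmap_leaf (Tagged M) (u s)
  | Node e l r => Node e (tgraft l u) (tgraft r u)
  end.

Lemma leaves_tmap_leaf L L' (f : L -> L') (t : tree G L) :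
  leaves (tmap_leaf f t) = map f (leaves t).
Proof. by elim: t => //= _ l -> r ->; rewrite map_cat. Qed.

Lemma leaves_tgraft L (M : L -> Type) (t : tree G L)
    (u : forall s, tree G (M s)) :
  leaves (tgraft t u) = [seq Tagged M i | s <- leaves t, i <- leaves (u s)].
Proof.
elim: t => [s|e l IHl r IHr] /=; first by rewrite cats0 leaves_tmap_leaf.
by rewrite IHl IHr map_cat flatten_cat.
Qed.

(* Each label of [A] is carried by exactly one leaf. *)
Definition multilinear (A : finType) (t : tree G A) : bool :=
  uniq (leaves t) && [forall a, a \in leaves t].

End Trees.

Lemma leaves_tmap_op G G' L (h : G -> G') (t : tree G L) :
  leaves (tmap_op h t) = leaves t.
Proof. by elim: t => //= e l -> r ->. Qed.

Record mtree (G : Type) (A : finType) := MTree {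
  mtree_val :> tree G A;
  mtreeP : multilinear mtree_val
}.
HB.instance Definition _ G A := [isSub for @mtree_val G A].
HB.instance Definition _ G A := [Choice of mtree G A by <:].

Section MultilinearTrees.
Variable G : Type.

Lemma mrename_subproof (A B : finType) (f : renaming A B) (t : mtree G A) :
  multilinear (tmap_leaf f t).
Proof.
case: f => f [g fK gK] /=; case/andP: (mtreeP t) => Ut /forallP tA.
rewrite /multilinear leaves_tmap_leaf map_inj_uniq ?Ut; last exact: can_inj fK.
by apply/forallP => b; rewrite -[b]gK map_f.
Qed.

Definition mrename (A B : finType) (f : renaming A B) (t : mtree G A) :
  mtree G B := MTree (mrename_subproof f t).

Lemma mgraft_subproof (L : finType) (M : L -> finType) (t : mtree G L)
    (u : forall s, mtree G (M s)) :
  multilinear (tgraft t u).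
Proof.
case/andP: (mtreeP t) => Ut /forallP tA.
rewrite /multilinear leaves_tgraft; apply/andP; split.
  apply: allpairs_uniq_dep => // [s _|[s i] [s' i'] _ _ //].
  by case/andP: (mtreeP (u s)).
apply/forallP => -[s i]; apply/allpairsPdep; exists s, i; split=> //.
by case/andP: (mtreeP (u s)) => _ /forallP.
Qed.

Definition mgraft (L : finType) (M : L -> finType) (t : mtree G L)
    (u : forall s, mtree G (M s)) : mtree G {s : L & M s} :=
  MTree (mgraft_subproof t u).

Lemma mtmap_op_subproof G' (h : G -> G') (A : finType) (t : mtree G A) :
  multilinear (tmap_op h t).
Proof. by rewrite /multilinear leaves_tmap_op; case: t. Qed.

Definition mtmap_op G' (h : G -> G') (A : finType) (t : mtree G A) :
  mtree G' A := MTree (mtmap_op_subproof h t).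

Lemma uniq3_mem (i j k a : 'I_3) : uniq [:: i; j; k] -> a \in [:: i; j; k].
Proof.
move=> U; have := uniq_min_size U (s2 := enum 'I_3).
by case=> [b|| _ ->] //; rewrite ?mem_enum // size_enum_ord.
Qed.

Lemma comp_right_subproof (m n : G) (i j k : 'I_3) : uniq [:: i; j; k] ->
  multilinear (Node m (Leaf i) (Node n (Leaf j) (Leaf k))).
Proof. by move=> U; rewrite /multilinear U; apply/forallP=> a; apply: uniq3_mem. Qed.

Lemma comp_left_subproof (m n : G) (i j k : 'I_3) : uniq [:: i; j; k] ->
  multilinear (Node m (Node n (Leaf i) (Leaf j)) (Leaf k)).
Proof. by move=> U; rewrite /multilinear U; apply/forallP=> a; apply: uniq3_mem. Qed.

(* The arity-three trees m(x_i, n(x_j, x_k)) and m(n(x_i, x_j), x_k). *)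
Definition comp_right m n i j k (U : uniq [:: i; j; k]) : mtree G 'I_3 :=
  MTree (comp_right_subproof m n U).
Definition comp_left m n i j k (U : uniq [:: i; j; k]) : mtree G 'I_3 :=
  MTree (comp_left_subproof m n U).

End MultilinearTrees.

Section FreeOperad.
Variables (K : fieldType) (E : sigma2 K).

(* [tree_lin a t t1 t2]: the three trees only differ in the decoration of one
   vertex, where the decorations satisfy e = a e1 + e2. *)
Inductive tree_lin (L : Type) (a : K) : tree E L -> tree E L -> tree E L -> Prop :=
| TreeLin (e1 e2 : E) l r :
    tree_lin a (Node (a *: e1 + e2) l r) (Node e1 l r) (Node e2 l r)
| TreeLinL e t t1 t2 r : tree_lin a t t1 t2 ->
    tree_lin a (Node e t r) (Node e t1 r) (Node e t2 r)
| TreeLinR e l t t1 t2 : tree_lin a t t1 t2 ->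
    tree_lin a (Node e l t) (Node e l t1) (Node e l t2).

Inductive tree_swap (L : Type) : tree E L -> tree E L -> Prop :=
| TreeSwap (e : E) l r : tree_swap (Node (swap e) l r) (Node e r l)
| TreeSwapL e t t' r : tree_swap t t' -> tree_swap (Node e t r) (Node e t' r)
| TreeSwapR e l t t' : tree_swap t t' -> tree_swap (Node e l t) (Node e l t').

Inductive free_rel (A : finType) : set {malg K[mtree E A]} :=
| FreeLin a (t t1 t2 : mtree E A) : tree_lin a t t1 t2 ->
    free_rel (<< t >> - (a *: << t1 >> + << t2 >>))
| FreeSwap (t t' : mtree E A) : tree_swap t t' -> free_rel (<< t >> - << t' >>).

(* The free operad generated by [E] in arity 2, with inputs labelled by an
   arbitrary finite set [A]; its component of arity [n] is [free 'I_n]. *)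
Definition free (A : finType) : lmodType K := quotmod (@free_rel A).

Definition ftree (A : finType) (t : mtree E A) : free A :=
  qpi (@free_rel A) << t >>.

Definition frename (A B : finType) (f : renaming A B) : free A -> free B :=
  qlift (linext (fun t => ftree (mrename f t))).

(* The operadic composition x(y_s | s : L), computed on representatives: grafting
   is linear in the decoration of each vertex and commutes with [swap], so the
   multilinear extension vanishes as soon as one argument is in the span of
   [free_rel]. *)
Definition fcomp (L : finType) (M : L -> finType) (x : free L)
    (y : forall s, free (M s)) : free {s : L & M s} :=
  multiext (fun t u => ftree (mgraft t u)) (repr x) (fun s => repr (y s)).

Record operad_ideal (I : forall A : finType, set (free A)) : Prop := {
  ideal_submodule : forall A, submodule (I A);
  ideal_rename : forall (A B : finType) (f : renaming A B) x,
    I A x -> I B (frename f x);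
  ideal_root : forall (L : finType) (M : L -> finType) x y,
    I L x -> I {s : L & M s} (fcomp x y);
  ideal_input : forall (L : finType) (M : L -> finType) x y s,
    I (M s) (y s) -> I {s : L & M s} (fcomp x y)
}.

Definition ideal (R : set (free 'I_3)) (A : finType) : set (free A) :=
  fun x => forall I, operad_ideal I -> (forall r, R r -> I 'I_3 r) -> I A x.
Arguments ideal : clear implicits.

Lemma tree_lin_map_leaf L L' (f : L -> L') a (t t1 t2 : tree E L) :
  tree_lin a t t1 t2 ->
  tree_lin a (tmap_leaf f t) (tmap_leaf f t1) (tmap_leaf f t2).
Proof. by elim=> *; constructor. Qed.

Lemma tree_swap_map_leaf L L' (f : L -> L') (t t' : tree E L) :
  tree_swap t t' -> tree_swap (tmap_leaf f t) (tmap_leaf f t').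
Proof. by elim=> *; constructor. Qed.

Lemma free_relP A (x : {malg K[mtree E A]}) :
  free_rel x -> qpi (@free_rel A) x = 0.
Proof.
by move=> Rx; rewrite -[RHS](linear0 (qpi (@free_rel A))); apply/eqP/qeqP;
   rewrite subr0; apply: sub_span.
Qed.

Lemma ftree_lin A a (t t1 t2 : mtree E A) :
  tree_lin a t t1 t2 -> ftree t = a *: ftree t1 + ftree t2.
Proof.
move=> /FreeLin/free_relP/eqP; rewrite linearB subr_eq0 linearP => /eqP; exact.
Qed.

Lemma ftree_swap A (t t' : mtree E A) : tree_swap t t' -> ftree t = ftree t'.
Proof. by move=> /FreeSwap/free_relP/eqP; rewrite linearB subr_eq0 => /eqP; exact. Qed.

Lemma frename_rel (A B : finType) (f : renaming A B) x :
  free_rel x -> linext (fun t => ftree (mrename f t)) x = 0.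
Proof.
case=> [a t t1 t2 R|t t' R]; apply/eqP; rewrite linearB subr_eq0.
  rewrite linearP /= !linextU; apply/eqP/ftree_lin.
  exact: tree_lin_map_leaf.
by rewrite /= !linextU; apply/eqP/ftree_swap; exact: tree_swap_map_leaf.
Qed.

Lemma frename_is_linear (A B : finType) (f : renaming A B) : linear (frename f).
Proof. exact: qlift_is_linear (@frename_rel A B f). Qed.

HB.instance Definition _ (A B : finType) f := GRing.isLinear.Build K (free A) (free B) _
  (@frename A B f) (@frename_is_linear A B f).

Lemma frename_tree (A B : finType) (f : renaming A B) t :
  frename f (ftree t) = ftree (mrename f t).
Proof. by rewrite /frename /ftree (qlift_pi (@frename_rel A B f)) /= linextU. Qed.

Lemma ideal_closed R : operad_ideal (ideal R).
Proof.
split=> [A|A B f x Rx I II RI|L M x y Rx I II RI|L M x y s Rx I II RI].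
- split=> [I [/(_ A)[]]//|a x y Rx Ry I II RI].
  by have [_] := ideal_submodule II A; apply; [exact: Rx|exact: Ry].
- by apply: ideal_rename => //; exact: Rx.
- by apply: ideal_root => //; exact: Rx.
- by apply: ideal_input => //; exact: Rx.
Qed.

Lemma free_ext (A : finType) (W : lmodType K) (f g : {linear free A -> W}) :
  (forall t, f (ftree t) = g (ftree t)) -> f =1 g.
Proof.
move=> fg x; have -> : x = qpi (@free_rel A) (repr x) by rewrite /qpi reprK.
rewrite [repr x]monalgE !linear_sum; apply: eq_bigr => t _.
have -> : << (repr x)@_t *g t >> = (repr x)@_t *: << t >> :> {malg K[mtree E A]}.
  by apply/malgP => u; rewrite mcoeffZ !mcoeffU mulrnAr mulr1.
by rewrite !linearZ /= fg.
Qed.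

Lemma frename_id (A : finType) (f : renaming A A) : f =1 id -> frename f =1 id.
Proof.
move=> f1; apply: (@free_ext _ _ (frename f) idfun) => t.
rewrite /= frename_tree; congr ftree; apply: val_inj => /=.
by elim: (val t) => [i|e l + r] /= => [|-> ->]; rewrite ?f1.
Qed.

Lemma frename_comp (A B C : finType) (f : renaming A B) (g : renaming B C)
    (h : renaming A C) :
  h =1 g \o f -> frename h =1 frename g \o frename f.
Proof.
move=> hE; apply: (@free_ext _ _ (frename h) (frename g \o frename f)) => t.
rewrite /= !frename_tree; congr ftree; apply: val_inj => /=.
by elim: (val t) => [i|e l + r] /= => [|-> ->]; rewrite ?hE.
Qed.

Definition operad (R : set (free 'I_3)) (A : finType) : lmodType K :=
  quotmod (ideal R A).

Definition orename R (A B : finType) (f : renaming A B) :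
    operad R A -> operad R B :=
  qlift (qpi (ideal R B) \o frename f).

(* Independent of the representatives because [ideal R] is closed under
   composition on both sides. *)
Definition ocomp R (L : finType) (M : L -> finType) (x : operad R L)
    (y : forall s, operad R (M s)) : operad R {s : L & M s} :=
  qpi (ideal R _) (fcomp (repr x) (fun s => repr (y s))).

Lemma orename_rel R (A B : finType) (f : renaming A B) x :
  ideal R A x -> (qpi (ideal R B) \o frename f) x = 0.
Proof.
move=> Ix; rewrite /= -[RHS](linear0 (qpi (ideal R B))); apply/eqP/qeqP.
rewrite subr0; apply: sub_span.
by have [_ + _ _] := ideal_closed R; apply.
Qed.

Lemma orename_is_linear R (A B : finType) (f : renaming A B) :
  linear (@orename R A B f).
Proof. exact: qlift_is_linear (@orename_rel R A B f). Qed.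

HB.instance Definition _ R (A B : finType) f := GRing.isLinear.Build K
  (operad R A) (operad R B) _ (@orename R A B f) (@orename_is_linear R A B f).

Lemma orename_pi R (A B : finType) (f : renaming A B) x :
  orename f (qpi (ideal R A) x) = qpi (ideal R B) (frename f x).
Proof. exact: qlift_pi (@orename_rel R A B f) x. Qed.

Lemma orename1 R n (x : operad R 'I_n) :
  orename (perm_renaming (1%g : 'S_n)) x = x.
Proof.
have -> : x = qpi (ideal R 'I_n) (repr x) by rewrite /qpi reprK.
by rewrite orename_pi frename_id //= => i; rewrite perm1.
Qed.

Lemma orenameM R n (s t : 'S_n) (x : operad R 'I_n) :
  orename (perm_renaming (s * t)%g) x =
  orename (perm_renaming t) (orename (perm_renaming s) x).
Proof.
have -> : x = qpi (ideal R 'I_n) (repr x) by rewrite /qpi reprK.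
rewrite !orename_pi; apply: (congr1 (qpi (ideal R 'I_n))).
by apply: frename_comp => i /=; rewrite permM.
Qed.

End FreeOperad.

Arguments free {K} E A.
Arguments ideal {K E} R A.
Arguments operad {K E} R A.
Arguments operad_ideal {K} E I.

(* [act s] renames the input [i] into [s i]; since [(s * t) i = t (s i)], this
   is a right action of 'S_n with its mathcomp product. *)
Record smodule (K : fieldType) := SModule {
  component :> nat -> lmodType K;
  act : forall n, 'S_n -> component n -> component n;
  act_linear : forall n (s : 'S_n), linear (act s);
  act1 : forall n (x : component n), act 1%g x = x;
  actM : forall n (s t : 'S_n) (x : component n),
    act (s * t)%g x = act t (act s x)
}.

Definition operad_smodule (K : fieldType) (E : sigma2 K)
    (R : set (free E 'I_3)) : smodule K :=
  @SModule K (fun n => operad R 'I_n)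
    (fun n s => orename (perm_renaming s))
    (fun n s => @orename_is_linear K E R _ _ (perm_renaming s))
    (fun n => @orename1 K E R n) (fun n => @orenameM K E R n).

Section Composite.
Variables (K : fieldType) (P Q : smodule K).

(* The formal composite root(arg_0, ..., arg_(l-1)), where the [i]-th input of
   [arg s] receives the label [lab (Tagged _ i)]. *)
Record fcomposite (n : nat) := FComposite {
  width : nat;
  root : P width;
  arity : 'I_width -> nat;
  arg : forall s, Q (arity s);
  lab : renaming {s : 'I_width & 'I_(arity s)} 'I_n
}.

HB.instance Definition _ n := gen_eqMixin (fcomposite n).
HB.instance Definition _ n := gen_choiceMixin (fcomposite n).

Lemma reindex_root_subproof l (m : 'I_l -> nat) (s : 'S_l) :
  bijective (fun u : {i : 'I_l & 'I_(m (s i))} =>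
    Tagged (fun i => 'I_(m i)) (tagged u)).
Proof.
apply: inj_card_bij => [[i a] [j b] /= e|].
  have ij : i = j by apply: (@perm_inj _ s); exact: (congr1 tag e).
  case: _ / ij in b e *; congr Tagged; move/eqP: e.
  by rewrite -tag_eqE /tag_eq /= eqxx tagged_asE => /eqP.
rewrite !card_tagged !sumnE !big_map -!enumT !big_enum /=.
by rewrite (reindex_inj (@perm_inj _ s)).
Qed.

Definition reindex_root l (m : 'I_l -> nat) (s : 'S_l) :
    renaming {i : 'I_l & 'I_(m (s i))} {i : 'I_l & 'I_(m i)} :=
  Renaming (reindex_root_subproof m s).

Lemma reindex_args_subproof l (m : 'I_l -> nat) (t : forall i, 'S_(m i)) :
  bijective (fun u : {i : 'I_l & 'I_(m i)} =>
    Tagged (fun i => 'I_(m i)) (t (tag u) (tagged u))).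
Proof.
exists (fun u => Tagged (fun i => 'I_(m i)) ((t (tag u))^-1%g (tagged u))).
  by case=> i a /=; rewrite permK.
by case=> i a /=; rewrite permKV.
Qed.

Definition reindex_args l (m : 'I_l -> nat) (t : forall i, 'S_(m i)) :
    renaming {i : 'I_l & 'I_(m i)} {i : 'I_l & 'I_(m i)} :=
  Renaming (reindex_args_subproof t).

Lemma renaming_comp_subproof (A B C : Type) (g : renaming B C)
  (f : renaming A B) : bijective (g \o f).
Proof. by apply: bij_comp; apply: renameP. Qed.

Definition renaming_comp (A B C : Type) (g : renaming B C)
    (f : renaming A B) : renaming A C :=
  Renaming (renaming_comp_subproof g f).

(* The tensor product relations over K, and the identifications by the actions
   of the symmetric groups on the inputs of the root and of the arguments. *)
Inductive composite_rel (n : nat) : set {malg K[fcomposite n]} :=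
| CompRoot a l (x x1 x2 : P l) m (y : forall s, Q (m s)) f : x = a *: x1 + x2 ->
    composite_rel (<< @FComposite n l x m y f >>
      - (a *: << FComposite x1 y f >> + << FComposite x2 y f >>))
| CompArg a l (x : P l) m (y y1 y2 : forall s, Q (m s)) f s0 :
    y s0 = a *: y1 s0 + y2 s0 ->
    (forall s, s != s0 -> y s = y1 s /\ y s = y2 s) ->
    composite_rel (<< @FComposite n l x m y f >>
      - (a *: << FComposite x y1 f >> + << FComposite x y2 f >>))
| CompActRoot l (x : P l) m (y : forall s, Q (m s)) f (s : 'S_l) :
    composite_rel (<< @FComposite n l (act s x) m y f >>
      - << FComposite x (fun i => y (s i))
             (renaming_comp f (reindex_root m s)) >>)
| CompActArgs l (x : P l) m (y : forall s, Q (m s)) f (t : forall s, 'S_(m s)) :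
    composite_rel (<< @FComposite n l x m (fun s => act (t s) (y s)) f >>
      - << FComposite x y (renaming_comp f (reindex_args t)) >>).

Definition composite (n : nat) : lmodType K := quotmod (@composite_rel n).

End Composite.

Section FreeMap.
Variables (K : fieldType) (E E' : sigma2 K) (h : E -> E').

Definition fmap_op (A : finType) : free E A -> free E' A :=
  qlift (linext (fun t => ftree (mtmap_op h t))).

End FreeMap.

Section DistributiveLaw.
Variables (K : fieldType) (E1 E2 : sigma2 K).
Variables (R1 : set (free E1 'I_3)) (R2 : set (free E2 'I_3)).

Let E := sigma2_sum E1 E2.

(* The closure of a set of elements of arity [n] under the symmetric group;
   its span is the submodule generated by that set. *)
Definition orbits (E0 : sigma2 K) n (G : set (free E0 'I_n)) :
    set (free E0 'I_n) :=
  [set x | exists (s : 'S_n) g, G g /\ x = frename (perm_renaming s) g]%classic.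

Inductive compositions (M N : set E) : set (free E 'I_3) :=
| CompositionR m n : M m -> N n -> compositions M N
    (ftree (@comp_right E m n 0 1 2%:R isT))
| CompositionL m n : M m -> N n -> compositions M N
    (ftree (@comp_left E m n 0 1 2%:R isT)).

Definition ops1 : set E := range (@inl_op K E1 E2).
Definition ops2 : set E := range (@inr_op K E1 E2).

(* In [free12] the root operation is in E1 and the inner one in E2; in [free21]
   the roles are exchanged. *)
Definition free12 : lmodType K := subspace (orbits (compositions ops1 ops2)).
Definition free21 : lmodType K := subspace (orbits (compositions ops2 ops1)).

Definition equivariant (D : free12 -> free21) : Prop :=
  forall (s : 'S_3) (x y : free12),
    sub_val y = frename (perm_renaming s) (sub_val x) ->
    sub_val (D y) = frename (perm_renaming s) (sub_val (D x)).

Variable D : free12 -> free21.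

Definition rel1 : set (free E 'I_3) :=
  (@fmap_op K E1 E (@inl_op K E1 E2) 'I_3 @` R1)%classic.
Definition rel2 : set (free E 'I_3) :=
  (@fmap_op K E2 E (@inr_op K E1 E2) 'I_3 @` R2)%classic.
Definition relD : set (free E 'I_3) :=
  range (fun x : free12 => sub_val x - sub_val (D x)).

Definition rel_total : set (free E 'I_3) :=
  span (rel1 `|` relD `|` rel2)%classic.

Definition canon1 (A : finType) : operad R1 A -> operad rel_total A :=
  qlift (fun x => qpi (ideal rel_total A) (fmap_op (@inl_op K E1 E2) x)).
Definition canon2 (A : finType) : operad R2 A -> operad rel_total A :=
  qlift (fun x => qpi (ideal rel_total A) (fmap_op (@inr_op K E1 E2) x)).

Definition xi (n : nat) :
    composite (operad_smodule R2) (operad_smodule R1) n ->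
    operad rel_total 'I_n :=
  qlift (linext (fun c : fcomposite (operad_smodule R2) (operad_smodule R1) n =>
    orename (lab c)
      (ocomp (@canon2 'I_(width c) (root c))
        (fun s => @canon1 'I_(arity s) (arg s))))).

Definition distributive_law : Prop :=
  forall n, (2 <= n)%N -> bijective (@xi n).

End DistributiveLaw.

Section ComLie.
Variable K : fieldType.

Definition E_com : sigma2 K := @Sigma2 K K^o idfun (fun=> erefl).
Definition E_lie : sigma2 K := @Sigma2 K K^o -%R (@opprK K).

Definition R_com : set (free E_com 'I_3) :=
  span (orbits [set ftree (@comp_left E_com 1 1 0 1 2%:R isT)
                    - ftree (@comp_right E_com 1 1 0 1 2%:R isT)]%classic).

Definition R_lie : set (free E_lie 'I_3) :=
  span (orbits [set ftree (@comp_left E_lie 1 1 0 1 2%:R isT)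
                    + ftree (@comp_left E_lie 1 1 1 2%:R 0 isT)
                    + ftree (@comp_left E_lie 1 1 2%:R 0 1 isT)]%classic).

End ComLie.

(* Main.v *)
(** For D = 0, let W be spanned by the Lie trees whose leaves are commutative
    trees, modulo the relations of Lie at the root and of Com at the leaves, with
    the commutative product of two brackets set to 0.  This is an algebra over P,
    and evaluating operations of P on its generators gives a left inverse of xi;
    surjectivity holds because every tree with a Lie vertex below a Com vertex
    vanishes in P.

    Conversely equivariance forces D(a[b,c]) = lam ([b,ac] - [c,ab]).  Expanding
    both sides of (ab)[c,d] = a(b[c,d]) produces an element of (Lie o Com)(4)
    killed by xi in which the bracket [bd,ac] has coefficient lam^2.  If xi is
    injective this element is 0, and evaluating it in an algebra over the operad
    for D = 0 where [bd,ac] survives gives lam = 0. *)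

From HB Require Import structures.
From mathcomp Require Import all_boot all_order all_fingroup all_algebra.
From mathcomp Require Import generic_quotient finmap boolp classical_sets monalg.
(* [Defs] comes last because its [span] and [free] must shadow those of [vector]. *)
Require Import Defs.

Set Implicit Arguments.
Unset Strict Implicit.
Unset Printing Implicit Defensive.
Import GRing.Theory.
Local Open Scope ring_scope.

(** * Slotwise linear maps *)

(** All objects are quotients by spans, and no basis of Lie is ever computed; this is why
    injectivity for D = 0 goes through a left inverse, made of evaluation into W followed by a map
    from W to the composite product. The obstacle is that a relation of Lie has to be applied at a
    root whose inputs are whole commutative trees, whereas [operad] only knows inputs labelled by a
    finite set. The predicate [null] bridges this: it speaks of trees over any type of labels, in
    particular [tree E1 'I_n], and yields a relation after pulling back along an injection. W allows
    repeated labels; its map to the composite sends trees with repeated or missing labels to 0.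

    In the converse, the composite product does not involve D, so the element that vanishes by
    injectivity of xi for D can be pushed through xi for the zero law. The form of D(a[b,c]) comes
    from exchanging b and c: this changes its sign, which excludes [a,bc] and makes the two other
    coefficients opposite, after division by 2. In the detecting algebra b and d take one value, a
    and c another, and mixed products vanish; every bracket but [bd,ac] contains a triple or a mixed
    product. *)

Section Slots.
Variables (K : fieldType) (L : finType) (V : L -> lmodType K).
Implicit Types (y z w : forall s, V s).

Lemma dfwith_id y s : dfwith y (y s) = y.
Proof.
apply: functional_extensionality_dep => j.
by case: dfwithP.
Qed.

Lemma dfwith_dfwith y s (a b : V s) : dfwith (dfwith y a) b = dfwith y b.
Proof.
apply: functional_extensionality_dep => j.
by have [<-|sj] := eqVneq s j; rewrite ?dfwith_in ?dfwith_out.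
Qed.

(** The family [z] is turned into [y] one slot at a time. Intermediate families take each value from
    [y] or from [z], so the old value at the slot being replaced is known up to this alternative. *)
Lemma slot_replace_ind (P : (forall s, V s) -> Prop) y z : P z ->
  (forall s w, (forall j, w j = y j \/ w j = z j) -> P w -> P (dfwith w (y s))) ->
  P y.
Proof.
move=> Pz step.
have H (r : seq L) : exists w,
    [/\ P w, forall j, w j = y j \/ w j = z j & forall j, j \in r -> w j = y j].
  elim: r => [|s r [w [Pw wyz wr]]]; first by exists z; split=> // j; right.
  exists (dfwith w (y s)); split; first exact: step.
    by move=> j; case: dfwithP => [|{}j _]; [left|exact: wyz].
  move=> j; rewrite inE; have [<-|sj] := eqVneq s j; first by rewrite dfwith_in.
  by rewrite dfwith_out //= => /wr.
have [w [Pw _ wE]] := H (enum L).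
suff <- : w = y by [].
by apply: functional_extensionality_dep => j; apply: wE; rewrite mem_enum.
Qed.

(** Multilinear form of span induction: a property that defines a submodule in each slot separately
    only has to be checked on families of generators. *)
Lemma slot_span_ind (B : forall s, set (V s)) (P : (forall s, V s) -> Prop) :
  (forall y s, submodule (fun v : V s => P (dfwith y v))) ->
  (forall y, (forall s, B s (y s)) -> P y) ->
  forall y, (forall s, span (B s) (y s)) -> P y.
Proof.
move=> Psub PB y ySpan.
(* [r] lists the slots not yet known to hold generators; the induction empties it. *)
suff H (r : seq L) z : (forall s, z s = y s \/ B s (z s)) ->
    (forall s, s \notin r -> B s (z s)) -> P z.
  by apply: (H (enum L)) => s; [left|rewrite mem_enum].
elim: r z => [|s r IHr] z zyB zB; first by apply: PB => s; apply: zB.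
have [zs|] := zyB s; last first.
  move=> Bs; apply: IHr => // j jr; have [<-//|sj] := eqVneq s j.
  by apply: zB; rewrite inE negb_or eq_sym sj.
rewrite -(dfwith_id z s) zs; apply: (ySpan s (fun v => P (dfwith z v))) => // b bB.
apply: IHr => j; have [<-|sj] := eqVneq s j; rewrite ?dfwith_in ?dfwith_out //.
- by right.
- by move=> jr; apply: zB; rewrite inE negb_or eq_sym sj.
Qed.

Variable W : lmodType K.

(** Multilinearity for dependent families: [dfwith y v] is [y] with its value at the implicit slot
    [s] replaced by [v]. *)
Definition slotwise_linear (F : (forall s, V s) -> W) :=
  forall y s, linear (fun v : V s => F (dfwith y v)).

Lemma slotwise_submodule F y s : slotwise_linear F ->
  submodule (fun v : V s => F (dfwith y v) = 0).
Proof.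
move=> Flin; split=> [|a u v Fu Fv]; last by rewrite Flin Fu Fv scaler0 addr0.
by have := Flin y s (-1) 0 0; rewrite scaler0 addr0 scaleN1r => ->; rewrite addNr.
Qed.

Lemma slotwise_eq_submodule F G y s : slotwise_linear F -> slotwise_linear G ->
  submodule (fun v : V s => F (dfwith y v) = G (dfwith y v)).
Proof.
move=> Flin Glin; split=> [|a u v Fu Fv]; last by rewrite Flin Glin Fu Fv.
by have [-> _] := slotwise_submodule y s Flin; have [-> _] := slotwise_submodule y s Glin.
Qed.

Lemma slotwise_sub F y s (u v : V s) : slotwise_linear F ->
  F (dfwith y (u - v)) = F (dfwith y u) - F (dfwith y v).
Proof. by move=> Flin; rewrite addrC -scaleN1r Flin scaleN1r addrC. Qed.

(** This is how multilinear maps descend to quotients, [N s] being the null space at slot [s]. The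
    condition [N s 0] serves the slots where the intermediate family already agrees with [y]. *)
Lemma slotwise_congr F (N : forall s, set (V s)) y z : slotwise_linear F ->
  (forall w s v, N s v -> F (dfwith w v) = 0) ->
  (forall s, N s 0) ->
  (forall s, N s (y s - z s)) -> F y = F z.
Proof.
move=> Flin FN N0 yz; apply: (@slot_replace_ind (fun w => F w = F z) y z) => //.
move=> s w wE <-; rewrite -[in RHS](dfwith_id w s).
apply/eqP; rewrite -subr_eq0 -slotwise_sub //; apply/eqP; apply: FN.
by case: (wE s) => ->; rewrite ?subrr.
Qed.

End Slots.

Lemma malg_span (K : fieldType) (T : choiceType) (x : {malg K[T]}) :
  span (range (fun t : T => << t >>)) x.
Proof.
have -> : x = \sum_(t <- msupp x) x@_t *: << t >>.
  rewrite [LHS]monalgE; apply: eq_bigr => t _; apply/malgP => u.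
  by rewrite mcoeffZ !mcoeffU mulrnAr mulr1.
have [S0 SD] := @span_submodule K {malg K[T]} (range (fun t : T => << t >>)).
elim: (enum_fset (msupp x)) => [|t r IHr]; first by rewrite big_nil.
by rewrite big_cons; apply: SD => //; apply: sub_span; exists t.
Qed.

Lemma slot_coefficient (K : fieldType) (a p q A c : K) :
  c * ((a * p + q) * A) = a * (c * (p * A)) + c * (q * A).
Proof. by rewrite mulrDl mulrDr -!mulrA (mulrCA c a). Qed.

(** * Multilinear extension from bases *)

Section Multiext.
Variables (K : fieldType) (W : lmodType K) (T0 : choiceType) (L : finType).
Variables (T : L -> choiceType) (f : T0 -> (forall s, T s) -> W).

(** [multiext] sums over choices from the supports of [y], an index type that changes with [y].
    Enlarging the supports to a common [D] makes sums for different families comparable; the added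
    terms have coefficient 0. *)
Lemma multiextE x (y : forall s, {malg K[T s]}) (D : forall s, {fset T s}) :
  (forall s, msupp (y s) `<=` D s)%fset ->
  multiext f x y = \sum_(t <- msupp x) \sum_(u : {dffun forall s : L, D s})
    (x@_t * \prod_s (y s)@_(val (u s))) *: f t (fun s => val (u s)).
Proof.
move=> yD; apply: eq_bigr => t _.
pose h (u : {dffun forall s : L, msupp (y s)}) : {dffun forall s : L, D s} :=
  [ffun s => fincl (yD s) (u s)].
pose k (u : {dffun forall s : L, D s}) : option {dffun forall s : L, msupp (y s)} :=
  if pselect (exists v, h v = u) is left e then Some (projT1 (cid e)) else None.
have h_inj : injective h.
  move=> u v /ffunP uv; apply/ffunP => s; have := uv s; rewrite !ffunE => e.
  by apply: val_inj; have := congr1 val e.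
have hK : pcancel h k.
  move=> u; rewrite /k; case: pselect => [e|[]]; last by exists u.
  by congr Some; apply: h_inj; case: cid.
(* Choices outside the image of [h] pick some element off the support, so their product of
   coefficients is 0. *)
rewrite [RHS](bigID (fun u => k u != None)) /= [X in _ + X]big1 ?addr0; last first.
  move=> u; rewrite negbK /k; case: pselect => // nu _.
  case: (pselect (forall s, val (u s) \in msupp (y s))) => [us|].
    case: nu; exists [ffun s => FSetSub (us s)]; apply/ffunP => s.
    by rewrite !ffunE; apply: val_inj.
  move=> /existsNP[s] /negP us.
  by rewrite (bigD1 s) //= (mcoeff_outdom us) mul0r mulr0 scale0r.
rewrite (reindex_omap h k) /=; last first.
  move=> u; rewrite /k; case: pselect => // e _; by rewrite /=; case: cid => v /= ->.
apply: eq_big => [u|u _]; first by rewrite hK /= eqxx.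
congr (_ * _ *: f t _); first by apply: eq_bigr => s _; rewrite ffunE.
by apply: functional_extensionality_dep => s; rewrite ffunE.
Qed.

Lemma multiext_slotwise x : slotwise_linear (multiext f x).
Proof.
move=> y s a v w.
(* A common index set for the three sums: the union of the three supports at each slot. *)
pose D j := (msupp (dfwith y v j) `|` msupp (dfwith y w j)
             `|` msupp (dfwith y (a *: v + w)%R j))%fset.
rewrite !(@multiextE _ _ D) => [| j | j | j].
- rewrite scaler_sumr -big_split; apply: eq_bigr => t _ /=.
  rewrite scaler_sumr -big_split; apply: eq_bigr => u _ /=.
  rewrite scalerA -scalerDl; congr (_ *: _).
  have prodE z : \prod_j (dfwith y z j)@_(val (u j)) =
      z@_(val (u s)) * \prod_(j | j != s) (y j)@_(val (u j)).
    rewrite (bigD1 s) //= dfwith_in; congr (_ * _); apply: eq_bigr => j js.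
    by rewrite dfwith_out // eq_sym.
  rewrite !prodE; set A := \prod_(_ | _) _; move: A => A; rewrite mcoeffD mcoeffZ.
  move: (v@_ _) (w@_ _) (x@_t) => p q c.
  exact: slot_coefficient.
- by apply: fsubset_trans (fsubsetUl _ _); exact: fsubsetUr.
- by apply: fsubset_trans (fsubsetUl _ _); exact: fsubsetUl.
- exact: fsubsetUr.
Qed.

Lemma multiext_root y :
  multiext f ^~ y =1 linext (fun t => \sum_(u : {dffun forall s : L, msupp (y s)})
    (\prod_s (y s)@_(val (u s))) *: f t (fun s => val (u s))).
Proof.
move=> x; apply: eq_bigr => t _; rewrite scaler_sumr; apply: eq_bigr => u _.
by rewrite scalerA.
Qed.

Lemma multiextU t (u : forall s, T s) :
  multiext f << t >> (fun s => << u s >>) = f t u.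
Proof.
rewrite (@multiextE _ _ (fun s => [fset u s]%fset)) => [|s]; last first.
  by rewrite msuppU oner_eq0 fsubset_refl.
rewrite msuppU oner_eq0 big_seq_fset1 mcoeffUU.
have uE (v : {dffun forall s : L, [fset u s]%fset}) s : val (v s) = u s.
  by apply/fset1P; exact: valP.
have memu s : u s \in [fset u s]%fset by apply/fset1P.
pose v0 : {dffun forall s : L, [fset u s]%fset} := [ffun s => FSetSub (memu s)].
rewrite (big_pred1 v0) => [|v /=].
  rewrite mul1r big1 ?scale1r => [|s _]; last by rewrite uE mcoeffUU.
  by congr f; apply: functional_extensionality_dep => s; rewrite uE.
by symmetry; apply/eqP/ffunP => s; apply: val_inj; rewrite !uE.
Qed.

End Multiext.

(** * Linear maps on spans and quotients *)

Section Span.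
Variables (K : fieldType) (V W : lmodType K).

Lemma span_ind (S U : set V) v : submodule U -> (forall x, S x -> U x) ->
  span S v -> U v.
Proof. by move=> subU SU; apply. Qed.

Lemma span_image (f : {linear V -> W}) (S : set V) (S' : set W) v :
  (forall x, S x -> span S' (f x)) -> span S v -> span S' (f v).
Proof.
move=> SS'; apply: (span_ind (U := fun v => span S' (f v))) => //.
have [S0 SD] := span_submodule S'; split=> [|a x y fx fy]; first by rewrite linear0.
by rewrite linearP; apply: SD.
Qed.

Lemma linear_fun0 (f : V -> W) : linear f -> f 0 = 0.
Proof. by move=> /(_ (-1) 0 0); rewrite scaler0 addr0 scaleN1r addNr. Qed.

Lemma linear_funB (f : V -> W) x y : linear f -> f (x - y) = f x - f y.
Proof. by move=> lin; rewrite addrC -scaleN1r lin scaleN1r addrC. Qed.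

Lemma linear_funZ (f : V -> W) a x : linear f -> f (a *: x) = a *: f x.
Proof. by move=> lin; rewrite -[a *: x]addr0 lin linear_fun0 // addr0. Qed.

Lemma linear_funD (f : V -> W) x y : linear f -> f (x + y) = f x + f y.
Proof. by move=> lin; rewrite -[x]scale1r lin !scale1r. Qed.

Lemma span_ker (f : V -> W) (S : set V) v : linear f ->
  (forall x, S x -> f x = 0) -> span S v -> f v = 0.
Proof.
move=> lin fS; apply: (span_ind (U := fun v => f v = 0)) => //.
split=> [|a x y fx fy]; first exact: linear_fun0.
by rewrite lin fx fy scaler0 addr0.
Qed.

Lemma span_eq (f g : V -> W) (S : set V) v : linear f -> linear g ->
  (forall x, S x -> f x = g x) -> span S v -> f v = g v.
Proof.
move=> linf ling fg; apply: (span_ind (U := fun v => f v = g v)) => //.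
split=> [|a x y fx fy]; first by rewrite !linear_fun0.
by rewrite linf ling fx fy.
Qed.

End Span.

Section Quotient.
Variables (K : fieldType) (V : lmodType K).

Lemma qpi_eq (S : set V) x y : qpi S x = qpi S y <-> span S (x - y).
Proof. by split=> [/eqP/qeqP|/qeqP/eqP]. Qed.

Lemma qpi_eq0 (S : set V) x : qpi S x = 0 <-> span S x.
Proof. by rewrite -(linear0 (qpi S)) qpi_eq subr0. Qed.

Lemma repr_qpi (S : set V) x : span S (repr (qpi S x) - x).
Proof. by apply/qpi_eq; rewrite /qpi reprK. Qed.

Lemma qpi_repr (S : set V) (x : quotmod S) : qpi S (repr x) = x.
Proof. exact: reprK. Qed.

End Quotient.

Section MultiextRoot.
Variables (K : fieldType) (W : lmodType K) (T0 : choiceType) (L : finType).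
Variables (T : L -> choiceType) (f : T0 -> (forall s, T s) -> W).

Lemma multiext_root_linear y : linear (multiext f ^~ y).
Proof. by move=> a u v; rewrite !multiext_root linearP. Qed.

Lemma multiext_basis_ind (P : (forall s, {malg K[T s]}) -> Prop) :
  (forall y s, submodule (fun v : {malg K[T s]} => P (dfwith y v))) ->
  (forall u : forall s, T s, P (fun s => << u s >>)) -> forall y, P y.
Proof.
move=> Psub PU y; apply: (@slot_span_ind K L (fun s => {malg K[T s]})
  (fun s => range (fun t : T s => << t >>)) P Psub) => [{}y yB|s]; last exact: malg_span.
have -> : y = fun s => << projT1 (cid2 (yB s)) >>; last exact: PU.
by apply: functional_extensionality_dep => s; case: (cid2 (yB s)).
Qed.

End MultiextRoot.

Lemma choice_dep (L : Type) (T : L -> Type) (P : forall s, T s -> Prop) :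
  (forall s, exists u, P s u) -> exists u, forall s, P s (u s).
Proof. by move=> H; exists (fun s => projT1 (cid (H s))) => s; case: (cid (H s)). Qed.

(** * Composition in the free operad *)

Section Grafting.
Variables (K : fieldType) (E : sigma2 K).
Implicit Types (L A : finType).

Lemma tree_lin_graft (L : Type) (M : L -> Type) (a : K) (t t1 t2 : tree E L)
    (u : forall s, tree E (M s)) :
  tree_lin a t t1 t2 -> tree_lin a (tgraft t u) (tgraft t1 u) (tgraft t2 u).
Proof. by elim=> *; constructor. Qed.

Lemma tree_swap_graft (L : Type) (M : L -> Type) (t t' : tree E L)
    (u : forall s, tree E (M s)) :
  tree_swap t t' -> tree_swap (tgraft t u) (tgraft t' u).
Proof. by elim=> *; constructor. Qed.

Lemma eq_tgraft (L : eqType) (M : L -> Type) (t : tree E L)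
    (u v : forall s, tree E (M s)) :
  {in leaves t, forall s, u s = v s} -> tgraft t u = tgraft t v.
Proof.
elim: t => [s|e l IHl r IHr] uv /=; first by rewrite uv ?mem_head.
by rewrite IHl ?IHr // => s s_in; apply: uv; rewrite /= mem_cat s_in ?orbT.
Qed.

Lemma uniq_leaves_node (L : eqType) (e : E) (l r : tree E L) s :
  uniq (leaves (Node e l r)) -> s \in leaves (Node e l r) ->
  [/\ uniq (leaves l), uniq (leaves r) &
      (s \in leaves l) && (s \notin leaves r) ||
      (s \notin leaves l) && (s \in leaves r)].
Proof.
rewrite /= cat_uniq mem_cat => /and3P[-> /hasPn lr ->] sin; split=> //.
case/orP: sin => sin; last by rewrite sin (lr _ sin) orbT.
by rewrite sin andTb; apply/orP; left; apply/negP => /lr /negP.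
Qed.

Lemma dfwith_notin (L : eqType) (T : L -> Type) (u : forall s, T s) s (v w : T s)
    (r : seq L) : s \notin r -> {in r, forall j, dfwith u v j = dfwith u w j}.
Proof.
move=> sr j jr; have [sj|sj] := eqVneq s j; last by rewrite !dfwith_out.
by rewrite sj jr in sr.
Qed.

(** The label [s] sits at exactly one leaf of [t], so a relation at one vertex of the grafted tree
    remains a relation at one vertex; with several copies of it the dependence would not be
    linear. *)
Lemma tree_lin_graft_input (L : eqType) (M : L -> Type) a (t : tree E L)
    (u : forall s, tree E (M s)) s (w w1 w2 : tree E (M s)) :
  uniq (leaves t) -> s \in leaves t -> tree_lin a w w1 w2 ->
  tree_lin a (tgraft t (dfwith u w)) (tgraft t (dfwith u w1)) (tgraft t (dfwith u w2)).
Proof.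
move=> + + R; elim: t => [j _ /[!inE]/eqP<-|e l IHl r IHr Ut].
  by rewrite /= !dfwith_in; exact: tree_lin_map_leaf.
move=> /(uniq_leaves_node Ut)[Ul Ur /orP[]/andP[sl sr]] /=.
  by rewrite (eq_tgraft (dfwith_notin u w1 w sr)) (eq_tgraft (dfwith_notin u w2 w sr));
     apply: TreeLinL; exact: IHl.
by rewrite (eq_tgraft (dfwith_notin u w1 w sl)) (eq_tgraft (dfwith_notin u w2 w sl));
   apply: TreeLinR; exact: IHr.
Qed.

Lemma tree_swap_graft_input (L : eqType) (M : L -> Type) (t : tree E L)
    (u : forall s, tree E (M s)) s (w w' : tree E (M s)) :
  uniq (leaves t) -> s \in leaves t -> tree_swap w w' ->
  tree_swap (tgraft t (dfwith u w)) (tgraft t (dfwith u w')).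
Proof.
move=> + + R; elim: t => [j _ /[!inE]/eqP<-|e l IHl r IHr Ut].
  by rewrite /= !dfwith_in; exact: tree_swap_map_leaf.
move=> /(uniq_leaves_node Ut)[Ul Ur /orP[]/andP[sl sr]] /=.
  by rewrite (eq_tgraft (dfwith_notin u w w' sr)); apply: TreeSwapL; exact: IHl.
by rewrite (eq_tgraft (dfwith_notin u w w' sl)); apply: TreeSwapR; exact: IHr.
Qed.

Lemma mtree_uniq L (t : mtree E L) : uniq (leaves t).
Proof. by case/andP: (mtreeP t). Qed.

Lemma mtree_mem L (t : mtree E L) s : s \in leaves t.
Proof. by case/andP: (mtreeP t) => _ /forallP. Qed.

Section Fcomp.
Variables (L : finType) (M : L -> finType).

Let graft (t : mtree E L) (u : forall s, mtree E (M s)) := ftree (mgraft t u).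

Lemma val_dfwith (u : forall s, mtree E (M s)) s (w : mtree E (M s)) :
  (fun j => val (dfwith u w j)) = dfwith (fun j => val (u j)) (val w).
Proof.
apply: functional_extensionality_dep => j.
by have [<-|sj] := eqVneq s j; rewrite ?dfwith_in ?dfwith_out.
Qed.

Lemma graft_root_rel x y : span (@free_rel K E L) x -> multiext graft x y = 0.
Proof.
apply: (span_ker (multiext_root_linear _ y)) => {}x Rx.
move: y; apply: (multiext_basis_ind (P := fun y => multiext graft x y = 0)).
  by move=> y s; exact: slotwise_submodule (multiext_slotwise _ _).
move=> u; case: Rx => [a t t1 t2 R|t t' R]; apply/eqP.
  rewrite (linear_funB _ _ (multiext_root_linear _ _)) multiext_root_linear.
  rewrite subr_eq0 !multiextU; apply/eqP/ftree_lin; exact: tree_lin_graft.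
rewrite (linear_funB _ _ (multiext_root_linear _ _)) subr_eq0 !multiextU.
by apply/eqP/ftree_swap; exact: tree_swap_graft.
Qed.

Lemma dfwithU (u : forall s, mtree E (M s)) s (w : mtree E (M s)) :
  dfwith (fun j => << u j >> : {malg K[mtree E (M j)]}) << w >> =
  fun j => << dfwith u w j >>.
Proof.
apply: functional_extensionality_dep => j.
by have [<-|sj] := eqVneq s j; rewrite ?dfwith_in ?dfwith_out.
Qed.

(** Slotwise induction with mixed generators: elements of [free_rel] at slot [s] and single trees at
    all other slots, after which the root also reduces to a single tree. *)
Lemma graft_input_rel x y s (v : {malg K[mtree E (M s)]}) :
  span (@free_rel K E (M s)) v -> multiext graft x (dfwith y v) = 0.
Proof.
pose B j : set {malg K[mtree E (M j)]} :=
  if s == j then @free_rel K E (M j) else range (fun t => << t >>).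
move=> Rv; apply: (@slot_span_ind K L (fun j => {malg K[mtree E (M j)]}) B
    (fun y => multiext graft x y = 0)) => [{}y j|{}y yB|j].
- exact: slotwise_submodule (multiext_slotwise _ _).
(* [t0] is a default value for [u] at slot [s], where [dfwith] overrides it. *)
- have [t0 _] : exists t0 : mtree E (M s), True.
    by have := yB s; rewrite /B eqxx; case=> [a t t1 t2 _|t t' _]; exists t.
  have /choice_dep[u uE] : forall j, exists u : mtree E (M j), s != j -> y j = << u >>.
    move=> j; have := yB j; rewrite /B; case: (eqVneq s j) => [<-|sj [u _ <-]].
      by exists t0.
    by exists u.
  have yE : y = dfwith (fun j => << u j >>) (y s).
    apply: functional_extensionality_dep => j.
    by have [<-|sj] := eqVneq s j; rewrite ?dfwith_in ?dfwith_out // uE.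
  have := yB s; rewrite yE /B eqxx dfwith_in => Rys.
  pose P x' := multiext graft x' (dfwith (fun j => << u j >>) (y s)) = 0.
  suff: forall x', span (range (fun t => << t >>)) x' -> P x' by apply; exact: malg_span.
  move=> x'; apply: (span_ker (multiext_root_linear _ _)) => _ [t _ <-].
  have Flin := @multiext_slotwise _ _ _ _ _ graft << t >>.
  case: Rys => [a w w1 w2 R|w w' R].
    rewrite slotwise_sub; last exact: multiext_slotwise.
    rewrite Flin !dfwithU !multiextU; apply/eqP; rewrite subr_eq0; apply/eqP/ftree_lin.
    by rewrite /= !val_dfwith; apply: tree_lin_graft_input => //;
       [exact: mtree_uniq|exact: mtree_mem].
  rewrite slotwise_sub; last exact: multiext_slotwise.
  rewrite !dfwithU !multiextU; apply/eqP; rewrite subr_eq0; apply/eqP/ftree_swap.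
  by rewrite /= !val_dfwith; apply: tree_swap_graft_input => //;
     [exact: mtree_uniq|exact: mtree_mem].
- have [<-|sj] := eqVneq s j; first by rewrite /B eqxx dfwith_in.
  by rewrite /B (negbTE sj); exact: malg_span.
Qed.

(** By the two vanishing lemmas, [fcomp], defined through chosen representatives, may be computed
    from any representatives. *)
Lemma fcompE x (y : forall s, {malg K[mtree E (M s)]}) :
  fcomp (qpi (@free_rel K E L) x) (fun s => qpi (@free_rel K E (M s)) (y s)) =
  multiext graft x y.
Proof.
rewrite /fcomp -/graft; set z := fun s => repr _.
have -> : multiext graft (repr (qpi (@free_rel K E L) x)) z = multiext graft x z.
  apply/eqP; rewrite -subr_eq0 -(linear_funB _ _ (multiext_root_linear _ _)).
  by rewrite graft_root_rel //; exact: repr_qpi.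
apply: (@slotwise_congr K L (fun s => {malg K[mtree E (M s)]}) _ _
  (fun s => span (@free_rel K E (M s)))).
- exact: multiext_slotwise.
- by move=> w s v; exact: graft_input_rel.
- by move=> s; have [] := span_submodule (@free_rel K E (M s)).
- by move=> s; exact: repr_qpi.
Qed.

Lemma fcomp_tree (t : mtree E L) (u : forall s, mtree E (M s)) :
  fcomp (ftree t) (fun s => ftree (u s)) = ftree (mgraft t u).
Proof. by rewrite fcompE multiextU. Qed.

Lemma fcomp_root_linear (y : forall s, free E (M s)) : linear (fun x => fcomp x y).
Proof.
have -> : y = fun s => qpi _ (repr (y s)).
  by apply: functional_extensionality_dep => s; rewrite qpi_repr.
move=> a x1 x2; rewrite -(qpi_repr x1) -(qpi_repr x2) -linearP !fcompE.
exact: multiext_root_linear.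
Qed.

Lemma fcomp_slotwise (x : free E L) :
  slotwise_linear (fcomp x : (forall s, free E (M s)) -> free E _).
Proof.
move=> y s a v1 v2.
have yE v : dfwith y (qpi (@free_rel K E (M s)) v) =
    fun j => qpi _ (dfwith (fun j => repr (y j)) v j).
  apply: functional_extensionality_dep => j.
  by have [<-|sj] := eqVneq s j; rewrite ?dfwith_in ?dfwith_out ?qpi_repr.
rewrite -(qpi_repr x) -(qpi_repr v1) -(qpi_repr v2) -linearP !yE !fcompE.
exact: multiext_slotwise.
Qed.

End Fcomp.
End Grafting.
Lemma span_congr (K : fieldType) (V W : lmodType K) (f : V -> W) (S : set V) x y :
  linear f -> (forall v, S v -> f v = 0) -> span S (x - y) -> f x = f y.
Proof.
move=> flin fS xy; apply/eqP; rewrite -subr_eq0 -(linear_funB _ _ flin).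
by rewrite (span_ker flin fS).
Qed.

Lemma slot_range_ind (K : fieldType) (L : finType) (V : L -> lmodType K)
    (T : L -> Type) (b : forall s, T s -> V s) (P : (forall s, V s) -> Prop) :
  (forall s v, span (range (b s)) v) ->
  (forall y s, submodule (fun v : V s => P (dfwith y v))) ->
  (forall u : forall s, T s, P (fun s => b s (u s))) -> forall y, P y.
Proof.
move=> bspan Psub PU y.
apply: (@slot_span_ind K L V (fun s => range (b s)) P Psub) => [{}y yB|s //].
have -> : y = fun s => b s (projT1 (cid2 (yB s))) by
  apply: functional_extensionality_dep => s; case: (cid2 (yB s)).
exact: PU.
Qed.

Lemma slotwise_ext (K : fieldType) (L : finType) (V : L -> lmodType K)
    (W : lmodType K) (T : L -> Type) (b : forall s, T s -> V s)
    (F G : (forall s, V s) -> W) :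
  (forall s v, span (range (b s)) v) -> slotwise_linear F -> slotwise_linear G ->
  (forall u : forall s, T s, F (fun s => b s (u s)) = G (fun s => b s (u s))) ->
  F =1 G.
Proof.
move=> bspan Flin Glin FG.
apply: (@slot_range_ind K L V T b (fun y => F y = G y) bspan _ FG) => y s.
exact: slotwise_eq_submodule.
Qed.

Lemma slotwise_comp (K : fieldType) (L : finType) (V V' : L -> lmodType K)
    (W : lmodType K) (F : (forall s, V' s) -> W) (g : forall s, V s -> V' s) :
  slotwise_linear F -> (forall s, linear (g s)) ->
  slotwise_linear (fun y => F (fun s => g s (y s))).
Proof.
move=> Flin glin y s a v w.
have E x : (fun j => g j (dfwith y x j)) = dfwith (fun j => g j (y j)) (g s x).
  apply: functional_extensionality_dep => j.
  by have [<-|sj] := eqVneq s j; rewrite ?dfwith_in ?dfwith_out.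
by rewrite !E glin Flin.
Qed.

Lemma slotwise_reindex (K : fieldType) (L : finType) (V : L -> lmodType K)
    (W : lmodType K) (s : {perm L}) (F : (forall i, V (s i)) -> W) :
  slotwise_linear F -> slotwise_linear (fun y : forall i, V i => F (fun i => y (s i))).
Proof.
(* Slot [j] of [y] is slot [i] of the reindexed family; writing [j] as [s i] makes the types of the
   two slots match. *)
move=> Flin y j; rewrite -(permKV s j); set i := (s^-1)%g j => a v w.
have E (x : V (s i)) : (fun k => dfwith y x (s k)) = dfwith (fun k => y (s k)) x.
  apply: functional_extensionality_dep => k.
  have [<-|ik] := eqVneq i k; first by rewrite !dfwith_in.
  by rewrite !dfwith_out // (inj_eq perm_inj).
by rewrite !E Flin.
Qed.

Lemma slotwise_post (K : fieldType) (L : finType) (V : L -> lmodType K)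
    (W W' : lmodType K) (F : (forall i, V i) -> W) (g : W -> W') :
  linear g -> slotwise_linear F -> slotwise_linear (fun y => g (F y)).
Proof. by move=> glin Flin y s a v w; rewrite Flin glin. Qed.

Lemma linear_fun_comp (K : fieldType) (U V W : lmodType K) (f : V -> W) (g : U -> V) :
  linear f -> linear g -> linear (fun x => f (g x)).
Proof. by move=> lf lg a x y; rewrite lg lf. Qed.

Definition mklinear (K : fieldType) (V W : lmodType K) (f : V -> W) (H : linear f) :
  {linear V -> W} := HB.pack f (GRing.isLinear.Build K V W _ f H).

Lemma qpi_lin (K : fieldType) (V : lmodType K) (S : set V) : linear (qpi S).
Proof. exact: qpi_is_linear. Qed.

(** * Composition in the quotient operad, computed on trees *)

Section OperadTrees.
Variables (K : fieldType) (E : sigma2 K).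
Implicit Types (A B L : finType).

Lemma free_span A (x : free E A) : span (range (@ftree K E A)) x.
Proof.
rewrite -[x]qpi_repr.
apply: (@span_image _ _ _ (qpi (@free_rel K E A)) (range (fun t => << t >>))) => [_ [t _ <-]|].
  by apply: sub_span; exists t.
exact: malg_span.
Qed.

Variable R : set (free E 'I_3).

Definition otree A (t : mtree E A) : operad R A := qpi (ideal R A) (ftree t).

Lemma operad_span A (x : operad R A) : span (range (@otree A)) x.
Proof.
rewrite -[x]qpi_repr.
apply: (@span_image _ _ _ (qpi (ideal R A)) (range (@ftree K E A))) => [_ [t _ <-]|].
  by apply: sub_span; exists t.
exact: free_span.
Qed.

Lemma span_ideal A x : span (ideal R A) x -> ideal R A x.
Proof. by apply; [exact: (ideal_submodule (ideal_closed R))|]. Qed.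

Lemma sub_ideal x : R x -> ideal R 'I_3 x.
Proof. by move=> Rx I II; apply. Qed.

Lemma operad_eq0 A (x : free E A) : qpi (ideal R A) x = 0 <-> ideal R A x.
Proof.
rewrite qpi_eq0; split=> [|Ix]; [exact: span_ideal|exact: sub_span].
Qed.

Lemma ideal_fcomp_root L (M : L -> finType) x (y : forall s, free E (M s)) :
  ideal R L x -> ideal R {s : L & M s} (fcomp x y).
Proof. by have [_ _ + _] := ideal_closed R; apply. Qed.

Lemma ideal_fcomp_input L (M : L -> finType) x (y : forall s, free E (M s)) s :
  ideal R (M s) (y s) -> ideal R {s : L & M s} (fcomp x y).
Proof. by have [_ _ _ +] := ideal_closed R; apply. Qed.

Section Comp.
Variables (L : finType) (M : L -> finType).

(** The choice of representatives does not matter because [ideal R] absorbs composition at the root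
    and at every input. *)
Lemma ocompE x (y : forall s, free E (M s)) :
  ocomp (qpi (ideal R L) x) (fun s => qpi (ideal R (M s)) (y s)) =
  qpi (ideal R _) (fcomp x y).
Proof.
rewrite /ocomp; set z := fun s => repr _.
have qlin : linear (qpi (ideal R {s : L & M s})) by move=> a u v; rewrite linearP.
have zN s : ideal R (M s) (z s - y s) by apply: span_ideal; exact: repr_qpi.
transitivity (qpi (ideal R _) (fcomp x z)).
  apply: (@span_congr K (free E L) (operad R _) (fun x' => qpi (ideal R _) (fcomp x' z))
    (ideal R L) (repr (qpi (ideal R L) x)) x); last exact: repr_qpi.
    exact: linear_fun_comp qlin (fcomp_root_linear z).
  by move=> x' Ix'; apply/operad_eq0; exact: ideal_fcomp_root.
apply: (@slotwise_congr K L (fun s => free E (M s)) _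
  (fun y => qpi (ideal R _) (fcomp x y)) (fun s => ideal R (M s))) => //.
- exact: slotwise_post qlin (@fcomp_slotwise _ _ _ _ _).
- move=> w s v Nv /=; apply/operad_eq0.
  by apply: (@ideal_fcomp_input _ _ _ _ s); rewrite dfwith_in.
- by move=> s; have [] := ideal_submodule (ideal_closed R) (M s).
Qed.

Lemma ocomp_tree t (u : forall s, mtree E (M s)) :
  ocomp (otree t) (fun s => otree (u s)) = otree (mgraft t u).
Proof. by rewrite ocompE fcomp_tree. Qed.

Lemma ocomp_root_linear (y : forall s, operad R (M s)) :
  linear (fun x : operad R L => ocomp x y).
Proof.
have -> : y = fun s => qpi _ (repr (y s)).
  by apply: functional_extensionality_dep => s; rewrite qpi_repr.
move=> a x1 x2; rewrite -(qpi_repr x1) -(qpi_repr x2) -linearP !ocompE.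
exact: linear_fun_comp (qpi_lin (ideal R _)) (fcomp_root_linear _) a (repr x1) (repr x2).
Qed.

Lemma ocomp_slotwise (x : operad R L) :
  slotwise_linear (ocomp x : (forall s, operad R (M s)) -> operad R _).
Proof.
move=> y s a v1 v2.
have yE v : dfwith y (qpi (ideal R (M s)) v) =
    fun j => qpi _ (dfwith (fun j => repr (y j)) v j).
  apply: functional_extensionality_dep => j.
  by have [<-|sj] := eqVneq s j; rewrite ?dfwith_in ?dfwith_out ?qpi_repr.
rewrite -(qpi_repr x) -(qpi_repr v1) -(qpi_repr v2) -linearP !yE !ocompE.
by rewrite fcomp_slotwise linearP.
Qed.

End Comp.

Lemma orename_tree A B (f : renaming A B) (t : mtree E A) :
  orename f (otree t) = otree (mrename f t).
Proof. by rewrite /otree orename_pi frename_tree. Qed.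

Lemma orename_lin A B (f : renaming A B) : linear (@orename K E R A B f).
Proof. exact: orename_is_linear. Qed.

End OperadTrees.

(** * Functoriality of the free operad in its generating operations *)

Section OperationMap.
Variables (K : fieldType) (E E' : sigma2 K) (h : E -> E').
Hypotheses (h_linear : linear h) (h_swap : forall e, h (swap e) = swap (h e)).
Implicit Types (A B L : finType).

Lemma fmap_op_rel A x : @free_rel K E A x -> linext (fun t => ftree (mtmap_op h t)) x = 0.
Proof.
case=> [a t t1 t2 R|t t' R]; apply/eqP; rewrite linearB subr_eq0.
  rewrite linearP /= !linextU; apply/eqP/ftree_lin.
  by rewrite /=; elim: R => *; rewrite /= ?h_linear; constructor.
rewrite /= !linextU; apply/eqP/ftree_swap.
by rewrite /=; elim: R => *; rewrite /= ?h_swap; constructor.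
Qed.

Lemma fmap_op_linear A : linear (@fmap_op K E E' h A).
Proof. exact: qlift_is_linear (@fmap_op_rel A). Qed.

Lemma fmap_op_tree A (t : mtree E A) : fmap_op h (ftree t) = ftree (mtmap_op h t).
Proof. by rewrite /fmap_op /ftree (qlift_pi (@fmap_op_rel A)) /= linextU. Qed.

Lemma tmap_op_map_leaf (L L' : Type) (f : L -> L') (t : tree E L) :
  tmap_op h (tmap_leaf f t) = tmap_leaf f (tmap_op h t).
Proof. by elim: t => //= e l -> r ->. Qed.

Lemma tmap_op_graft (L : Type) (M : L -> Type) (t : tree E L)
    (u : forall s, tree E (M s)) :
  tmap_op h (tgraft t u) = tgraft (tmap_op h t) (fun s => tmap_op h (u s)).
Proof. by elim: t => [s|e l /= -> r ->] //=; rewrite tmap_op_map_leaf. Qed.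

Lemma fmap_op_rename A B (f : renaming A B) x :
  fmap_op h (frename f x) = frename f (fmap_op h x).
Proof.
apply: (@span_eq K (free E A) (free E' B) (fun x => fmap_op h (frename f x))
  (fun x => frename f (fmap_op h x)) (range (@ftree K E A)) x)
  => [||_ [t _ <-]|]; last exact: free_span.
- exact: linear_fun_comp (@fmap_op_linear B) (@frename_is_linear K E A B f).
- exact: linear_fun_comp (@frename_is_linear K E' A B f) (@fmap_op_linear A).
rewrite /= frename_tree !fmap_op_tree frename_tree; congr ftree.
by apply: val_inj; rewrite /= tmap_op_map_leaf.
Qed.

Lemma fmap_op_comp L (M : L -> finType) x (y : forall s, free E (M s)) :
  fmap_op h (fcomp x y) = fcomp (fmap_op h x) (fun s => fmap_op h (y s)).
Proof.
apply: (@span_eq K (free E L) (free E' _) (fun x => fmap_op h (fcomp x y))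
  (fun x => fcomp (fmap_op h x) (fun s => fmap_op h (y s))) (range (@ftree K E L)) x)
  => [||_ [t _ <-]|]; last exact: free_span.
- exact: linear_fun_comp (@fmap_op_linear _) (fcomp_root_linear y).
- exact: linear_fun_comp (fcomp_root_linear _) (@fmap_op_linear L).
move: y; apply: (@slotwise_ext K L (fun s => free E (M s)) (free E' _) _
  (fun s => @ftree K E (M s)) (fun y => fmap_op h (fcomp (ftree t) y))
  (fun y => fcomp (fmap_op h (ftree t)) (fun s => fmap_op h (y s)))) => [s v|||u].
- exact: free_span.
- exact: slotwise_post (@fmap_op_linear _) (@fcomp_slotwise K E L M (ftree t)).
- exact: slotwise_comp (@fcomp_slotwise K E' L M _) (fun s => @fmap_op_linear (M s)).
rewrite fcomp_tree !fmap_op_tree.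
have -> : (fun s => fmap_op h (ftree (u s))) = fun s => ftree (mtmap_op h (u s)).
  by apply: functional_extensionality_dep => s; rewrite fmap_op_tree.
by rewrite fcomp_tree; congr ftree; apply: val_inj; rewrite /= tmap_op_graft.
Qed.

(** The preimage of [ideal R'] under [fmap_op h] is itself an operad ideal, and [ideal R] lies in
    every operad ideal that contains [R]. *)
Lemma fmap_op_ideal (R : set (free E 'I_3)) (R' : set (free E' 'I_3)) A x :
  (forall r, R r -> ideal R' 'I_3 (fmap_op h r)) ->
  ideal R A x -> ideal R' A (fmap_op h x).
Proof.
move=> RR' Ix; apply: (Ix (fun A x => ideal R' A (fmap_op h x))); last exact: RR'.
split=> {A x Ix} [A|A B f x Ix|L M x y Ix|L M x y s Ix].
- have [I0 ID] := ideal_submodule (ideal_closed R') A; split=> [|a x y Ix Iy].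
    by rewrite (linear_fun0 (@fmap_op_linear A)).
  have e : fmap_op h (a *: x + y) = a *: fmap_op h x + fmap_op h y.
    exact: fmap_op_linear.
  rewrite e; exact: (ID a _ _ Ix Iy).
- rewrite fmap_op_rename; exact: (ideal_rename (ideal_closed R') _ Ix).
- rewrite fmap_op_comp; exact: (ideal_fcomp_root _ Ix).
- rewrite fmap_op_comp; exact: (@ideal_fcomp_input K E' R' L M _ _ s Ix).
Qed.

End OperationMap.

(** * The map xi *)

Section Xi.
Variables (K : fieldType) (E1 E2 : sigma2 K).
Variables (R1 : set (free E1 'I_3)) (R2 : set (free E2 'I_3)).
Variable D : free12 E1 E2 -> free21 E1 E2.
Implicit Types (A : finType).

Let E := sigma2_sum E1 E2.
Let P1 := operad_smodule R1.
Let P2 := operad_smodule R2.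
Let R := rel_total R1 R2 D.

Lemma inl_op_linear : linear (@inl_op K E1 E2).
Proof. by move=> a x y; rewrite /inl_op; congr pair; rewrite /= scaler0 addr0. Qed.

Lemma inr_op_linear : linear (@inr_op K E1 E2).
Proof. by move=> a x y; rewrite /inr_op; congr pair; rewrite /= scaler0 addr0. Qed.

Lemma inl_op_swap e : inl_op E2 (swap e) = swap (inl_op E2 e) :> E.
Proof. by rewrite /inl_op /= /pair_swap /= linear0. Qed.

Lemma inr_op_swap e : inr_op E1 (swap e) = swap (inr_op E1 e) :> E.
Proof. by rewrite /inr_op /= /pair_swap /= linear0. Qed.

Lemma canon1_rel A x : ideal R1 A x ->
  qpi (ideal R A) (@fmap_op K E1 E (@inl_op K E1 E2) A x) = 0.
Proof.
move=> Ix /=; apply/operad_eq0; apply: fmap_op_ideal Ix => [||r Rr].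
- exact: inl_op_linear.
- exact: inl_op_swap.
by apply: sub_ideal => //; apply: sub_span; left; left; exists r.
Qed.

Lemma canon2_rel A x : ideal R2 A x ->
  qpi (ideal R A) (@fmap_op K E2 E (@inr_op K E1 E2) A x) = 0.
Proof.
move=> Ix /=; apply/operad_eq0; apply: fmap_op_ideal Ix => [||r Rr].
- exact: inr_op_linear.
- exact: inr_op_swap.
by apply: sub_ideal => //; apply: sub_span; right; exists r.
Qed.

Let f1 A := mklinear (linear_fun_comp (qpi_lin (ideal R A))
  (fmap_op_linear inl_op_linear inl_op_swap (A := A))).
Let f2 A := mklinear (linear_fun_comp (qpi_lin (ideal R A))
  (fmap_op_linear inr_op_linear inr_op_swap (A := A))).

Lemma canon1_linear A : linear (@canon1 K E1 E2 R1 R2 D A).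
Proof. exact: (@qlift_is_linear _ _ _ _ (f1 A)) (@canon1_rel A). Qed.

Lemma canon2_linear A : linear (@canon2 K E1 E2 R1 R2 D A).
Proof. exact: (@qlift_is_linear _ _ _ _ (f2 A)) (@canon2_rel A). Qed.

Lemma canon1_tree A t :
  canon1 R2 D (otree R1 t) = otree R (mtmap_op (@inl_op K E1 E2) t : mtree E A).
Proof.
have := @qlift_pi _ _ _ _ (f1 A) (@canon1_rel A) (ftree t).
rewrite /= => eq; apply: etrans eq _.
by rewrite (fmap_op_tree inl_op_linear inl_op_swap).
Qed.

Lemma canon2_tree A t :
  canon2 R1 D (otree R2 t) = otree R (mtmap_op (@inr_op K E1 E2) t : mtree E A).
Proof.
have := @qlift_pi _ _ _ _ (f2 A) (@canon2_rel A) (ftree t).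
rewrite /= => eq; apply: etrans eq _.
by rewrite (fmap_op_tree inr_op_linear inr_op_swap).
Qed.

(** The value of [xi] on a formal composite, with root, arguments and labelling as separate
    parameters so that linearity in each of them can be stated. *)
Definition xi_gen n l (x : P2 l) (m : 'I_l -> nat) (y : forall s, P1 (m s))
    (f : renaming {s : 'I_l & 'I_(m s)} 'I_n) : operad R 'I_n :=
  orename f (ocomp (canon2 R1 D x) (fun s => canon1 R2 D (y s))).

Lemma xi_gen_root_linear n l m y f : linear (fun x : P2 l => @xi_gen n l x m y f).
Proof.
pose C := fun s => canon1 R2 D (y s).
exact: linear_fun_comp (orename_lin f)
  (linear_fun_comp (ocomp_root_linear C) (@canon2_linear 'I_l)).
Qed.

Lemma xi_gen_slotwise n l x m f :
  slotwise_linear (fun y : forall s, P1 (m s) => @xi_gen n l x m y f).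
Proof.
have H := @slotwise_comp K 'I_l (fun s => P1 (m s)) (fun s => operad R 'I_(m s))
  _ _ _ (ocomp_slotwise (canon2 R1 D x)) (fun s => @canon1_linear 'I_(m s)).
exact: slotwise_post (orename_lin f) H.
Qed.

Lemma xi_gen_tree n l q m (u : forall s, mtree E1 'I_(m s)) f :
  @xi_gen n l (otree R2 q) m (fun s => otree R1 (u s)) f =
  otree R (mrename f (mgraft (mtmap_op (@inr_op K E1 E2) q)
    (fun s => mtmap_op (@inl_op K E1 E2) (u s)))).
Proof.
rewrite /xi_gen canon2_tree.
have -> : (fun s => canon1 R2 D (otree R1 (u s))) =
    fun s => otree R (mtmap_op (@inl_op K E1 E2) (u s)).
  by apply: functional_extensionality_dep => s; rewrite canon1_tree.
by rewrite ocomp_tree orename_tree.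
Qed.

Lemma tmap_leaf_comp (G : Type) (A B C : Type) (f : A -> B) (g : B -> C) (t : tree G A) :
  tmap_leaf g (tmap_leaf f t) = tmap_leaf (g \o f) t.
Proof. by elim: t => //= e l -> r ->. Qed.

Lemma eq_tmap_leaf (G : Type) (A B : Type) (f g : A -> B) (t : tree G A) :
  f =1 g -> tmap_leaf f t = tmap_leaf g t.
Proof. by move=> fg; elim: t => [a|e l IHl r IHr] /=; rewrite ?fg ?IHl ?IHr. Qed.

(** Both sides are linear in the root and in every argument, so trees suffice; on trees the two
    relabelled graftings coincide. *)
Lemma xi_gen_act_root n l (x : P2 l) m (y : forall s, P1 (m s)) f (s : 'S_l) :
  @xi_gen n l (act s x) m y f =
  @xi_gen n l x _ (fun i => y (s i)) (renaming_comp f (reindex_root m s)).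
Proof.
apply: (@span_eq K (P2 l) (operad R 'I_n) (fun x => @xi_gen n l (act s x) m y f)
  (fun x => @xi_gen n l x _ (fun i => y (s i)) (renaming_comp f (reindex_root m s)))
  (range (@otree _ _ R2 'I_l)) x) => [||_ [t _ <-]|]; last exact: operad_span.
- exact: linear_fun_comp (@xi_gen_root_linear n l m y f) (@act_linear _ P2 l s).
- exact: xi_gen_root_linear.
move: y; apply: (@slotwise_ext K 'I_l (fun s => P1 (m s)) (operad R 'I_n) _
  (fun s => @otree _ _ R1 'I_(m s)) (fun y => @xi_gen n l (act s (otree R2 t : P2 l)) m y f)
  (fun y => @xi_gen n l (otree R2 t) _ (fun i => y (s i))
    (renaming_comp f (reindex_root m s)))) => [i v|||u].
- exact: operad_span.
- exact: xi_gen_slotwise.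
- exact: (@slotwise_reindex K 'I_l (fun s => P1 (m s)) _ s _ (xi_gen_slotwise _ _)).
rewrite /= orename_tree !xi_gen_tree; congr otree; apply: val_inj => /=.
elim: (val t) => [i|e a IHa b IHb] /=; last by rewrite IHa IHb.
by rewrite !tmap_leaf_comp; apply: eq_tmap_leaf.
Qed.

Lemma xi_gen_act_args n l (x : P2 l) m (y : forall s, P1 (m s)) f
    (t : forall s, 'S_(m s)) :
  @xi_gen n l x m (fun s => act (t s) (y s)) f =
  @xi_gen n l x m y (renaming_comp f (reindex_args t)).
Proof.
apply: (@span_eq K (P2 l) (operad R 'I_n)
  (fun x => @xi_gen n l x m (fun s => act (t s) (y s)) f)
  (fun x => @xi_gen n l x m y (renaming_comp f (reindex_args t)))
  (range (@otree _ _ R2 'I_l)) x) => [||_ [q _ <-]|]; last exact: operad_span.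
- exact: xi_gen_root_linear.
- exact: xi_gen_root_linear.
move: y; apply: (@slotwise_ext K 'I_l (fun s => P1 (m s)) (operad R 'I_n) _
  (fun s => @otree _ _ R1 'I_(m s))
  (fun y => @xi_gen n l (otree R2 q) m (fun s => act (t s) (y s)) f)
  (fun y => @xi_gen n l (otree R2 q) m y (renaming_comp f (reindex_args t))))
  => [i v|||u].
- exact: operad_span.
- exact: (@slotwise_comp K 'I_l (fun s => P1 (m s)) (fun s => P1 (m s)) _ _ _
    (@xi_gen_slotwise n l _ m f) (fun s => @act_linear _ P1 (m s) (t s))).
- exact: xi_gen_slotwise.
have -> : (fun s => act (t s) (otree R1 (u s) : P1 (m s))) =
    fun s => otree R1 (mrename (perm_renaming (t s)) (u s)).
  by apply: functional_extensionality_dep => s; rewrite /= orename_tree.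
rewrite !xi_gen_tree; congr otree; apply: val_inj => /=.
elim: (val q) => [i|e a IHa b IHb] /=; last by rewrite IHa IHb.
rewrite !tmap_leaf_comp; elim: (val (u i)) => [j|e a IHa b IHb] //=.
by rewrite IHa IHb.
Qed.

Let G n (c : fcomposite P2 P1 n) := xi_gen (root c) (@arg _ _ _ _ c) (lab c).

(** The four cases are linearity in the root, linearity in one argument, and the two actions of
    symmetric groups. *)
Lemma xi_rel n (c : {malg K[fcomposite P2 P1 n]}) :
  @composite_rel K P2 P1 n c -> linext (@G n) c = 0.
Proof.
case=> [a l x x1 x2 m y f ->|a l x m y y1 y2 f s0 e ne|l x m y f s|l x m y f t];
  apply/eqP; rewrite linearB subr_eq0 ?linearP /= !linextU; apply/eqP.
- exact: (@xi_gen_root_linear n l m y f a x1 x2).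
(* By the side condition of [CompArg], [y1] and [y2] differ from [y] only at slot [s0], which puts
   them in the form [dfwith]. *)
- have [E1' E2'] : y1 = dfwith y (y1 s0) /\ y2 = dfwith y (y2 s0).
    split; apply: functional_extensionality_dep => j; have [<-|sj] := eqVneq s0 j;
      rewrite ?dfwith_in ?dfwith_out //; move: (ne j); rewrite eq_sym => /(_ sj)[e1 e2].
      by rewrite -e1.
    by rewrite -e2.
  rewrite /G /= E1' E2' -(dfwith_id y s0) e dfwith_dfwith !dfwith_dfwith.
  exact: (xi_gen_slotwise x f).
- exact: xi_gen_act_root.
- exact: xi_gen_act_args.
Qed.

Lemma xi_linear n : linear (@xi K E1 E2 R1 R2 D n).
Proof. exact: qlift_is_linear (@xi_rel n). Qed.

Lemma xiE n (c : fcomposite P2 P1 n) :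
  @xi K E1 E2 R1 R2 D n (qpi (@composite_rel K P2 P1 n) << c >>) = @G n c.
Proof. apply: etrans (qlift_pi (@xi_rel n) _) _; exact: linextU. Qed.

End Xi.
(** * Relations plugged into trees *)

Section TreeSubstitution.
Variable G : Type.
Implicit Types (A B L : Type).

(** Unlike in [tgraft], the substituted trees share one type of labels, so labels may collide; this
    form is needed to apply relations to arbitrary subtrees. *)
Fixpoint tsubst L A (t : tree G L) (u : L -> tree G A) : tree G A :=
  match t with Leaf s => u s | Node e l r => Node e (tsubst l u) (tsubst r u) end.

Lemma leaves_tsubst L A (t : tree G L) (u : L -> tree G A) :
  leaves (tsubst t u) = flatten [seq leaves (u s) | s <- leaves t].
Proof. by elim: t => [s|e l IHl r IHr] /=; rewrite ?cats0 // IHl IHr map_cat flatten_cat. Qed.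

Lemma tsubst_graft L (M : L -> Type) A (t : tree G L) (v : forall s, tree G (M s))
    (f : {s : L & M s} -> A) (u : L -> tree G A) :
  (forall s, u s = tmap_leaf (fun i => f (Tagged M i)) (v s)) ->
  tsubst t u = tmap_leaf f (tgraft t v).
Proof.
move=> uE; elim: t => [s|e l /= -> r ->] //=.
by rewrite uE tmap_leaf_comp; apply: eq_tmap_leaf.
Qed.

Lemma tmap_leaf_subst L A B (g : A -> B) (t : tree G L) (u : L -> tree G A) :
  tmap_leaf g (tsubst t u) = tsubst t (fun s => tmap_leaf g (u s)).
Proof. by elim: t => //= e l -> r ->. Qed.

Lemma tmap_leaf_inj A B (g : A -> B) : injective g -> injective (@tmap_leaf G A B g).
Proof.
move=> g_inj; elim=> [a|e l IHl r IHr] [b|e' l' r'] //=; first by case=> /g_inj ->.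
by case=> -> /IHl -> /IHr ->.
Qed.

Lemma tmap_leaf_id A (t : tree G A) : tmap_leaf id t = t.
Proof. by elim: t => //= e l -> r ->. Qed.

Lemma tree_pullback (A : Type) (B : eqType) (g : A -> B) (t : tree G B) :
  (forall b, b \in leaves t -> exists a, g a = b) -> exists u, tmap_leaf g u = t.
Proof.
elim: t => [b /(_ b)|e l IHl r IHr tg].
  by rewrite mem_head => /(_ isT)[a <-]; exists (Leaf a).
have [b bl|u <-] := IHl; first by apply: tg; rewrite /= mem_cat bl.
have [b br|v <-] := IHr; first by apply: tg; rewrite /= mem_cat br orbT.
by exists (Node e u v).
Qed.

Lemma multilinear_pullback (A : finType) (B : eqType) (g : A -> B) (u : tree G A) :
  injective g -> uniq (leaves (tmap_leaf g u)) ->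
  (forall a, g a \in leaves (tmap_leaf g u)) -> multilinear u.
Proof.
move=> g_inj; rewrite leaves_tmap_leaf map_inj_uniq // => Uu gu.
by rewrite /multilinear Uu; apply/forallP => a; rewrite -(mem_map g_inj).
Qed.

Lemma perm_multilinear (A : finType) (t t' : tree G A) :
  perm_eq (leaves t) (leaves t') -> multilinear t = multilinear t'.
Proof.
move=> tt'; rewrite /multilinear (perm_uniq tt'); congr (_ && _).
by apply: eq_forallb => a; rewrite (perm_mem tt').
Qed.

End TreeSubstitution.

Lemma Tagged_inj (I : eqType) (M : I -> eqType) s : injective (@Tagged I s M).
Proof. by move=> i j /eqP; rewrite -tag_eqE /tag_eq eqxx tagged_asE => /eqP. Qed.

Lemma bijective_choice (A B : Type) (f : A -> B) :
  injective f -> (forall b, exists a, f a = b) -> bijective f.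
Proof.
move=> f_inj /choice_dep[g gK]; exists g => // a.
by apply: f_inj; rewrite gK.
Qed.

Lemma flatten_uniq_inj (L A : eqType) (h : L -> seq A) (r : seq L) s s' a :
  uniq (flatten [seq h s | s <- r]) -> s \in r -> s' \in r ->
  a \in h s -> a \in h s' -> s = s'.
Proof.
elim: r => //= j r IHr; rewrite cat_uniq => /and3P[_ /hasPn jr Ur].
have notj i : i \in r -> a \in h i -> a \notin h j.
  by move=> ir ai; apply: jr; apply/flatten_mapP; exists i.
rewrite !inE => /predU1P[->|sr] /predU1P[->|s'r] // as1 as2; last exact: IHr.
- by rewrite (negbTE (notj _ s'r as2)) in as1.
- by rewrite (negbTE (notj _ sr as1)) in as2.
Qed.

Lemma flatten_uniq_in (L A : eqType) (h : L -> seq A) (r : seq L) s :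
  uniq (flatten [seq h s | s <- r]) -> s \in r -> uniq (h s).
Proof.
elim: r => //= j r IHr; rewrite cat_uniq inE => /and3P[Uj _ Ur] /predU1P[->|] //.
exact: IHr.
Qed.

(** If the leaves of the trees [u s] partition [A], then [A] is identified with pairs (block,
    position in the block), which turns a substitution into an operadic grafting. The same [f] lifts
    every other tree on the labels of a block, so it serves all terms of a relation at once. *)
Lemma relabel_blocks (G : Type) (L A : finType) (u : L -> tree G A) (r : seq L) :
  (forall s, s \in r) -> uniq (flatten [seq leaves (u s) | s <- r]) ->
  (forall a, a \in flatten [seq leaves (u s) | s <- r]) ->
  exists f : renaming {s : L & 'I_(size (leaves (u s)))} A,
  forall s (w : tree G A), perm_eq (leaves w) (leaves (u s)) ->
  exists v : mtree G 'I_(size (leaves (u s))),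
    w = tmap_leaf (fun i => f (Tagged (fun s => 'I_(size (leaves (u s)))) i)) v.
Proof.
move=> rL Ur Ar.
(* The pair (s, i) goes to the i-th leaf of [u s]. *)
pose f (x : {s : L & 'I_(size (leaves (u s)))}) := tnth (in_tuple (leaves (u (tag x)))) (tagged x).
have f_inj : injective f.
  move=> [s i] [s' i'] e; have ss' : s = s'.
    apply: (flatten_uniq_inj (h := fun s => leaves (u s)) Ur (rL s) (rL s') (a := f (Tagged _ i))).
      exact: mem_tnth.
    by rewrite e; exact: mem_tnth.
  case: _ / ss' in i' e *; congr Tagged.
  have Us := flatten_uniq_in (h := fun s => leaves (u s)) Ur (rL s).
  by move: e; rewrite /f /=; apply/tuple_uniqP.
have f_surj a : exists x, f x = a.
  have /flatten_mapP[s _ /(tnthP (in_tuple _))[i ->]] := Ar a.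
  by exists (Tagged (fun s => 'I_(size (leaves (u s)))) i).
exists (Renaming (bijective_choice f_inj f_surj)) => s w wu /=.
have /tree_pullback[v vE] : forall a, a \in leaves w -> exists i,
    (fun i : 'I_(size (leaves (u s))) => f (Tagged (fun s => 'I_(size (leaves (u s)))) i)) i = a.
  move=> a; rewrite (perm_mem wu) => /(tnthP (in_tuple _))[i ->].
  by exists i.
have mv : multilinear v.
  apply: (@multilinear_pullback G _ _
    (fun i : 'I_(size (leaves (u s))) =>
       f (Tagged (fun s => 'I_(size (leaves (u s)))) i))); last first.
  - by move=> i; rewrite vE (perm_mem wu); exact: mem_tnth.
  - by rewrite vE (perm_uniq wu); exact: (flatten_uniq_in (h := fun s => leaves (u s)) Ur).
  - by move=> i j /f_inj /Tagged_inj.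
by exists (MTree mv).
Qed.

Section Null.
Variables (K : fieldType) (E : sigma2 K) (R : set (free E 'I_3)).
Implicit Types (A L : finType).

(* Junk value: 0 unless each label of [A] occurs exactly once. *)
Definition tree_class A (t : tree E A) : operad R A := oapp (@otree K E R A) 0 (insub t).

Lemma tree_classE A (t : mtree E A) : tree_class t = otree R t.
Proof. by rewrite /tree_class valK. Qed.

Lemma tree_class_degenerate A (t : tree E A) : ~~ multilinear t -> tree_class t = 0.
Proof. by move=> Nt; rewrite /tree_class insubN. Qed.

Definition combination A (X : seq (K * tree E A)) : operad R A :=
  \sum_(z <- X) z.1 *: tree_class z.2.

Definition relabel (T T' : Type) (g : T -> T') (X : seq (K * tree E T)) :=
  [seq (z.1, tmap_leaf g z.2) | z <- X].

Definition same_leaves (T : eqType) (X : seq (K * tree E T)) :=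
  {in X &, forall z z', perm_eq (leaves z.2) (leaves z'.2)}.

(* A formal combination of trees over an arbitrary set of labels which becomes a
   relation of the operad for every injective labelling by a finite set. *)
Definition null (T : eqType) (X : seq (K * tree E T)) : Prop :=
  same_leaves X /\ forall A (g : A -> T) (Y : seq (K * tree E A)),
    injective g -> X = relabel g Y -> combination Y = 0.

Lemma null_combination A (X : seq (K * tree E A)) : null X -> combination X = 0.
Proof.
move=> [_ /(_ A id X)]; apply=> //; rewrite /relabel -[LHS]map_id.
by apply: eq_map => -[c t] /=; rewrite tmap_leaf_id.
Qed.

Lemma null_pullback (T T' : eqType) (g : T -> T') (X : seq (K * tree E T)) :
  injective g -> null (relabel g X) -> null X.
Proof.
move=> g_inj [lX nX]; split=> [z z' zX z'X|A h Y h_inj XE].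
  have := lX (z.1, tmap_leaf g z.2) (z'.1, tmap_leaf g z'.2).
  rewrite /= !leaves_tmap_leaf => /(_ (map_f _ zX) (map_f _ z'X)).
  exact: perm_map_inj.
apply: (nX A (g \o h)); first exact: inj_comp.
rewrite XE /relabel -map_comp; apply: eq_map => -[c t] /=.
by rewrite tmap_leaf_comp.
Qed.

(** The trees of [X] carry the same labels with the same multiplicities, so they are multilinear
    together or degenerate together; in the second case all their classes are 0 by convention. *)
Lemma combination_degenerate A (X : seq (K * tree E A)) : same_leaves X ->
  {z0 | z0 \in X & multilinear z0.2} + (combination X = 0).
Proof.
move=> lX; case: (pselect (exists z0, z0 \in X /\ multilinear z0.2)) => [|nX].
  by move=> /cid[z0 [? ?]]; left; exists z0.
right; rewrite /combination big_seq big1 // => z zX.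
rewrite tree_class_degenerate ?scaler0 //; apply/negP => mz.
by apply: nX; exists z.
Qed.

Lemma tree_class_graft L (M : L -> finType) A (t : mtree E L) (u : L -> tree E A)
    (v : forall s, mtree E (M s)) (f : renaming {s : L & M s} A) :
  (forall s, u s = tmap_leaf (fun i => f (Tagged M i)) (v s)) ->
  tree_class (tsubst t u) = orename f (ocomp (otree R t) (fun s => otree R (v s))).
Proof.
move=> uE; rewrite ocomp_tree orename_tree -tree_classE; congr tree_class.
exact: tsubst_graft.
Qed.

Lemma perm_flatten_map (T T' : eqType) (h : T -> seq T') (r r' : seq T) :
  perm_eq r r' -> perm_eq (flatten (map h r)) (flatten (map h r')).
Proof. by move=> rr'; apply: perm_flatten; apply: perm_map. Qed.

Lemma mtree_perm L (t t' : mtree E L) : perm_eq (leaves t) (leaves t').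
Proof.
by apply: uniq_perm; rewrite ?mtree_uniq // => s; rewrite !mtree_mem.
Qed.

Lemma combination_subst L A (X : seq (K * mtree E L)) (u : L -> tree E A) :
  \sum_(z <- X) z.1 *: otree R z.2 = 0 ->
  combination [seq (z.1, tsubst (z.2 : mtree E L) u) | z <- X] = 0.
Proof.
move=> X0; have [|[_ /mapP[[c t] _ ->] /= mt]|//] :=
  @combination_degenerate A [seq (z.1, tsubst (z.2 : mtree E L) u) | z <- X].
  move=> _ _ /mapP[[c t] _ ->] /mapP[[c' t'] _ ->] /=.
  by rewrite !leaves_tsubst; exact: perm_flatten_map (mtree_perm _ _).
case/andP: (mt); rewrite leaves_tsubst => Ut /forallP At.
have [f fE] := relabel_blocks (@mtree_mem _ _ _ t) Ut At.
have /choice_dep[v vE] := fun s => fE s (u s) (perm_refl _).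
pose F := mklinear (linear_fun_comp (orename_lin f)
  (ocomp_root_linear (R := R) (fun s => otree R (v s)))).
rewrite /combination big_map -[RHS](linear0 F) -X0 linear_sum; apply: eq_bigr => z _.
by rewrite linearZ /= (tree_class_graft _ vE).
Qed.

Lemma null_subst L (T : eqType) (X : seq (K * mtree E L)) (u : L -> tree E T) :
  \sum_(z <- X) z.1 *: otree R z.2 = 0 ->
  null [seq (z.1, tsubst (z.2 : mtree E L) u) | z <- X].
Proof.
move=> X0; split=> [|A g Y g_inj XY].
  move=> _ _ /mapP[[c t] _ ->] /mapP[[c' t'] _ ->] /=.
  by rewrite !leaves_tsubst; exact: perm_flatten_map (mtree_perm _ _).
(* The pullback of the trees [u s] along [g] reads their labels off a first term, so the empty
   combination is treated apart. *)
case: X => [|z0 X] in X0 XY *; first by case: Y XY => // _; rewrite /combination big_nil.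
have /choice_dep[u' u'E] : forall s, exists v, tmap_leaf g v = u s.
  move=> s; apply: tree_pullback => b bu; case: Y XY => // y Y [_ e _].
  have : b \in leaves (tmap_leaf g y.2).
    rewrite -e leaves_tsubst; apply/flatten_mapP; exists s => //; exact: mtree_mem.
  by rewrite leaves_tmap_leaf => /mapP[a _ ->]; exists a.
rewrite -(combination_subst u' X0); congr combination.
have rel_inj : injective (relabel g).
  apply: inj_map => -[c t] [c' t'] /= [->] e; congr pair.
  exact: (tmap_leaf_inj g_inj).
apply: rel_inj; rewrite -XY /relabel -map_comp; apply: eq_map => -[c t] /=.
rewrite tmap_leaf_subst; congr pair; congr tsubst; apply: functional_extensionality_dep => s.
by rewrite u'E.
Qed.

Definition plug (T : Type) (t : tree E bool) (r w : tree E T) :=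
  tsubst t (fun b : bool => if b then w else r).

(** Slot [true] of [t] receives the terms of the relation and slot [false] receives [r]; composition
    is linear in slot [true], so the vanishing carries over. *)
Lemma null_context (T : eqType) (X : seq (K * tree E T)) (t : mtree E bool) r :
  null X -> null [seq (z.1, plug t r z.2) | z <- X].
Proof.
move=> [lX nX].
have lP (T' : eqType) (Y : seq (K * tree E T')) (r' : tree E T') : same_leaves Y ->
    same_leaves [seq (z.1, plug t r' z.2) | z <- Y].
  move=> lY _ _ /mapP[z zY ->] /mapP[z' z'Y ->] /=; rewrite !leaves_tsubst.
  elim: (leaves t) => //= b s IHs; rewrite perm_cat //.
  by case: b; [exact: lY|].
split=> [|A g Y g_inj XY]; first exact: lP.
case: X => [|z0 X] in lX nX XY *; first by case: Y XY => // _; rewrite /combination big_nil.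
have inr (w : tree E T) y b : plug t r w = tmap_leaf g y ->
    b \in leaves w \/ b \in leaves r -> exists a, g a = b.
  move=> e bw; have : b \in leaves (tmap_leaf g y).
    rewrite -e leaves_tsubst; apply/flatten_mapP.
    by case: bw => ?; [exists true|exists false]; rewrite ?mtree_mem.
  by rewrite leaves_tmap_leaf => /mapP[a _ ->]; exists a.
have [r' rE] : exists r', tmap_leaf g r' = r.
  apply: tree_pullback => b bu; case: Y XY => // y Y [_ e _].
  by apply: (inr _ _ _ e); right.
have [X' XE] : exists X', z0 :: X = relabel g X'.
  elim: (z0 :: X) Y XY => [|[c w] X1 IH] [|[c' y] Y] //= => [_|[_ e /IH[X' ->]]].
    by exists [::].
  have [w' <-] : exists w', tmap_leaf g w' = w.
    by apply: tree_pullback => b bu; apply: (inr _ _ _ e); left.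
  by exists ((c, w') :: X').
have {XY} -> : Y = [seq (z.1, plug t r' z.2) | z <- X'].
  have rel_inj : injective (relabel g).
    apply: inj_map => -[c v] [c' v'] /= [->] e; congr pair.
    exact: (tmap_leaf_inj g_inj).
  apply: rel_inj; rewrite -XY XE /relabel -!map_comp; apply: eq_map => -[c w] /=.
  rewrite /plug tmap_leaf_subst; congr pair; congr tsubst.
  by apply: functional_extensionality_dep => -[]; rewrite ?rE.
have nX' : null X' by apply: null_pullback g_inj _; rewrite -XE; split.
have [|[_ /mapP[z1 z1X ->] /= mz]|//] :=
  @combination_degenerate A [seq (z.1, plug t r' z.2) | z <- X'].
  by apply: lP; case: nX'.
case/andP: (mz); rewrite leaves_tsubst => Uz /forallP Az.
have [f fE] := relabel_blocks (@mtree_mem _ _ _ t) Uz Az.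
have [v0 v0E] := choice_dep (fun b => fE b _ (perm_refl _)).
pose M b : finType := 'I_(size (leaves (if b then z1.2 else r'))).
pose v1 (b : bool) : mtree E (M b) := v0 b.
pose y0 (b : bool) : operad R (M b) := otree R (v1 b).
(* [z1] fixes the labels occurring at the hole. All terms of the relation share them, so all plugged
   trees are values of the single linear map [C]. *)
pose C (x : operad R (M true)) := orename f (ocomp (otree R t) (@dfwith _ _ y0 true x)).
have Clin : linear C.
  exact: linear_fun_comp (orename_lin f) (@ocomp_slotwise K E R _ _ (otree R t) _ true).
have [U UE] : exists U : seq (K * mtree E (M true)),
    X' = relabel (fun i => f (@Tagged _ true M i)) [seq (z.1, val z.2) | z <- U].
  have lX' : {in X', forall z, perm_eq (leaves z.2) (leaves z1.2)}.
    by move=> z zX; case: nX' => lX' _; apply: lX'.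
  elim: X' lX' {nX' XE z1X lP} => [|[c w] X1 IH] lX'; first by exists [::].
  have [z zX|U ->] := IH; first by apply: lX'; rewrite inE zX orbT.
  have [v vE] := fE true w (lX' _ (mem_head _ _)).
  by exists ((c, v) :: U); rewrite /= -vE.
have U0 : \sum_(z <- U) z.1 *: otree R z.2 = 0.
  have g_inj' : injective (fun i => f (@Tagged _ true M i)).
    by move=> i j /(bij_inj (renameP f)) /Tagged_inj.
  have := nX'.2 _ _ _ g_inj' UE; rewrite /combination big_map => e.
  by rewrite -[RHS]e; apply: eq_bigr => z _; rewrite tree_classE.
pose F := mklinear Clin.
rewrite /combination big_map -[RHS](linear0 F) -U0 linear_sum UE !big_map.
apply: eq_bigr => z _; rewrite linearZ /= /C /plug.
rewrite (@tree_class_graft _ _ _ t _ (@dfwith _ _ v1 true z.2) f).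
  congr (_ *: orename f (ocomp _ _)); apply: functional_extensionality_dep => b.
  by have [<-|tb] := eqVneq true b; rewrite ?dfwith_in ?dfwith_out.
case; first by rewrite dfwith_in.
by rewrite dfwith_out //; exact: (v0E false).
Qed.

End Null.

(** * The defining relations, applied to arbitrary subtrees *)

Section NullRelations.
Variables (K : fieldType) (E : sigma2 K) (R : set (free E 'I_3)).
Implicit Types (T : eqType).

Fact cherry_lr_subproof (e : E) : multilinear (Node e (Leaf true) (Leaf false)).
Proof. by apply/andP; split=> //; apply/forallP => -[]. Qed.

Fact cherry_rl_subproof (e : E) : multilinear (Node e (Leaf false) (Leaf true)).
Proof. by apply/andP; split=> //; apply/forallP => -[]. Qed.

Definition cherry_lr e : mtree E bool := MTree (cherry_lr_subproof e).
Definition cherry_rl e : mtree E bool := MTree (cherry_rl_subproof e).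

Lemma null_node_l T e (X : seq (K * tree E T)) r :
  null R X -> null R [seq (z.1, Node e z.2 r) | z <- X].
Proof. exact: (null_context (cherry_lr e)). Qed.

Lemma null_node_r T e (X : seq (K * tree E T)) l :
  null R X -> null R [seq (z.1, Node e l z.2) | z <- X].
Proof. exact: (null_context (cherry_rl e)). Qed.

Inductive ctx (T : Type) : Type :=
| Hole
| CtxL of E & ctx T & tree E T
| CtxR of E & tree E T & ctx T.

Fixpoint fill (T : Type) (c : ctx T) (t : tree E T) : tree E T :=
  match c with
  | Hole => t
  | CtxL e c r => Node e (fill c t) r
  | CtxR e l c => Node e l (fill c t)
  end.

Fixpoint ctx_comp (T : Type) (c c' : ctx T) : ctx T :=
  match c with
  | Hole => c'
  | CtxL e c r => CtxL e (ctx_comp c c') r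
  | CtxR e l c => CtxR e l (ctx_comp c c')
  end.

Lemma fill_comp (T : Type) (c c' : ctx T) t : fill (ctx_comp c c') t = fill c (fill c' t).
Proof. by elim: c => //= [e c -> r|e l c ->]. Qed.

Lemma null_fill T (c : ctx T) X :
  null R X -> null R [seq (z.1, fill c z.2) | z <- X].
Proof.
move=> nX; elim: c => [|e c IH r|e l c IH].
- by rewrite /= (eq_map (g := id)) ?map_id // => -[].
- by have := null_node_l e r IH; rewrite -map_comp.
- by have := null_node_r e l IH; rewrite -map_comp.
Qed.

Let arg T (l r : tree E T) (b : bool) := if b then l else r.

Lemma null_swap T e (l r : tree E T) :
  null R [:: (1, Node (swap e) l r); (-1, Node e r l)].
Proof.
apply: (@null_subst K E R _ T
  [:: (1, cherry_lr (swap e)); (-1, cherry_rl e)] (arg l r)).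
rewrite !big_cons big_nil /= scale1r scaleN1r addr0 /otree.
rewrite (@ftree_swap _ _ _ (cherry_lr (swap e)) (cherry_rl e)) ?subrr //.
exact: TreeSwap.
Qed.

Lemma null_lin T a e1 e2 (l r : tree E T) :
  null R [:: (1, Node (a *: e1 + e2) l r); (- a, Node e1 l r); (-1, Node e2 l r)].
Proof.
apply: (@null_subst K E R _ T
  [:: (1, cherry_lr (a *: e1 + e2)); (- a, cherry_lr e1); (-1, cherry_lr e2)] (arg l r)).
rewrite !big_cons big_nil /= scale1r scaleN1r addr0 scaleNr /otree.
rewrite (@ftree_lin _ _ _ a (cherry_lr (a *: e1 + e2)) (cherry_lr e1) (cherry_lr e2)).
  by rewrite linearP -opprD subrr.
exact: TreeLin.
Qed.

Lemma null_zero T (l r : tree E T) : null R [:: (1, Node 0 l r)].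
Proof.
apply: (@null_subst K E R _ T [:: (1, cherry_lr 0)] (arg l r)).
rewrite !big_cons big_nil /= scale1r addr0 /otree.
(* Reading the decoration 0 as [-1 *: 0 + 0] gives t = -t + t for the class of the tree. *)
have L : tree_lin (-1) (cherry_lr 0) (cherry_lr 0) (cherry_lr 0).
  by have := TreeLin (-1) (0 : E) 0 (Leaf true) (Leaf false); rewrite scaler0 addr0.
by rewrite (ftree_lin L) scaleN1r addNr linear0.
Qed.

Lemma null_relation T (X : seq (K * mtree E 'I_3)) (u : 'I_3 -> tree E T) :
  R (\sum_(z <- X) z.1 *: ftree z.2) ->
  null R [seq (z.1, tsubst (z.2 : mtree E 'I_3) u) | z <- X].
Proof.
move=> RX; apply: null_subst.
have /operad_eq0 := sub_ideal RX; rewrite linear_sum => e; rewrite -[RHS]e.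
by apply: eq_bigr => z _; rewrite linearZ.
Qed.

End NullRelations.

(** * Algebras over an operad *)

Section Evaluation.
Variables (K : fieldType) (E : sigma2 K) (V : lmodType K) (op : E -> V -> V -> V).
Hypotheses (op_linear : forall x y, linear (fun e => op e x y))
  (op_linearl : forall e y, linear (fun x => op e x y))
  (op_linearr : forall e x, linear (op e x))
  (op_swap : forall e x y, op (swap e) x y = op e y x).
Implicit Types (A B L : finType).

Fixpoint teval (T : Type) (v : T -> V) (t : tree E T) : V :=
  match t with Leaf i => v i | Node e l r => op e (teval v l) (teval v r) end.

Lemma teval_lin T (v : T -> V) a t t1 t2 : tree_lin a t t1 t2 ->
  teval v t = a *: teval v t1 + teval v t2.
Proof.
elim=> [e1 e2 l r|e {}t {}t1 {}t2 r _ IH|e l {}t {}t1 {}t2 _ IH] /=.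
- exact: op_linear.
- rewrite IH; exact: (op_linearl e (teval v r) a).
- rewrite IH; exact: (op_linearr e (teval v l) a).
Qed.

Lemma teval_swap T (v : T -> V) t t' : tree_swap t t' -> teval v t = teval v t'.
Proof. by elim=> [e l r|e {}t {}t' r _ IH|e l {}t {}t' _ IH] /=; rewrite ?op_swap ?IH. Qed.

Lemma eq_teval (T : eqType) (v w : T -> V) t :
  {in leaves t, forall i, v i = w i} -> teval v t = teval w t.
Proof.
elim: t => [i|e l IHl r IHr] vw /=; first by rewrite vw ?mem_head.
by rewrite IHl ?IHr // => i ir; apply: vw; rewrite /= mem_cat ir ?orbT.
Qed.

Lemma teval_map T T' (f : T -> T') (v : T' -> V) t :
  teval v (tmap_leaf f t) = teval (v \o f) t.
Proof. by elim: t => //= e l -> r ->. Qed.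

Lemma teval_graft T (M : T -> Type) (v : {s : T & M s} -> V) t
    (u : forall s, tree E (M s)) :
  teval v (tgraft t u) = teval (fun s => teval (fun i => v (Tagged M i)) (u s)) t.
Proof. by elim: t => [s|e l /= -> r ->] //=; rewrite teval_map. Qed.

Lemma teval_rel A (v : A -> V) x :
  @free_rel K E A x -> linext (fun t : mtree E A => teval v t) x = 0.
Proof.
case=> [a t t1 t2 R|t t' R]; apply/eqP; rewrite linearB subr_eq0.
  by rewrite linearP /= !linextU; apply/eqP/teval_lin.
by rewrite /= !linextU; apply/eqP/teval_swap.
Qed.

Definition free_eval A (v : A -> V) : free E A -> V :=
  qlift (linext (fun t : mtree E A => teval v t)).

Lemma free_eval_linear A (v : A -> V) : linear (free_eval v).
Proof. exact: qlift_is_linear (@teval_rel A v). Qed.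

Lemma free_eval_tree A (v : A -> V) t : free_eval v (ftree t) = teval v t.
Proof. by apply: etrans (qlift_pi (@teval_rel A v) _) _; exact: linextU. Qed.

Lemma free_eval_rename A B (f : renaming A B) (v : B -> V) x :
  free_eval v (frename f x) = free_eval (v \o f) x.
Proof.
apply: (@span_eq K (free E A) V (fun x => free_eval v (frename f x))
  (free_eval (v \o f)) (range (@ftree K E A)) x) => [||_ [t _ <-]|];
  last exact: free_span.
- exact: linear_fun_comp (@free_eval_linear B v) (@frename_is_linear K E A B f).
- exact: free_eval_linear.
by rewrite frename_tree !free_eval_tree /= teval_map.
Qed.

(** The label [s] has one leaf, so at each vertex only one of the two subtrees depends on the value
    there. *)
Lemma teval_slotwise (L : eqType) (t : tree E L) (v : L -> V) s :
  uniq (leaves t) -> s \in leaves t ->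
  linear (fun x => teval (@dfwith _ (fun=> V) v s x) t).
Proof.
elim: t => [j _ /[!inE] /eqP-> |e l IHl r IHr Ut] /=.
  by move=> a x y; rewrite !dfwith_in.
have notin (w : tree E L) x y : s \notin leaves w ->
    teval (@dfwith _ (fun=> V) v s x) w = teval (@dfwith _ (fun=> V) v s y) w.
  move=> sw; apply: eq_teval; exact: (@dfwith_notin _ (fun=> V)).
move=> /(uniq_leaves_node Ut)[Ul Ur /orP[]/andP[sl sr]] a x y.
  rewrite (notin r _ 0 sr) (notin r x 0 sr) (notin r y 0 sr) (IHl Ul sl a x y).
  exact: op_linearl.
rewrite (notin l _ 0 sl) (notin l x 0 sl) (notin l y 0 sl) (IHr Ur sr a x y).
exact: op_linearr.
Qed.

Lemma free_eval_comp L (M : L -> finType) (v : {s : L & M s} -> V) x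
    (y : forall s, free E (M s)) :
  free_eval v (fcomp x y) =
  free_eval (fun s => free_eval (fun i => v (Tagged M i)) (y s)) x.
Proof.
apply: (@span_eq K (free E L) V (fun x => free_eval v (fcomp x y))
  (free_eval (fun s => free_eval (fun i => v (Tagged M i)) (y s)))
  (range (@ftree K E L)) x) => [||_ [t _ <-]|]; last exact: free_span.
- exact: linear_fun_comp (@free_eval_linear _ v) (fcomp_root_linear y).
- exact: free_eval_linear.
move: y; apply: (@slotwise_ext K L (fun s => free E (M s)) V _
  (fun s => @ftree K E (M s)) (fun y => free_eval v (fcomp (ftree t) y))
  (fun y => free_eval (fun s => free_eval (fun i => v (Tagged M i)) (y s)) (ftree t)))
  => [s w|||u].
- exact: free_span.
- exact: slotwise_post (@free_eval_linear _ v) (@fcomp_slotwise K E L M (ftree t)).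
- have H : slotwise_linear (fun w : L -> V => free_eval w (ftree t)).
    move=> w s a x1 x2; rewrite !free_eval_tree.
    exact: (teval_slotwise w (mtree_uniq t) (mtree_mem t s)).
  exact: (@slotwise_comp K L (fun s => free E (M s)) (fun=> V) _ _
    (fun s => free_eval (fun i => v (Tagged M i))) H
    (fun s => @free_eval_linear (M s) _)).
rewrite fcomp_tree !free_eval_tree /= teval_graft; apply: eq_teval => s _.
by rewrite free_eval_tree.
Qed.

Variable R : set (free E 'I_3).
Hypothesis R_eval : forall r v, R r -> free_eval v r = 0.

(** The elements that vanish under every assignment of values form an operad ideal containing [R].
    Quantifying over all assignments gives stability under renaming and under composition at the
    root; at an input, each tree is linear in the argument that evaluates to 0. *)
Lemma ideal_eval A (v : A -> V) x : ideal R A x -> free_eval v x = 0.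
Proof.
pose I A x := forall v : A -> V, free_eval v x = 0.
suff opI : @operad_ideal K E I by move=> Ix; apply: (Ix I opI) => r Rr w; exact: R_eval.
split=> {A v x} [A|A B f x Ix v|L M x y Ix v|L M x y s Ix v].
- split=> [v|a x y Ix Iy v]; first exact: linear_fun0 (@free_eval_linear A v).
  apply: etrans (@free_eval_linear A v a x y) _.
  by rewrite Ix Iy scaler0 addr0.
- by rewrite free_eval_rename Ix.
- by rewrite free_eval_comp Ix.
rewrite free_eval_comp.
apply: (@span_ker K (free E L) V _ (range (@ftree K E L)) x) => [|_ [t _ <-]|].
- exact: free_eval_linear.
- rewrite free_eval_tree; set w := fun s => _.
  have w0 : w s = 0 by exact: Ix.
  have -> : w = @dfwith _ (fun=> V) w s 0 by rewrite -w0 dfwith_id.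
  exact: linear_fun0 (teval_slotwise w (mtree_uniq t) (mtree_mem t s)).
- exact: free_span.
Qed.

Definition operad_eval A (v : A -> V) : operad R A -> V := qlift (free_eval v).

Let f A (v : A -> V) := mklinear (@free_eval_linear A v).

Lemma operad_eval_linear A (v : A -> V) : linear (operad_eval v).
Proof. exact: (@qlift_is_linear _ _ _ _ (f v)) (@ideal_eval A v). Qed.

Lemma operad_eval_tree A (v : A -> V) t : operad_eval v (otree R t) = teval v t.
Proof.
by apply: etrans (@qlift_pi _ _ _ _ (f v) (@ideal_eval A v) _) _; exact: free_eval_tree.
Qed.

End Evaluation.
(** * Elements of the composite product *)

Section Presentations.
Variables (K : fieldType) (E1 E2 : sigma2 K).
Variables (R1 : set (free E1 'I_3)) (R2 : set (free E2 'I_3)) (n : nat).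

Let P1 := operad_smodule R1.
Let P2 := operad_smodule R2.

Definition composite_class l (x : P2 l) (m : 'I_l -> nat) (y : forall s, P1 (m s))
    (f : renaming {s : 'I_l & 'I_(m s)} 'I_n) : composite P2 P1 n :=
  qpi (@composite_rel K P2 P1 n) << @FComposite K P2 P1 n l x m y f >>.

Lemma composite_eq x y : @composite_rel K P2 P1 n (x - y) ->
  qpi (@composite_rel K P2 P1 n) x = qpi (@composite_rel K P2 P1 n) y.
Proof. by move=> xy; apply/qpi_eq; exact: sub_span. Qed.

Lemma composite_class_linear l m y f :
  linear (fun x : P2 l => @composite_class l x m y f).
Proof.
move=> a x1 x2; rewrite /composite_class -linearP.
by apply: composite_eq; apply: CompRoot.
Qed.

Lemma composite_class_slotwise l x m f :
  slotwise_linear (fun y : forall s, P1 (m s) => @composite_class l x m y f).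
Proof.
move=> y s a v w; rewrite /composite_class -linearP.
apply: composite_eq; apply: (@CompArg _ _ _ _ _ _ _ _ _ _ _ _ s); first by rewrite !dfwith_in.
by move=> j js; rewrite !dfwith_out // eq_sym.
Qed.

Lemma composite_class_act_root l (x : P2 l) m y f (s : 'S_l) :
  @composite_class l (act s x) m y f =
  composite_class x (fun i => y (s i)) (renaming_comp f (reindex_root m s)).
Proof. by apply: composite_eq; apply: CompActRoot. Qed.

Lemma composite_class_act_args l (x : P2 l) m (y : forall s, P1 (m s)) f
    (t : forall s, 'S_(m s)) :
  composite_class x (fun s => act (t s) (y s)) f =
  composite_class x y (renaming_comp f (reindex_args t)).
Proof. by apply: composite_eq; apply: CompActArgs. Qed.

Lemma renaming_eq (A B : Type) (f g : renaming A B) : f =1 g -> f = g.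
Proof.
case: f g => f bf [g bg] /= fg; have e : f = g by exact: functional_extensionality_dep.
by case: _ / e in bg *; congr Renaming; exact: Prop_irrelevance.
Qed.

Record presentation := Presentation {
  pwidth : nat;
  proot : mtree E2 'I_pwidth;
  parity : 'I_pwidth -> nat;
  parg : forall s, mtree E1 'I_(parity s);
  plab : renaming {s : 'I_pwidth & 'I_(parity s)} 'I_n
}.

Definition block l (m : 'I_l -> nat) (u : forall s, mtree E1 'I_(m s))
    (f : renaming {s : 'I_l & 'I_(m s)} 'I_n) (s : 'I_l) : tree E1 'I_n :=
  tmap_leaf (fun i => f (Tagged (fun s => 'I_(m s)) i)) (u s).

(** Forgets the numbering of the root inputs and of the inputs of each argument, which is what
    [CompActRoot] and [CompActArgs] identify. *)
Definition flat (P : presentation) : tree E2 (tree E1 'I_n) :=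
  tmap_leaf (block (@parg P) (plab P)) (proot P).

Definition presentation_class (P : presentation) : composite P2 P1 n :=
  composite_class (otree R2 (proot P)) (fun s => otree R1 (@parg P s)) (plab P).

Lemma leaves_nonempty (G T : Type) (t : tree G T) : (0 < size (leaves t))%N.
Proof. by elim: t => //= e l IHl r _; rewrite size_cat addn_gt0 IHl. Qed.

Lemma size_mtree (G : Type) (A : finType) (t : mtree G A) : size (leaves t) = #|A|.
Proof.
have /andP[Ut /forallP tA] := mtreeP t.
by rewrite -(card_uniqP Ut); apply: eq_card => a; rewrite tA.
Qed.

(** Blocks are nonempty, and distinct blocks share no label. *)
Lemma block_inj l m u f : injective (@block l m u f).
Proof.
move=> s s' e; have [i si] : exists i, i \in leaves (block u f s).
  have := leaves_nonempty (block u f s).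
  by case: (leaves _) => // i r _; exists i; rewrite mem_head.
move: (si); rewrite {1}e !leaves_tmap_leaf in si * => /mapP[j' _ ij'].
case/mapP: si => j _ ij; rewrite ij in ij'.
by have /(congr1 tag) := bij_inj (renameP f) ij'.
Qed.

(** Equal blocks have equal sizes, and the two numberings of the labels of a block differ by a
    permutation, which [CompActArgs] absorbs. *)
Lemma composite_class_blocks l (x : P2 l) m m' (u : forall s, mtree E1 'I_(m s))
    (u' : forall s, mtree E1 'I_(m' s)) f f' : block u f =1 block u' f' ->
  composite_class x (fun s => otree R1 (u s)) f =
  composite_class x (fun s => otree R1 (u' s)) f'.
Proof.
move=> uu'; have e : m = m'.
  apply: functional_extensionality_dep => s; have := congr1 (size \o @leaves _ _) (uu' s).
  by rewrite /= !leaves_tmap_leaf !size_map !size_mtree !card_ord.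
case: m' / e in u' f' uu' *.
have tex s : exists t : 'S_(m s), forall i : 'I_(m s),
    f (Tagged (fun s => 'I_(m s)) i) = f' (Tagged (fun s => 'I_(m s)) (t i)).
  have ex (i : 'I_(m s)) : exists j : 'I_(m s),
      f (Tagged (fun s => 'I_(m s)) i) = f' (Tagged (fun s => 'I_(m s)) j).
    have : f (Tagged (fun s => 'I_(m s)) i) \in leaves (block u f s).
      by rewrite leaves_tmap_leaf; apply/mapP; exists i => //; exact: mtree_mem.
    by rewrite uu' leaves_tmap_leaf => /mapP[j _ ->]; exists j.
  have /choice_dep[t tE] := ex; have t_inj : injective t.
    move=> i j tij; have := tE i; rewrite tij -tE => /(bij_inj (renameP f)).
    exact: Tagged_inj.
  by exists (perm t_inj) => i; rewrite permE.
have /choice_dep[t tE] := tex.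
have u'E s : u' s = mrename (perm_renaming (t s)) (u s).
  apply: val_inj; have := uu' s; rewrite /block /=.
  have -> : tmap_leaf (fun i => f (Tagged (fun s => 'I_(m s)) i)) (u s) =
      tmap_leaf (fun i => f' (Tagged (fun s => 'I_(m s)) i)) (tmap_leaf (t s) (u s)).
    by rewrite tmap_leaf_comp; apply: eq_tmap_leaf => i; exact: tE.
  move/tmap_leaf_inj => <- // i j /(bij_inj (renameP f')); exact: Tagged_inj.
have -> : (fun s => otree R1 (u' s)) =
    fun s => act (t s) (otree R1 (u s) : P1 (m s)).
  by apply: functional_extensionality_dep => s; rewrite u'E /= orename_tree.
rewrite composite_class_act_args; congr composite_class.
by apply: renaming_eq => -[s i] /=; exact: tE.
Qed.

(** Both root trees have the same blocks at their leaves, so they differ by the permutation that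
    matches blocks; [CompActRoot] absorbs it, and equality of the blocks does the rest. *)
Lemma presentation_class_flat P P' : flat P = flat P' ->
  presentation_class P = presentation_class P'.
Proof.
case: P P' => [l q m u f] [l' q' m' u' f']; rewrite /flat /presentation_class /= => e.
have el : l = l'.
  have := congr1 (size \o @leaves _ _) e.
  by rewrite /= !leaves_tmap_leaf !size_map !size_mtree !card_ord.
case: l' / el in q' m' u' f' e *.
have /choice_dep[s0 s0E] : forall i, exists j, block u' f' j = block u f i.
  move=> i; have : block u f i \in leaves (tmap_leaf (block u f) q).
    by rewrite leaves_tmap_leaf; apply: map_f; exact: mtree_mem.
  by rewrite e leaves_tmap_leaf => /mapP[j _ ->]; exists j.
have s0_inj : injective s0.
  by move=> i j sij; apply: (@block_inj l m u f); rewrite -!s0E sij.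
pose s := perm s0_inj.
have -> : otree R2 q' = act s (otree R2 q : P2 l).
  rewrite /= orename_tree; congr otree; apply: val_inj => /=.
  apply: (tmap_leaf_inj (@block_inj l m' u' f')); rewrite -e tmap_leaf_comp.
  by apply: eq_tmap_leaf => i /=; rewrite permE s0E.
rewrite composite_class_act_root.
apply: (@composite_class_blocks l _ m (fun i => m' (s i)) u (fun i => u' (s i))).
by move=> i; rewrite -s0E /block /= /s permE.
Qed.

(* Junk value: 0 unless each label occurs exactly once; otherwise the class does
   not depend on the chosen presentation, by [presentation_class_flat]. *)
Definition tree_composite (p : tree E2 (tree E1 'I_n)) : composite P2 P1 n :=
  if pselect (exists P, flat P = p) is left e then presentation_class (projT1 (cid e))
  else 0.

Lemma tree_composite_flat P : tree_composite (flat P) = presentation_class P.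
Proof.
rewrite /tree_composite; case: pselect => [e|[]]; last by exists P.
by apply: presentation_class_flat; case: cid.
Qed.

Lemma tree_composite_degenerate p : ~ (exists P, flat P = p) -> tree_composite p = 0.
Proof. by rewrite /tree_composite; case: pselect. Qed.

Definition composite_combination (X : seq (K * tree E2 (tree E1 'I_n))) :=
  \sum_(z <- X) z.1 *: tree_composite z.2.

(** Whole trees over [E1] act here as the labels of the relation: [null] is used over
    [tree E1 'I_n], with the injection [block u f] as labelling. One presentation provides the
    blocks of all terms, since all terms have the same labels. *)
Lemma composite_null_root X : null R2 X -> composite_combination X = 0.
Proof.
move=> [lX nX].
case: (pselect (exists P z0, z0 \in X /\ flat P = z0.2)) => [[P [z0 [z0X Pz0]]]|nP];
  last first.
  rewrite /composite_combination big_seq big1 // => z zX.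
  rewrite tree_composite_degenerate ?scaler0 // => -[P Pz].
  by apply: nP; exists P, z.
case: P Pz0 => [l q m u f]; rewrite /flat /= => qz0.
have mq z v : z \in X -> z.2 = tmap_leaf (block u f) v -> multilinear v.
  move=> zX zE; have pzq : perm_eq (leaves v) (leaves q).
    apply: (perm_map_inj (@block_inj l m u f)).
    by rewrite -!leaves_tmap_leaf -zE qz0; exact: lX.
  by rewrite (perm_multilinear pzq); exact: mtreeP.
have [Y YE] : exists Y : seq (K * mtree E2 'I_l),
    X = relabel (block u f) [seq (z.1, val z.2) | z <- Y].
  have : {subset X <= X} by [].
  elim: {1 3}X => [|z X' IH] sX; first by exists [::].
  have [z' z'X'|Y ->] := IH; first by apply: sX; rewrite inE z'X' orbT.
  have /tree_pullback[v vE] : forall b, b \in leaves z.2 -> exists i, block u f i = b.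
    move=> b; rewrite (perm_mem (lX z z0 (sX _ (mem_head _ _)) z0X)) -qz0.
    by rewrite leaves_tmap_leaf => /mapP[i _ ->]; exists i.
  have mv := mq z v (sX _ (mem_head _ _)) (esym vE).
  exists ((z.1, MTree mv) :: Y); rewrite /= vE.
  by case: z {sX vE mv}.
pose F := mklinear (@composite_class_linear l m (fun s => otree R1 (u s)) f).
have := nX _ _ _ (@block_inj l m u f) YE; rewrite /combination !big_map => Y0.
rewrite /composite_combination YE !big_map -[RHS](linear0 F) -[in RHS]Y0 linear_sum.
apply: eq_bigr => z _; rewrite linearZ /= tree_classE.
by rewrite (tree_composite_flat (Presentation z.2 u f)).
Qed.

Fixpoint ctx_map (T T' : Type) (g : T -> T') (c : ctx E2 T) : ctx E2 T' :=
  match c with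
  | Hole => Hole _ _
  | CtxL e c r => CtxL e (ctx_map g c) (tmap_leaf g r)
  | CtxR e l c => CtxR e (tmap_leaf g l) (ctx_map g c)
  end.

Lemma fill_pullback (T T' : Type) (g : T -> T') (c : ctx E2 T') b q :
  tmap_leaf g q = fill c (Leaf b) ->
  exists c' s, [/\ q = fill c' (Leaf s), c = ctx_map g c' & g s = b].
Proof.
elim: c q => [|e c IH r|e l c IH] [s|e' ql qr] //= [].
- by move=> <-; exists (Hole _ _), s.
- by move=> -> /IH[c' [s [-> -> <-]]] <-; exists (CtxL e c' qr), s.
- by move=> -> <- /IH[c' [s [-> -> <-]]]; exists (CtxR e ql c'), s.
Qed.

(** The label of the hole occurs nowhere else, so changing [g] there leaves the context
    untouched. *)
Lemma fill_map (T T' : eqType) (g g' : T -> T') (c : ctx E2 T) s :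
  uniq (leaves (fill c (Leaf s))) -> (forall j, j != s -> g j = g' j) ->
  tmap_leaf g' (fill c (Leaf s)) = fill (ctx_map g c) (Leaf (g' s)).
Proof.
have mems (c' : ctx E2 T) : s \in leaves (fill c' (Leaf s)).
  by elim: c' => [|e c' IH r|e l c' IH] /=; rewrite ?mem_head // mem_cat IH ?orbT.
have mapE (t : tree E2 T) : s \notin leaves t -> (forall j, j != s -> g j = g' j) ->
    tmap_leaf g' t = tmap_leaf g t.
  move=> + gg'; elim: t => [j|e l IHl r IHr] /=.
    by rewrite inE => sj; rewrite gg' // eq_sym.
  by rewrite mem_cat negb_or => /andP[/IHl -> /IHr ->].
move=> + gg'; elim: c => [//|e c IH r|e l c IH] /=; rewrite cat_uniq => /and3P[Ul /hasPn lr Ur].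
  rewrite IH // mapE //; apply/negP => /lr; by rewrite mems.
by rewrite IH // mapE //; exact: (lr s (mems c)).
Qed.

(** The context fixes the root and all blocks but one; the relation varies in that block, and the
    class in the composite product is linear in it. *)
Lemma composite_null_arg (c : ctx E2 (tree E1 'I_n)) X : null R1 X ->
  composite_combination [seq (z.1, fill c (Leaf z.2)) | z <- X] = 0.
Proof.
move=> [lX nX].
case: (pselect (exists P z0, z0 \in X /\ flat P = fill c (Leaf z0.2)))
  => [[P [z0 [z0X Pz0]]]|nP]; last first.
  rewrite /composite_combination big_map big_seq big1 // => z zX.
  rewrite tree_composite_degenerate ?scaler0 // => -[P Pz].
  by apply: nP; exists P, z.
case: P Pz0 => [l q m u f]; rewrite /flat /= => e.
have [c' [s [qE cE sE]]] := @fill_pullback _ _ (block u f) c z0.2 q e.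
pose g (i : 'I_(m s)) := f (Tagged (fun s => 'I_(m s)) i).
have g_inj : injective g by move=> i j /(bij_inj (renameP f)) /Tagged_inj.
have [Y YE] : exists Y : seq (K * mtree E1 'I_(m s)),
    X = relabel g [seq (z.1, val z.2) | z <- Y].
  have : {subset X <= X} by [].
  elim: {1 3}X => [|z X' IH] sX; first by exists [::].
  have [z' z'X'|Y ->] := IH; first by apply: sX; rewrite inE z'X' orbT.
  have lz : perm_eq (leaves z.2) (map g (leaves (u s))).
    by rewrite -leaves_tmap_leaf -/(block u f s) sE; apply: lX => //; apply: sX; exact: mem_head.
  have /tree_pullback[v vE] : forall b, b \in leaves z.2 -> exists i, g i = b.
    by move=> b; rewrite (perm_mem lz) => /mapP[i _ ->]; exists i.
  have mv : multilinear v.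
    rewrite (@perm_multilinear _ _ _ (u s)); first exact: mtreeP.
    by apply: (perm_map_inj g_inj); rewrite -leaves_tmap_leaf vE.
  exists ((z.1, MTree mv) :: Y); rewrite /= vE.
  by case: z {sX vE mv lz}.
pose y0 s := otree R1 (u s) : P1 (m s).
pose F := mklinear (@composite_class_slotwise l (otree R2 q) m f y0 s).
have := nX _ _ _ g_inj YE; rewrite /combination !big_map => Y0.
rewrite /composite_combination YE !big_map -[RHS](linear0 F) -[in RHS]Y0 linear_sum.
apply: eq_bigr => z _; rewrite linearZ /= tree_classE.
have -> : fill c (Leaf (tmap_leaf g (val z.2))) =
    flat (Presentation q (@dfwith _ (fun s => mtree E1 'I_(m s)) u s z.2) f).
  rewrite /flat /= qE cE (@fill_map _ _ (block u f)) //.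
  - by rewrite /block dfwith_in.
  - by rewrite -qE; exact: mtree_uniq.
  - by move=> j js; rewrite /block dfwith_out // eq_sym.
rewrite tree_composite_flat /presentation_class /=; congr (_ *: composite_class _ _ _).
apply: functional_extensionality_dep => j.
by have [<-|sj] := eqVneq s j; rewrite ?dfwith_in ?dfwith_out.
Qed.

Definition block_leaves (p : tree E2 (tree E1 'I_n)) :=
  flatten [seq leaves t | t <- leaves p].

(** The blocks are numbered by their position among the leaves of [p], and the inputs of a block by
    their position in it. *)
Lemma presentation_exists p :
  uniq (block_leaves p) -> (forall i, i \in block_leaves p) -> exists P, flat P = p.
Proof.
rewrite /block_leaves => Up Ap.
pose T := tnth (in_tuple (leaves p)).
have TE : [seq leaves (T s) | s <- enum 'I_(size (leaves p))] = map (@leaves _ _) (leaves p).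
  have e : leaves p = map T (enum 'I_(size (leaves p))).
    exact: esym (map_tnth_enum (in_tuple (leaves p))).
  by rewrite [in RHS]e -map_comp.
rewrite -TE in Up Ap.
have [f fE] := relabel_blocks (fun s => mem_enum _ s) Up Ap.
have [u uE] := choice_dep (fun s => fE s (T s) (perm_refl _)).
have T_inj : injective T.
  by move=> s s' e; have := @block_inj _ _ u f s s'; rewrite /block -!uE; apply.
have /tree_pullback[q qE] : forall b, b \in leaves p -> exists s, T s = b.
  by move=> b /(tnthP (in_tuple _))[s ->]; exists s.
have mq : multilinear q.
  apply: (multilinear_pullback T_inj); rewrite qE; last first.
    by move=> s; exact: mem_tnth.
  by apply/(tuple_uniqP (in_tuple _)).
exists (Presentation (MTree mq) u f); rewrite /flat /= -[RHS]qE.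
by apply: eq_tmap_leaf => s; rewrite /block -uE.
Qed.

End Presentations.

(** * Trees of trees and their images under [xi] *)

Section PureTrees.
Variables (K : fieldType) (E1 E2 : sigma2 K).
Variables (R1 : set (free E1 'I_3)) (R2 : set (free E2 'I_3)).
Variable D : free12 E1 E2 -> free21 E1 E2.

Let E := sigma2_sum E1 E2.
Let P1 := operad_smodule R1.
Let P2 := operad_smodule R2.
Let R := rel_total R1 R2 D.

(** The result has no operation of [E2] below one of [E1]. *)
Fixpoint pure_tree (T : Type) (p : tree E2 (tree E1 T)) : tree E T :=
  match p with
  | Leaf x => tmap_op (@inl_op K E1 E2) x
  | Node e l r => Node (inr_op E1 e : E) (pure_tree l) (pure_tree r)
  end.

Lemma leaves_pure_tree n (p : tree E2 (tree E1 'I_n)) :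
  leaves (pure_tree p) = block_leaves p.
Proof.
rewrite /block_leaves; elim: p => [x|e l IHl r IHr] /=.
  by rewrite leaves_tmap_op cats0.
by rewrite IHl IHr map_cat flatten_cat.
Qed.

Lemma xi_presentation n (P : presentation E1 E2 n) :
  exists t : mtree E 'I_n, val t = pure_tree (flat P) /\
    xi D (presentation_class R1 R2 P) = otree R t.
Proof.
case: P => [l q m u f]; rewrite /presentation_class /= xiE /= xi_gen_tree.
eexists; split; last reflexivity.
rewrite /flat /=; elim: (val q) => [s|e a IHa b IHb] /=; last by rewrite IHa IHb.
by rewrite tmap_leaf_comp; exact: esym (@tmap_op_map_leaf K E1 E _ _ _ _ _).
Qed.

(** The two conventions for degenerate trees agree: if a label is missing or repeated, both sides
    are 0. *)
Lemma xi_tree_composite n (p : tree E2 (tree E1 'I_n)) :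
  xi D (tree_composite R1 R2 p) = tree_class R (pure_tree p).
Proof.
case: (pselect (exists P, flat P = p)) => [[P <-]|nP].
  by rewrite tree_composite_flat; have [t [<- ->]] := xi_presentation P; rewrite tree_classE.
rewrite tree_composite_degenerate // tree_class_degenerate.
  exact: linear_fun0 (@xi_linear K E1 E2 R1 R2 D n).
apply/negP => /andP[]; rewrite leaves_pure_tree => Up /forallP Ap.
by apply: nP; apply: presentation_exists.
Qed.

Lemma composite_span n (x : composite P2 P1 n) :
  span (range (@presentation_class K E1 E2 R1 R2 n)) x.
Proof.
rewrite -[x]qpi_repr.
apply: (@span_image _ _ _ (qpi (@composite_rel K P2 P1 n)) (range (fun c => << c >>)))
  => [_ [c _ <-]|]; last exact: malg_span.
case: c => l r m y f; rewrite -/(composite_class r y f).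
have [S0 SD] := span_submodule (range (@presentation_class K E1 E2 R1 R2 n)).
move: y; apply: (@slot_range_ind K _ (fun s => P1 (m s)) _ (fun s => @otree K E1 R1 'I_(m s))
  (fun y => span (range (@presentation_class K E1 E2 R1 R2 n)) (composite_class r y f)))
  => [s v|y s|u].
- exact: operad_span.
- have lin := @composite_class_slotwise K E1 E2 R1 R2 n l r m f y s.
  split=> [|a v w Sv Sw]; first by rewrite (linear_fun0 lin).
  by rewrite (lin a v w); apply: SD.
have lin := @composite_class_linear K E1 E2 R1 R2 n l m (fun s => otree R1 (u s)) f.
apply: (@span_ind _ _ (range (@otree K E2 R2 'I_l))
  (fun r => span (range (@presentation_class K E1 E2 R1 R2 n))
    (composite_class r (fun s => otree R1 (u s)) f))).
- split=> [|a v w Sv Sw]; first by rewrite (linear_fun0 lin).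
  by rewrite (lin a v w); apply: SD.
- move=> _ [q _ <-]; apply: sub_span.
  by exists (Presentation q u f).
exact: operad_span.
Qed.

End PureTrees.

(** * Bilinear operations on a quotient of a free module *)

Section BilinearExtension.
Variables (K : fieldType) (T : choiceType) (S : set {malg K[T]}).
Variable f : T -> T -> {malg K[T]}.
Implicit Types (x y : {malg K[T]}).

Definition bilext x y : {malg K[T]} := linext (fun t => linext (f t) y) x.

Lemma bilext_linearl y : linear (bilext^~ y).
Proof. exact: linext_is_linear. Qed.

Lemma bilext_linearr x : linear (bilext x).
Proof.
move=> a y z; rewrite /bilext /linext.
rewrite scaler_sumr -big_split; apply: eq_bigr => t _ /=.
rewrite -/(linext (f t) (a *: y + z)) -/(linext (f t) y) -/(linext (f t) z).
have -> : linext (f t) (a *: y + z) = a *: linext (f t) y + linext (f t) z.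
  exact: linext_is_linear.
by rewrite scalerDr !scalerA mulrC.
Qed.

Lemma bilextU s t : bilext << s >> << t >> = f s t.
Proof. by rewrite /bilext !linextU. Qed.

Hypotheses (f_left : forall x t, S x -> span S (bilext x << t >>))
  (f_right : forall x t, S x -> span S (bilext << t >> x)).

Definition quot_op (u v : quotmod S) : quotmod S := qpi S (bilext (repr u) (repr v)).

(** One representative is replaced at a time; by [f_left] and [f_right], products of elements of [S]
    with basis elements, hence with all elements, stay in the span of [S]. *)
Lemma quot_opE x y : quot_op (qpi S x) (qpi S y) = qpi S (bilext x y).
Proof.
rewrite /quot_op; transitivity (qpi S (bilext x (repr (qpi S y)))).
  apply: (@span_congr K _ _ (fun x => qpi S (bilext x _)) S); last exact: repr_qpi.
    exact: linear_fun_comp (qpi_lin S) (bilext_linearl _).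
  move=> z Sz; move: (repr (qpi S y)) => w.
  apply: (@span_ker K _ _ (fun w => qpi S (bilext z w)) (range (fun t => << t >>))).
  - exact: linear_fun_comp (qpi_lin S) (bilext_linearr _).
  - by move=> _ [t _ <-]; apply/qpi_eq0; exact: f_left.
  exact: malg_span.
apply: (@span_congr K _ _ (fun y => qpi S (bilext x y)) S); last exact: repr_qpi.
  exact: linear_fun_comp (qpi_lin S) (bilext_linearr _).
move=> z Sz.
apply: (@span_ker K _ _ (fun w => qpi S (bilext w z)) (range (fun t => << t >>))).
- exact: linear_fun_comp (qpi_lin S) (bilext_linearl _).
- by move=> _ [t _ <-]; apply/qpi_eq0; exact: f_right.
exact: malg_span.
Qed.

Definition quot_basis (t : T) : quotmod S := qpi S << t >>.

Lemma quot_opU s t : quot_op (quot_basis s) (quot_basis t) = qpi S (f s t).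
Proof. by rewrite quot_opE bilextU. Qed.

Lemma quot_basis_span (u : quotmod S) : span (range quot_basis) u.
Proof.
rewrite -[u]qpi_repr.
apply: (@span_image _ _ _ (qpi S) (range (fun t => << t >>))) => [_ [t _ <-]|].
  by apply: sub_span; exists t.
exact: malg_span.
Qed.

Lemma quot_op_linearl v : linear (quot_op^~ v).
Proof.
move=> a u u'; rewrite -(qpi_repr u) -(qpi_repr u') -(qpi_repr v) -linearP !quot_opE.
exact: linear_fun_comp (qpi_lin S) (bilext_linearl _) a (repr u) (repr u').
Qed.

Lemma quot_op_linearr u : linear (quot_op u).
Proof.
move=> a v v'; rewrite -(qpi_repr u) -(qpi_repr v) -(qpi_repr v') -linearP !quot_opE.
exact: linear_fun_comp (qpi_lin S) (bilext_linearr _) a (repr v) (repr v').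
Qed.

End BilinearExtension.

(** * Algebras over the operad of the trivial law *)

Section ComLieAlgebra.
Variables (K : fieldType) (V : lmodType K) (com lie : V -> V -> V).
Hypotheses (com_linearl : forall y, linear (com^~ y)) (com_linearr : forall x, linear (com x))
  (lie_linearl : forall y, linear (lie^~ y)) (lie_linearr : forall x, linear (lie x))
  (comC : forall x y, com x y = com y x)
  (comA : forall x y z, com (com x y) z = com x (com y z))
  (lieN : forall x y, lie x y = - lie y x)
  (jacobi : forall x y z, lie (lie x y) z + lie (lie y z) x + lie (lie z x) y = 0)
  (com_lie : forall x y z, com x (lie y z) = 0).

Let E1 := E_com K.
Let E2 := E_lie K.
Let E := sigma2_sum E1 E2.

Definition com_lie_op (e : E) (x y : V) : V :=
  (fst e : K) *: com x y + (snd e : K) *: lie x y.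

Lemma com_lie_op_linear x y : linear (fun e => com_lie_op e x y).
Proof.
move=> a [c1 b1] [c2 b2]; rewrite /com_lie_op /= !scalerDl scalerDr !scalerA.
by rewrite addrACA.
Qed.

Lemma com_lie_op_linearl e y : linear (fun x => com_lie_op e x y).
Proof.
move=> a x x'; rewrite /com_lie_op com_linearl lie_linearl !scalerDr !scalerA.
by rewrite ![_ * a]mulrC addrACA.
Qed.

Lemma com_lie_op_linearr e x : linear (com_lie_op e x).
Proof.
move=> a y y'; rewrite /com_lie_op com_linearr lie_linearr !scalerDr !scalerA.
by rewrite ![_ * a]mulrC addrACA.
Qed.

Lemma com_lie_op_swap e x y : com_lie_op (swap e) x y = com_lie_op e y x.
Proof. by case: e => c b; rewrite /com_lie_op /= comC (lieN x) scalerN scaleNr opprK. Qed.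

Notation eval := (free_eval com_lie_op).

Let evalU (A : finType) (v : A -> V) := free_eval_tree com_lie_op_linear com_lie_op_linearl
  com_lie_op_linearr com_lie_op_swap v.
Let eval_linear (A : finType) (v : A -> V) := free_eval_linear com_lie_op_linear com_lie_op_linearl
  com_lie_op_linearr com_lie_op_swap v.
Let eval_rename (A B : finType) (f : renaming A B) (v : B -> V) :=
  free_eval_rename com_lie_op_linear com_lie_op_linearl
  com_lie_op_linearr com_lie_op_swap f v.

Variable D : free12 E1 E2 -> free21 E1 E2.
Hypothesis D0 : forall x, D x = 0.

(** The three cases are [rel1], [relD] and [rel2]. With D = 0 the middle relations fill [free12],
    which is spanned by products with a bracket as a factor, and these vanish by [com_lie]. *)
Lemma rel_total_eval r (v : 'I_3 -> V) : rel_total (@R_com K) (@R_lie K) D r -> eval v r = 0.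
Proof.
apply: (span_ker (eval_linear v)) => {}r [[]|].
- case=> r' Rr' <-; pose F x := eval v (fmap_op (@inl_op K E1 E2) x).
  have Flin : linear F.
    exact: linear_fun_comp (eval_linear v)
      (fmap_op_linear (@inl_op_linear K E1 E2) (@inl_op_swap K E1 E2) (A := _)).
  apply: (span_ker (f := F) Flin _ Rr') => _ [s [_ [-> ->]]]; rewrite /F.
  rewrite (fmap_op_rename (@inl_op_linear K E1 E2) (@inl_op_swap K E1 E2)) eval_rename.
  rewrite linear_funB; last first.
    exact: fmap_op_linear (@inl_op_linear K E1 E2) (@inl_op_swap K E1 E2) _.
  rewrite linear_funB; last exact: eval_linear.
  rewrite !(fmap_op_tree (@inl_op_linear K E1 E2) (@inl_op_swap K E1 E2)) !evalU /=.
  by rewrite /com_lie_op /= !scale0r !addr0 !scale1r comA subrr.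
- case=> x _ <-; rewrite D0 subr0.
  have : span (orbits (compositions (@ops1 K E1 E2) (@ops2 K E1 E2))) (sub_val x).
    by case: x => x /= /asboolP.
  apply: (span_ker (eval_linear v)) => _ [s [g [mn ->]]]; rewrite eval_rename.
  case: mn => m n [m' _ <-] [n' _ <-]; rewrite evalU /= /com_lie_op /=.
    by rewrite !scale0r !addr0 !add0r (linear_funZ _ _ (com_linearr _)) com_lie !scaler0.
  by rewrite !scale0r !addr0 !add0r comC (linear_funZ _ _ (com_linearr _)) com_lie !scaler0.
- case=> r' Rr' <-; pose F x := eval v (fmap_op (@inr_op K E1 E2) x).
  have flin : linear (@fmap_op K E2 E (@inr_op K E1 E2) 'I_3).
    exact: (fmap_op_linear (@inr_op_linear K E1 E2) (@inr_op_swap K E1 E2)).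
  have Flin : linear F by exact: linear_fun_comp (eval_linear v) flin.
  apply: (span_ker (f := F) Flin _ Rr') => _ [s [_ [-> ->]]]; rewrite /F.
  rewrite (fmap_op_rename (@inr_op_linear K E1 E2) (@inr_op_swap K E1 E2)) eval_rename.
  rewrite (linear_funD _ _ flin) (linear_funD _ _ flin).
  rewrite (linear_funD _ _ (eval_linear _)) (linear_funD _ _ (eval_linear _)).
  rewrite !(fmap_op_tree (@inr_op_linear K E1 E2) (@inr_op_swap K E1 E2)) !evalU /=.
  by rewrite /com_lie_op /= !scale0r !add0r !scale1r jacobi.
Qed.

Lemma com_lie_eval_linear (A : finType) (v : A -> V) :
  linear (operad_eval com_lie_op v : operad (rel_total (@R_com K) (@R_lie K) D) A -> V).
Proof.
exact: (operad_eval_linear com_lie_op_linear com_lie_op_linearl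
  com_lie_op_linearr com_lie_op_swap rel_total_eval).
Qed.

Lemma com_lie_eval_tree (A : finType) (v : A -> V) t :
  operad_eval com_lie_op v (otree (rel_total (@R_com K) (@R_lie K) D) t) =
  teval com_lie_op v t.
Proof.
exact: (operad_eval_tree com_lie_op_linear com_lie_op_linearl
  com_lie_op_linearr com_lie_op_swap rel_total_eval).
Qed.

End ComLieAlgebra.
Section ComLieRelations.
Variable K : fieldType.

Definition arg3 (T : Type) (x y z : T) (i : 'I_3) : T :=
  if nat_of_ord i is 0 then x else if nat_of_ord i is 1 then y else z.

Lemma orbits_self (E : sigma2 K) m (G : set (free E 'I_m)) g : G g -> orbits G g.
Proof. by move=> Gg; exists 1%g, g; split=> //; rewrite frename_id // => i; rewrite /= perm1. Qed.

Lemma null_assoc (T : eqType) (x y z : tree (E_com K) T) :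
  null (@R_com K) [:: (1, Node (1 : E_com K) (Node (1 : E_com K) x y) z);
                      (-1, Node (1 : E_com K) x (Node (1 : E_com K) y z))].
Proof.
apply: (@null_relation K (E_com K) (@R_com K) T
  [:: (1, @comp_left (E_com K) 1 1 0 1 2%:R isT);
      (-1, @comp_right (E_com K) 1 1 0 1 2%:R isT)] (arg3 x y z)).
rewrite !big_cons big_nil /= scale1r scaleN1r addr0.
by apply: sub_span; exact: orbits_self.
Qed.

Lemma null_jacobi (T : eqType) (x y z : tree (E_lie K) T) :
  null (@R_lie K) [:: (1, Node (1 : E_lie K) (Node (1 : E_lie K) x y) z);
                      (1, Node (1 : E_lie K) (Node (1 : E_lie K) y z) x);
                      (1, Node (1 : E_lie K) (Node (1 : E_lie K) z x) y)].
Proof.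
apply: (@null_relation K (E_lie K) (@R_lie K) T
  [:: (1, @comp_left (E_lie K) 1 1 0 1 2%:R isT);
      (1, @comp_left (E_lie K) 1 1 1 2%:R 0 isT);
      (1, @comp_left (E_lie K) 1 1 2%:R 0 1 isT)] (arg3 x y z)).
rewrite !big_cons big_nil /= !scale1r addr0 addrA.
by apply: sub_span; exact: orbits_self.
Qed.

End ComLieRelations.

(** * The free algebra of the trivial law *)

Section FreeComLie.
Variables (K : fieldType) (n : nat).

Let E1 := E_com K.
Let E2 := E_lie K.
Let E := sigma2_sum E1 E2.
Notation com_tree := (tree E1 'I_n).
Notation pure := (tree E2 com_tree).
Notation com1 := (Node (1 : E1)).
Notation lie1 := (Node (1 : E2)).

Definition basis_sum (T : choiceType) (X : seq (K * T)) : {malg K[T]} :=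
  \sum_(z <- X) z.1 *: << z.2 >>.

Lemma linext_basis_sum (T : choiceType) (V : lmodType K) (g : T -> V) X :
  linext g (basis_sum X) = \sum_(z <- X) z.1 *: g z.2.
Proof. by rewrite linear_sum; apply: eq_bigr => z _; rewrite linearZ /= linextU. Qed.

Definition is_node (T : Type) (p : tree E2 T) : bool := if p is Node _ _ _ then true else false.

(* In [PureRoot] bare leaves are excluded so that the commutative product, which
   vanishes on brackets, respects the relation. *)
Inductive pure_rel : set {malg K[pure]} :=
| PureArg c X : null (@R_com K) X ->
    pure_rel (basis_sum [seq (z.1, fill c (Leaf z.2)) | z <- X])
| PureRoot X : null (@R_lie K) X -> all (fun z => is_node z.2) X ->
    pure_rel (basis_sum X).

Definition lie_basis (p q : pure) : {malg K[pure]} := << lie1 p q >>.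
Definition com_basis (p q : pure) : {malg K[pure]} :=
  match p, q with Leaf x, Leaf y => << Leaf (com1 x y) >> | _, _ => 0 end.

Lemma com_basis_node p q : is_node p || is_node q -> com_basis p q = 0.
Proof. by case: p; case: q. Qed.

Lemma lie_basis_left x t : pure_rel x -> span pure_rel (bilext lie_basis x << t >>).
Proof.
move=> xr; rewrite /bilext; apply: sub_span.
have E0 X : linext (fun s => linext (lie_basis s) << t >>) (basis_sum X) =
    basis_sum [seq (z.1, lie1 z.2 t) | z <- X].
  by rewrite linext_basis_sum /basis_sum big_map; apply: eq_bigr => z _; rewrite linextU.
case: xr => [c X nX|X nX _]; rewrite E0.
  by rewrite -map_comp; exact: (PureArg (CtxL (1 : E2) c t) nX).
apply: PureRoot; first exact: null_node_l.
by rewrite all_map; apply/allP.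
Qed.

Lemma lie_basis_right x t : pure_rel x -> span pure_rel (bilext lie_basis << t >> x).
Proof.
move=> xr; rewrite /bilext linextU; apply: sub_span.
have E0 X : linext (lie_basis t) (basis_sum X) = basis_sum [seq (z.1, lie1 t z.2) | z <- X].
  by rewrite linext_basis_sum /basis_sum big_map.
case: xr => [c X nX|X nX _]; rewrite E0.
  by rewrite -map_comp; exact: (PureArg (CtxR (1 : E2) t c) nX).
apply: PureRoot; first exact: null_node_r.
by rewrite all_map; apply/allP.
Qed.

Lemma span0 (S : set {malg K[pure]}) : span S 0.
Proof. by have [] := span_submodule S. Qed.

Lemma com_basisC p q : span pure_rel (com_basis p q - com_basis q p).
Proof.
case: p q => [x|? ? ?] [y|? ? ?] /=; rewrite ?subrr; try exact: span0.
apply: sub_span; have := PureArg (Hole _ _) (null_swap (@R_com K) (1 : E1) x y).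
by rewrite /basis_sum !big_cons big_nil /= scale1r scaleN1r addr0.
Qed.

(** A relation of Lie has only brackets as terms, so its products are 0. A relation of Com survives
    only in the empty context and against a commutative tree, where it becomes a relation of Com
    below a new vertex. *)
Lemma com_basis_left x t : pure_rel x -> span pure_rel (bilext com_basis x << t >>).
Proof.
move=> xr; rewrite /bilext.
have E0 X : linext (fun s => linext (com_basis s) << t >>) (basis_sum X) =
    \sum_(z <- X) z.1 *: com_basis z.2 t.
  by rewrite linext_basis_sum; apply: eq_bigr => z _; rewrite linextU.
have Z (X : seq (K * pure)) : all (fun z => is_node z.2 || is_node t) X ->
    span pure_rel (\sum_(z <- X) z.1 *: com_basis z.2 t).
  move=> /allP Xn; rewrite big_seq big1; first exact: span0.
  by move=> z zX; rewrite com_basis_node ?scaler0 //; exact: Xn.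
case: xr => [c X nX|X nX Xn]; rewrite E0; last first.
  by apply: Z; apply: sub_all Xn => z ->.
case: c => [|e c r|e l c]; try by apply: Z; rewrite all_map; apply/allP.
case: t E0 Z => [y|e l r] _ Z; last by apply: Z; rewrite all_map; apply/allP => z _ /=.
apply: sub_span; have := PureArg (Hole _ _) (null_node_l (1 : E1) y nX).
by rewrite /basis_sum !big_map.
Qed.

Lemma com_basis_right x t : pure_rel x -> span pure_rel (bilext com_basis << t >> x).
Proof.
move=> xr; have := com_basis_left t xr.
set a := bilext _ _ _; set b := bilext _ _ _ => Sa.
have [_ SD] := span_submodule pure_rel.
(* The right product differs from the left one by an element of the span, so the left case is
   enough. *)
suff Sab : span pure_rel (b - a) by have := SD 1 _ _ Sab Sa; rewrite scale1r subrK.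
have lin : linear (fun y => bilext com_basis << t >> y - bilext com_basis y << t >>).
  move=> k y z; have -> := bilext_linearl com_basis << t >> k y z.
  have -> := bilext_linearr com_basis << t >> k y z.
  by rewrite opprD scalerBr addrACA.
rewrite /a /b {a b Sa xr}.
apply: (@span_image _ _ _ (mklinear lin) (range (fun t => << t >>))) (malg_span x).
by move=> _ [s _ <-] /=; rewrite !bilextU; exact: com_basisC.
Qed.

Definition lie_comp := quot_op (S := pure_rel) lie_basis.
Definition com_comp := quot_op (S := pure_rel) com_basis.
Notation basis := (quot_basis pure_rel).

Lemma lie_compU p q : lie_comp (basis p) (basis q) = basis (lie1 p q).
Proof. exact: (quot_opU lie_basis_left lie_basis_right). Qed.

Lemma com_compU p q : com_comp (basis p) (basis q) = qpi pure_rel (com_basis p q).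
Proof. exact: (quot_opU com_basis_left com_basis_right). Qed.

Lemma lie_comp_linearl y : linear (lie_comp^~ y).
Proof. exact: (quot_op_linearl lie_basis_left lie_basis_right). Qed.
Lemma lie_comp_linearr x : linear (lie_comp x).
Proof. exact: (quot_op_linearr lie_basis_left lie_basis_right). Qed.
Lemma com_comp_linearl y : linear (com_comp^~ y).
Proof. exact: (quot_op_linearl com_basis_left com_basis_right). Qed.
Lemma com_comp_linearr x : linear (com_comp x).
Proof. exact: (quot_op_linearr com_basis_left com_basis_right). Qed.

Lemma quot_ext (V : lmodType K) (F G : quotmod pure_rel -> V) :
  linear F -> linear G -> (forall p, F (basis p) = G (basis p)) -> F =1 G.
Proof.
move=> Flin Glin FG x; apply: (span_eq Flin Glin _ (quot_basis_span x)).
by move=> _ [p _ <-].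
Qed.

Lemma quot_rel x : pure_rel x -> qpi pure_rel x = 0.
Proof. by move=> xr; apply/qpi_eq0; exact: sub_span. Qed.

Lemma basis_sum_pi X : qpi pure_rel (basis_sum X) = \sum_(z <- X) z.1 *: basis z.2.
Proof. by rewrite linear_sum; apply: eq_bigr => z _; rewrite linearZ. Qed.

Lemma com_compC x y : com_comp x y = com_comp y x.
Proof.
move: x; apply: quot_ext => [||p]; [exact: com_comp_linearl|exact: com_comp_linearr|].
move: y; apply: quot_ext => [||q]; [exact: com_comp_linearr|exact: com_comp_linearl|].
by rewrite !com_compU; apply/qpi_eq; exact: com_basisC.
Qed.

Lemma basis_null_root X : null (@R_lie K) X -> all (fun z => is_node z.2) X ->
  \sum_(z <- X) z.1 *: basis z.2 = 0.
Proof. by move=> nX Xn; rewrite -basis_sum_pi; apply: quot_rel; exact: PureRoot. Qed.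

Lemma basis_null_arg X : null (@R_com K) X -> \sum_(z <- X) z.1 *: basis (Leaf z.2) = 0.
Proof.
move=> nX; have := quot_rel (PureArg (Hole _ _) nX).
by rewrite basis_sum_pi big_map.
Qed.

Lemma basis_lie_scale (e : E2) p q : basis (Node e p q) = (e : K) *: basis (lie1 p q).
Proof.
(* The decoration [e] is read as [e *: 1 + 0]; the term decorated by 0 disappears by [null_zero]. *)
have := basis_null_root (null_lin (@R_lie K) (e : K) (1 : E2) 0 p q) isT.
have := basis_null_root (null_zero (@R_lie K) p q) isT.
rewrite !big_cons !big_nil /= !addr0 !scale1r scaleN1r => ->.
rewrite oppr0 addr0 scaleNr => /eqP; rewrite subr_eq0 => /eqP <-.
by congr (basis (Node _ p q)); exact: esym (mulr1 (e : K)).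
Qed.

Lemma basis_com_scale (e : E1) x y :
  basis (Leaf (Node e x y)) = (e : K) *: basis (Leaf (com1 x y)).
Proof.
have := basis_null_arg (null_lin (@R_com K) (e : K) (1 : E1) 0 x y).
have := basis_null_arg (null_zero (@R_com K) x y).
rewrite !big_cons !big_nil /= !addr0 !scale1r scaleN1r => ->.
rewrite oppr0 addr0 scaleNr => /eqP; rewrite subr_eq0 => /eqP <-.
by congr (basis (Leaf (Node _ x y))); exact: esym (mulr1 (e : K)).
Qed.

Lemma lie_compN x y : lie_comp x y = - lie_comp y x.
Proof.
have linN (F : quotmod pure_rel -> quotmod pure_rel) : linear F -> linear (fun x => - F x).
  by move=> lin a u v; rewrite lin opprD scalerN.
move: x; apply: quot_ext => [||p].
- exact: lie_comp_linearl.
- exact: linN (lie_comp_linearr y).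
move: y; apply: quot_ext => [||q].
- exact: lie_comp_linearr.
- exact: linN (lie_comp_linearl _).
rewrite !lie_compU.
have := basis_null_root (null_swap (@R_lie K) (1 : E2) p q) isT.
rewrite !big_cons !big_nil /= !addr0 !scale1r scaleN1r => /eqP.
rewrite subr_eq0 => /eqP <-.
by rewrite [in RHS]basis_lie_scale scaleN1r opprK.
Qed.

Lemma qpi0 : qpi pure_rel 0 = 0.
Proof. exact: linear0. Qed.

Lemma com_comp_leaf x y :
  com_comp (basis (Leaf x)) (basis (Leaf y)) = basis (Leaf (com1 x y)).
Proof. exact: com_compU. Qed.

Lemma com_comp_node p q : is_node p || is_node q -> com_comp (basis p) (basis q) = 0.
Proof. by move=> pq; rewrite com_compU com_basis_node ?qpi0. Qed.

Lemma com_node_l e p q x : com_comp (basis (Node e p q)) x = 0.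
Proof.
apply: (@span_ker K _ _ (com_comp (basis (Node e p q))) (range basis)).
- exact: com_comp_linearr.
- by move=> _ [r _ <-]; exact: com_comp_node.
exact: quot_basis_span.
Qed.

Lemma com_node_r x e p q : com_comp x (basis (Node e p q)) = 0.
Proof. by rewrite com_compC com_node_l. Qed.

(** On basis elements, if one factor is a bracket then both sides are 0; otherwise all three are
    commutative trees and the relation of Com applies. *)
Lemma com_compA x y z : com_comp (com_comp x y) z = com_comp x (com_comp y z).
Proof.
move: x; apply: quot_ext => [||p].
- exact: linear_fun_comp (com_comp_linearl z) (com_comp_linearl y).
- exact: com_comp_linearl.
move: y; apply: quot_ext => [||q].
- exact: linear_fun_comp (com_comp_linearl z) (com_comp_linearr _).
- exact: linear_fun_comp (com_comp_linearr _) (com_comp_linearl z).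
move: z; apply: quot_ext => [||r].
- exact: com_comp_linearr.
- exact: linear_fun_comp (com_comp_linearr _) (com_comp_linearr _).
have com0l w : com_comp 0 w = 0 by exact: linear_fun0 (com_comp_linearl w).
have com0r w : com_comp w 0 = 0 by exact: linear_fun0 (com_comp_linearr w).
case: p => [x|e p1 p2]; last by rewrite !com_node_l com0l.
case: q => [y|e q1 q2].
  case: r => [z|e r1 r2]; last by rewrite com_node_r (com_node_r (basis _)) com0r.
  rewrite !com_comp_leaf; have := basis_null_arg (null_assoc x y z).
  rewrite !big_cons !big_nil /= addr0 scale1r scaleN1r => /eqP.
  by rewrite subr_eq0 => /eqP.
by rewrite com_node_r com_node_l com0l com0r.
Qed.

Lemma lie_comp_jacobi x y z :
  lie_comp (lie_comp x y) z + lie_comp (lie_comp y z) x + lie_comp (lie_comp z x) y = 0.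
Proof.
have lin0 : linear (fun _ : quotmod pure_rel => 0 : quotmod pure_rel).
  by move=> a u v; rewrite scaler0 addr0.
have linD (F G : quotmod pure_rel -> quotmod pure_rel) :
    linear F -> linear G -> linear (fun x => F x + G x).
  by move=> Fl Gl a u v; rewrite Fl Gl scalerDr addrACA.
have ll := lie_comp_linearl; have lr := lie_comp_linearr.
move: x; apply: quot_ext => // [|p].
  apply: (linD); [apply: (linD)|].
  - exact: linear_fun_comp (ll z) (ll y).
  - exact: lr.
  - exact: linear_fun_comp (ll y) (lr z).
move: y; apply: quot_ext => // [|q].
  apply: (linD); [apply: (linD)|].
  - exact: linear_fun_comp (ll z) (lr _).
  - exact: linear_fun_comp (ll _) (ll z).
  - exact: lr.
move: z; apply: quot_ext => // [|r].
  apply: (linD); [apply: (linD)|].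
  - exact: lr.
  - exact: linear_fun_comp (ll _) (lr _).
  - exact: linear_fun_comp (ll _) (ll _).
rewrite !lie_compU.
have := basis_null_root (null_jacobi p q r) isT.
by rewrite !big_cons !big_nil /= addr0 !scale1r addrA.
Qed.

Lemma com_lie_comp x y z : com_comp x (lie_comp y z) = 0.
Proof.
have lin0 : linear (fun _ : quotmod pure_rel => 0 : quotmod pure_rel).
  by move=> a u v; rewrite scaler0 addr0.
move: x; apply: quot_ext => // [|p]; first exact: com_comp_linearl.
move: y; apply: quot_ext => // [|q].
  exact: linear_fun_comp (com_comp_linearr _) (lie_comp_linearl z).
move: z; apply: quot_ext => // [|r].
  exact: linear_fun_comp (com_comp_linearr _) (lie_comp_linearr _).
by rewrite lie_compU com_node_r.
Qed.

Notation op := (com_lie_op com_comp lie_comp).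
Let v (i : 'I_n) := basis (Leaf (Leaf i)).

(** Evaluation at the generators returns the tree itself as a basis element; this is what makes
    [com_lie_section] a left inverse of [xi]. *)
Lemma teval_pure_tree p : teval op v (pure_tree p) = basis p.
Proof.
elim: p => [x|e p IHp q IHq] /=; last first.
  rewrite IHp IHq /com_lie_op /= scale0r add0r lie_compU.
  by rewrite [RHS]basis_lie_scale.
elim: x => [i|e x IHx y IHy] //=.
rewrite IHx IHy /com_lie_op /= scale0r addr0 com_compU.
by rewrite [RHS]basis_com_scale.
Qed.

Lemma tree_composite_rel x : pure_rel x ->
  linext (tree_composite (@R_com K) (@R_lie K) (n := n)) x = 0.
Proof.
case=> [c X nX|X nX _]; rewrite linext_basis_sum.
  exact: composite_null_arg.
exact: composite_null_root.
Qed.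

Definition quot_composite : quotmod pure_rel -> composite _ _ n :=
  qlift (linext (tree_composite (@R_com K) (@R_lie K) (n := n))).

Lemma quot_composite_linear : linear quot_composite.
Proof. exact: qlift_is_linear tree_composite_rel. Qed.

Lemma quot_composite_basis p : quot_composite (basis p) = tree_composite _ _ p.
Proof. by apply: etrans (qlift_pi tree_composite_rel _) _; exact: linextU. Qed.

Variable D : free12 E1 E2 -> free21 E1 E2.
Hypothesis D0 : forall x, D x = 0.

Let R := rel_total (@R_com K) (@R_lie K) D.
Notation xiD := (@xi K E1 E2 (@R_com K) (@R_lie K) D n).

Definition com_lie_section (x : operad R 'I_n) : composite _ _ n :=
  quot_composite (operad_eval op v x).

Lemma com_lie_sectionK : cancel xiD com_lie_section.
Proof.
move=> x; have evlin := @com_lie_eval_linear K _ com_comp lie_comp com_comp_linearl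
  com_comp_linearr lie_comp_linearl lie_comp_linearr com_compC com_compA lie_compN
  lie_comp_jacobi com_lie_comp D D0 _ v.
have evtree := @com_lie_eval_tree K _ com_comp lie_comp com_comp_linearl
  com_comp_linearr lie_comp_linearl lie_comp_linearr com_compC com_compA lie_compN
  lie_comp_jacobi com_lie_comp D D0 _ v.
have lin := linear_fun_comp quot_composite_linear
  (linear_fun_comp evlin (@xi_linear _ _ _ _ _ D n)).
apply: (span_eq (g := id) lin _ _ (composite_span x)) => // _ [P _ <-].
have [t [tP ->]] := xi_presentation (@R_com K) (@R_lie K) D P.
by rewrite evtree tP teval_pure_tree quot_composite_basis tree_composite_flat.
Qed.

End FreeComLie.
(** * Bijectivity of xi for the trivial law *)

Section Surjectivity.
Variables (K : fieldType).

Let E1 := E_com K.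
Let E2 := E_lie K.
Let E := sigma2_sum E1 E2.
Notation com1 := (Node (inl_op E2 (1 : E1) : E)).
Notation lie1 := (Node (inr_op E1 (1 : E2) : E)).

(** Every decoration is a combination of the commutative product and the bracket, and the class is
    linear in the decoration of a single vertex. *)
Lemma tree_class_combine (R : set (free E 'I_3)) n (C : ctx E 'I_n) (e : E) l r :
  tree_class R (fill C (Node e l r)) =
  (fst e : K) *: tree_class R (fill C (com1 l r)) +
  (snd e : K) *: tree_class R (fill C (lie1 l r)).
Proof.
have lin a e1 e2 : tree_class R (fill C (Node (a *: e1 + e2) l r)) =
    a *: tree_class R (fill C (Node e1 l r)) + tree_class R (fill C (Node e2 l r)).
  have := null_combination (null_fill C (null_lin R a e1 e2 l r)).
  rewrite /combination !big_cons big_nil /= addr0 scale1r scaleN1r scaleNr -opprD.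
  by move/eqP; rewrite subr_eq0 => /eqP.
have zero : tree_class R (fill C (Node 0 l r)) = 0.
  have := null_combination (null_fill C (null_zero R l r)).
  by rewrite /combination big_cons big_nil /= addr0 scale1r.
(* The trailing 0 allows the rule [lin] to be applied twice, with [zero] for what is left. *)
have -> : e = (fst e : K) *: (inl_op E2 (1 : E1) : E) +
    ((snd e : K) *: (inr_op E1 (1 : E2) : E) + 0).
  case: e => a b; congr pair; rewrite /= ?scaler0 ?addr0 ?add0r.
    exact: esym (mulr1 (a : K)).
  exact: esym (mulr1 (b : K)).
by rewrite !lin zero addr0 /= !scaler0 !addr0 !add0r /GRing.scale /= !mulr1.
Qed.

Definition vertex (b : bool) : E :=
  if b then inl_op E2 (1 : E1) else inr_op E1 (1 : E2).

Fixpoint coloured (T : Type) (c : tree bool T) : tree E T :=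
  match c with
  | Leaf i => Leaf i
  | Node b l r => Node (vertex b) (coloured l) (coloured r)
  end.

(** Decorations are split vertex by vertex; the context [C] holds the part of the tree outside the
    subtree being treated. *)
Lemma tree_class_coloured (R : set (free E 'I_3)) n (U : set (operad R 'I_n))
    (C : ctx E 'I_n) t : submodule U ->
  (forall c, U (tree_class R (fill C (coloured c)))) -> U (tree_class R (fill C t)).
Proof.
move=> [U0 UD]; elim: t C => [i|e l IHl r IHr] C UC; first exact: UC (Leaf i).
suff H (b : bool) : U (tree_class R (fill C (Node (vertex b) l r))).
  rewrite tree_class_combine; apply: (UD); first exact: (H true).
  by have := UD (snd e : K) _ _ (H false) U0; rewrite addr0.
set k := vertex b.
have -> : fill C (Node k l r) = fill (ctx_comp C (CtxL k (Hole E _) r)) l.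
  by rewrite fill_comp.
apply: IHl => c; rewrite fill_comp /=.
have -> : fill C (Node k (coloured c) r) =
    fill (ctx_comp C (CtxR k (coloured c) (Hole E _))) r.
  by rewrite fill_comp.
by apply: IHr => c'; rewrite fill_comp /=; exact: UC (Node b c c').
Qed.

(** A commutative product of two pure trees stays pure when both are commutative trees; otherwise a
    bracket sits directly below the product, which is the pattern killed by the trivial law. *)
Lemma coloured_pure (T : Type) (c : tree bool T) :
  (exists p : tree E2 (tree E1 T), coloured c = pure_tree p) \/
  (exists C e (l r s : tree E T), coloured c = fill C (com1 l (Node (inr_op E1 e : E) r s)) \/
    coloured c = fill C (com1 (Node (inr_op E1 e : E) r s) l)).
Proof.
elim: c => [i|b l IHl r IHr]; first by left; exists (Leaf (Leaf i)).
case: IHl => [[p pE]|[C [e [x [y [z H]]]]]]; last first.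
  right; exists (CtxL (vertex b) C (coloured r)), e, x, y, z.
  by case: H => H; [left|right]; rewrite /= H.
case: IHr => [[q qE]|[C [e [x [y [z H]]]]]]; last first.
  right; exists (CtxR (vertex b) (coloured l) C), e, x, y, z.
  by case: H => H; [left|right]; rewrite /= H.
case: b => /=; rewrite pE qE; last by left; exists (Node (1 : E2) p q).
case: p {pE} => [x|e p p']; last first.
  by right; exists (Hole E T), e, (pure_tree q), (pure_tree p), (pure_tree p'); right.
case: q {qE} => [y|e q q']; first by left; exists (Leaf (Node (1 : E1) x y)).
right; exists (Hole E T), e, (@pure_tree K E1 E2 T (Leaf x)), (pure_tree q), (pure_tree q').
by left.
Qed.

Variable D : free12 E1 E2 -> free21 E1 E2.
Hypothesis D0 : forall x, D x = 0.

Let R := rel_total (@R_com K) (@R_lie K) D.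

Lemma rel_total_composition g : compositions (@ops1 K E1 E2) (@ops2 K E1 E2) g -> R g.
Proof.
move=> cg; have Sg : g \in spanb (orbits (compositions (@ops1 K E1 E2) (@ops2 K E1 E2))).
  by apply/asboolP; apply: sub_span; exact: orbits_self.
apply: sub_span; left; right; exists (SubSpace Sg) => //=.
by rewrite D0 subr0.
Qed.

Lemma null_com_lie_right (T : eqType) m e (x y z : tree E T) :
  null R [:: (1, Node (inl_op E2 m : E) x (Node (inr_op E1 e : E) y z))].
Proof.
apply: (@null_relation K E R T
  [:: (1, @comp_right E (inl_op E2 m) (inr_op E1 e) 0 1 2%:R isT)] (arg3 x y z)).
rewrite big_cons big_nil addr0 scale1r.
have mm : @ops1 K E1 E2 (inl_op E2 m) by exists m.
have ee : @ops2 K E1 E2 (inr_op E1 e) by exists e.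
exact: rel_total_composition (CompositionR mm ee).
Qed.

Lemma null_com_lie_left (T : eqType) m e (x y z : tree E T) :
  null R [:: (1, Node (inl_op E2 m : E) (Node (inr_op E1 e : E) x y) z)].
Proof.
apply: (@null_relation K E R T
  [:: (1, @comp_left E (inl_op E2 m) (inr_op E1 e) 0 1 2%:R isT)] (arg3 x y z)).
rewrite big_cons big_nil addr0 scale1r.
have mm : @ops1 K E1 E2 (inl_op E2 m) by exists m.
have ee : @ops2 K E1 E2 (inr_op E1 e) by exists e.
exact: rel_total_composition (CompositionL mm ee).
Qed.

Lemma xi_trivial_surjective n (x : operad R 'I_n) :
  exists c, @xi K E1 E2 (@R_com K) (@R_lie K) D n c = x.
Proof.
pose U : set (operad R 'I_n) := fun x => exists c, xi D c = x.
have xilin := @xi_linear K E1 E2 (@R_com K) (@R_lie K) D n.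
have subU : submodule U.
  split=> [|a u w [c <-] [d <-]]; first by exists 0; exact: linear_fun0 xilin.
  by exists (a *: c + d); exact: xilin.
apply: (span_ind (U := U) subU _ (operad_span x)) => _ [t _ <-].
rewrite -tree_classE; apply: (tree_class_coloured (C := Hole E _)) => // c /=.
case: (coloured_pure c) => [[p ->]|[C [e [l [r [s H]]]]]].
  by exists (tree_composite _ _ p); exact: xi_tree_composite.
have Z X : null R [:: (1, X)] -> U (tree_class R (fill C X)).
  move=> /(null_fill C)/null_combination; rewrite /combination big_cons big_nil /=.
  by rewrite addr0 scale1r => ->; case: subU.
by case: H => ->; apply: Z; [exact: null_com_lie_right|exact: null_com_lie_left].
Qed.

Lemma xi_trivial_bijective n : bijective (@xi K E1 E2 (@R_com K) (@R_lie K) D n).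
Proof.
apply: bijective_choice; last exact: xi_trivial_surjective.
exact: can_inj (com_lie_sectionK D0).
Qed.

End Surjectivity.
(** * Distributive laws in arity three and four *)

Section ArityThree.
Variables (K : fieldType) (E : sigma2 K).

Lemma ftree_comp_right_linear_root e' i j k (U : uniq [:: i; j; k]) :
  linear (fun e : E => ftree (comp_right e e' U)).
Proof. by move=> a e1 e2; apply: ftree_lin; exact: TreeLin. Qed.

Lemma ftree_comp_right_linear_inner e i j k (U : uniq [:: i; j; k]) :
  linear (fun e' : E => ftree (comp_right e e' U)).
Proof. by move=> a e1 e2; apply: ftree_lin; apply: TreeLinR; exact: TreeLin. Qed.

Lemma uniq3_perm (s : 'S_3) i j k : uniq [:: i; j; k] -> uniq [:: s i; s j; s k].
Proof. by move=> U; rewrite -[_ :: _]/(map s [:: i; j; k]) map_inj_uniq //; exact: perm_inj. Qed.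

Lemma frename_comp_right (s : 'S_3) (e e' : E) i j k (U : uniq [:: i; j; k]) :
  frename (perm_renaming s) (ftree (comp_right e e' U)) =
  ftree (comp_right e e' (uniq3_perm s U)).
Proof. by rewrite frename_tree; congr ftree; exact: val_inj. Qed.

Lemma ftree_comp_right_irr (e e' : E) i j k (U U' : uniq [:: i; j; k]) :
  ftree (comp_right e e' U) = ftree (comp_right e e' U').
Proof. by congr ftree; exact: val_inj. Qed.

Lemma uniq3_rot (i j k : 'I_3) : uniq [:: i; j; k] -> uniq [:: k; i; j].
Proof. by rewrite -(rot_uniq 2) /rot /=. Qed.

(** Turns left compositions into right ones, so that computations in arity three can be done with
    [comp_right] alone. *)
Lemma ftree_comp_left (e e' : E) i j k (U : uniq [:: i; j; k]) :
  ftree (comp_left e e' U) = ftree (comp_right (swap e) e' (uniq3_rot U)).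
Proof.
apply: ftree_swap; rewrite /= -{1}(swapK e); exact: TreeSwap.
Qed.

Lemma uniq3_swap (i j k : 'I_3) : uniq [:: i; j; k] -> uniq [:: i; k; j].
Proof. by rewrite /= !inE (eq_sym k j) !negb_or => /and3P[/andP[-> ->] ->]. Qed.

Lemma ftree_comp_right_swap (e e' : E) i j k (U : uniq [:: i; j; k]) :
  ftree (comp_right e e' U) = ftree (comp_right e (swap e') (uniq3_swap U)).
Proof.
by apply: ftree_swap; rewrite /= -{1}(swapK e'); apply: TreeSwapR; exact: TreeSwap.
Qed.

(** When the inner operation is symmetric, only the label at the root matters: the other two labels
    form the same pair in either order. *)
Lemma ftree_comp_right_sym (e e' : E) i j k j' k' (U : uniq [:: i; j; k])
    (U' : uniq [:: i; j'; k']) : swap e' = e' ->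
  ftree (comp_right e e' U) = ftree (comp_right e e' U').
Proof.
move=> se'; have j'E : (j' == j) || (j' == k).
  have := uniq3_mem j' U; move: U'; rewrite /= !inE !negb_or => /andP[/andP[ij' _] _].
  by rewrite eq_sym (negbTE ij').
have k'E : (k' == j) || (k' == k).
  have := uniq3_mem k' U; move: U'; rewrite /= !inE !negb_or => /andP[/andP[_ ik'] _].
  by rewrite eq_sym (negbTE ik').
have jk' : j' != k' by move: U'; rewrite /= !inE => /and3P[].
case/orP: j'E k'E => /eqP e1 /orP[]/eqP e2; rewrite e1 e2 ?eqxx in jk' U' *.
- by [].
- exact: ftree_comp_right_irr.
- by rewrite ftree_comp_right_swap se'; exact: ftree_comp_right_irr.
- by [].
Qed.

Lemma perm_arg3 (i j k : 'I_3) : uniq [:: i; j; k] ->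
  exists s : 'S_3, [/\ s 0 = i, s 1 = j & s 2%:R = k].
Proof.
move=> U; pose f (a : 'I_3) := nth i [:: i; j; k] a.
have f_inj : injective f.
  by move=> a b /eqP; rewrite nth_uniq ?ltn_ord // => /eqP; exact: val_inj.
by exists (perm f_inj); rewrite !permE.
Qed.

End ArityThree.

Section LinearArithmetic.
Variables (K : fieldType) (V : lmodType K).

(** The right-hand side has the shape that [big_cons] and [big_nil] give to a three-term
    combination; the same shapes occur in the next lemma and in [expansion_gap_eq0]. *)
Lemma subtract_scaled_difference (lam : K) (x p q : V) :
  x - lam *: (p - q) = 1 *: x + (- lam *: p + (lam *: q + 0)).
Proof. by rewrite scale1r addr0 scaleNr scalerBr opprB [- _ + _]addrC. Qed.

Lemma subtract_signed (x y : V) : x - y = (1 : K) *: x + ((-1 : K) *: y + 0).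
Proof. by rewrite scale1r scaleN1r addr0. Qed.

Lemma scale_difference (a p : K) (x y d : V) : x - y = p *: d ->
  a *: x - a *: y = (a * p) *: d.
Proof. by move=> e; rewrite -scalerBr e scalerA. Qed.

Lemma halve (a : K) (x d : V) : (2%:R : K) != 0 -> x + x = a *: d ->
  x = (2%:R^-1 * a) *: d.
Proof.
move=> two e; rewrite -scalerA -e -mulr2n -scaler_nat scalerA mulVf //.
by rewrite scale1r.
Qed.

(* The difference of the two expansions of (ab)[c,d] = a(b[c,d]) given by
   a[b,c] = lam ([b,ac] - [c,ab]). *)
Definition expansion_gap (lam : K) (q1 q2 q3 q4 q5 q6 : V) : V :=
  lam *: q1 - lam *: q2 - (lam * lam) *: (q3 - q4 - (q5 - q6)).

(** Here x = (ab)[c,d], y = a(b[c,d]), u1 = a[c,bd] and u2 = a[d,bc]. The hypotheses are, in order,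
    the law for x, associativity, the law for b[c,d] multiplied by a, and the law for u1 and for
    u2. *)
Lemma expansion_gap_eq0 lam (x y u1 u2 q1 q2 q3 q4 q5 q6 : V) :
  1 *: x + (- lam *: q1 + (lam *: q2 + 0)) = 0 ->
  1 *: x + (-1 *: y + 0) = 0 ->
  1 *: y + (- lam *: u1 + (lam *: u2 + 0)) = 0 ->
  1 *: u1 + (- lam *: q3 + (lam *: q4 + 0)) = 0 ->
  1 *: u2 + (- lam *: q5 + (lam *: q6 + 0)) = 0 ->
  expansion_gap lam q1 q2 q3 q4 q5 q6 = 0.
Proof.
have split (x' p q : V) : 1 *: x' + (- lam *: p + (lam *: q + 0)) = 0 ->
    x' = lam *: (p - q).
  rewrite scale1r addr0 scaleNr scalerBr => /eqP; rewrite addr_eq0 => /eqP ->.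
  by rewrite opprD opprK.
move=> /split e1 + /split e3 /split e4 /split e5.
rewrite scale1r scaleN1r addr0 => /eqP; rewrite subr_eq0 => /eqP e2.
by rewrite /expansion_gap -scalerBr -e1 e2 e3 e4 e5 -scalerBr scalerA subrr.
Qed.

End LinearArithmetic.

Lemma expansion_gap_linear (K : fieldType) (V W : lmodType K) (F : V -> W) lam
    q1 q2 q3 q4 q5 q6 : linear F ->
  F (expansion_gap lam q1 q2 q3 q4 q5 q6) =
  expansion_gap lam (F q1) (F q2) (F q3) (F q4) (F q5) (F q6).
Proof.
move=> Fl; rewrite /expansion_gap !(linear_funB _ _ Fl) !(linear_funZ _ _ Fl).
by rewrite !(linear_funB _ _ Fl).
Qed.

Lemma expansion_gap_unit (K : fieldType) (lam : K) :
  expansion_gap (V := K^o) lam 0 0 0 1 0 0 = 0 -> lam = 0.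
Proof.
rewrite /expansion_gap !scaler0 !subr0 !sub0r scalerN opprK => /eqP.
by rewrite -[_ *: 1]/(lam * lam * 1) mulr1 mulf_eq0 orbb => /eqP.
Qed.

(** * An algebra in which [bd,ac] survives *)

Section DetectingAlgebra.
Variable K : fieldType.

(* Generators in degree 1, products in degree 2, brackets of products in degree
   3; all triple products and iterated brackets vanish. *)
Let V := ((K^o * K^o) * (K^o * K^o) * K^o)%type.

(** The squares of the two generators form a basis of degree 2, and the product of the two
    generators is 0. *)
Definition graded_com (x y : V) : V :=
  (((0 : K^o), (0 : K^o)),
   (((x.1.1.1 : K) * y.1.1.1 : K^o), ((x.1.1.2 : K) * y.1.1.2 : K^o)), (0 : K^o)).

(** The determinant of the degree 2 parts: the bracket of the two squares is 1 up to sign. *)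
Definition graded_lie (x y : V) : V :=
  (((0 : K^o), (0 : K^o)), ((0 : K^o), (0 : K^o)),
   ((x.1.2.1 : K) * y.1.2.2 - (x.1.2.2 : K) * y.1.2.1 : K^o)).

Lemma graded_com_linearr x : linear (graded_com x).
Proof.
move=> a y z; rewrite /graded_com /=.
by congr (_, _, _); [congr (_, _)|congr (_, _)|];
   rewrite /= ?mulrDr ?scaler0 ?addr0 //; congr (_ + _); exact: mulrCA.
Qed.

Lemma graded_comC x y : graded_com x y = graded_com y x.
Proof. by rewrite /graded_com; congr (_, (_, _), _); exact: mulrC. Qed.

Lemma graded_com_linearl y : linear (graded_com^~ y).
Proof. by move=> a x z; rewrite !(graded_comC _ y) graded_com_linearr. Qed.

Lemma graded_lieN x y : graded_lie x y = - graded_lie y x.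
Proof.
rewrite /graded_lie; congr (_, _, _); rewrite /= ?oppr0 //.
by rewrite opprB [_ * y.1.2.2]mulrC [_ * y.1.2.1]mulrC.
Qed.

Lemma graded_lie_linearr x : linear (graded_lie x).
Proof.
move=> a y z; rewrite /graded_lie.
congr (_, _, _); rewrite /= ?scaler0 ?addr0 //.
rewrite !mulrDr opprD addrACA; congr (_ + _).
by rewrite scalerBr; congr (_ - _); exact: mulrCA.
Qed.

Lemma graded_lie_linearl y : linear (graded_lie^~ y).
Proof.
move=> a x z; rewrite (graded_lieN _ y) graded_lie_linearr.
by rewrite opprD -scalerN -!graded_lieN.
Qed.

Lemma graded_comA x y z : graded_com (graded_com x y) z = graded_com x (graded_com y z).
Proof. by rewrite /graded_com /= !mulr0 !mul0r. Qed.

Lemma graded_jacobi x y z :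
  graded_lie (graded_lie x y) z + graded_lie (graded_lie y z) x +
  graded_lie (graded_lie z x) y = 0.
Proof. by rewrite /graded_lie /= !mul0r !subr0; congr (_, _, _); rewrite /= !addr0. Qed.

Lemma graded_com_lie x y z : graded_com x (graded_lie y z) = 0.
Proof. by rewrite /graded_com /= !mulr0. Qed.

End DetectingAlgebra.

(** * A distributive law is given by one scalar, and the scalar vanishes *)

Section Forward.
Variables (K : fieldType).
Hypothesis charK : [pchar K] =i pred0.

Let E1 := E_com K.
Let E2 := E_lie K.
Let E := sigma2_sum E1 E2.
Let m : E := inl_op E2 (1 : E1).
Let b : E := inr_op E1 (1 : E2).

Variable D : {linear free12 E1 E2 -> free21 E1 E2}.
Hypothesis eqD : equivariant D.

Lemma swap_com e : swap (inl_op E2 e : E) = inl_op E2 e.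
Proof. by rewrite -inl_op_swap. Qed.

Lemma inl_op_scale (c : E1) : inl_op E2 c = (c : K) *: m.
Proof. by congr pair; rewrite /= ?scaler0 //; exact: esym (mulr1 (c : K)). Qed.

Lemma inr_op_scale (c : E2) : inr_op E1 c = (c : K) *: b.
Proof. by congr pair; rewrite /= ?scaler0 //; exact: esym (mulr1 (c : K)). Qed.

Lemma swap_lie : swap b = (-1 : K) *: b.
Proof. by rewrite /b -inr_op_swap inr_op_scale. Qed.

Let com_lie i j k (U : uniq [:: i; j; k]) : free E 'I_3 := ftree (comp_right m b U).
Let lie_com i j k (U : uniq [:: i; j; k]) : free E 'I_3 := ftree (comp_right b m U).

Lemma free12_generator g : orbits (compositions (@ops1 K E1 E2) (@ops2 K E1 E2)) g ->
  exists a i j k (U : uniq [:: i; j; k]), g = a *: com_lie U.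
Proof.
have H i j k (U : uniq [:: i; j; k]) (c : E1) (d : E2) :
    ftree (comp_right (inl_op E2 c) (inr_op E1 d) U) = ((c : K) * (d : K)) *: com_lie U.
  rewrite inl_op_scale (linear_funZ _ _ (ftree_comp_right_linear_root _ _)).
  rewrite inr_op_scale (linear_funZ _ _ (ftree_comp_right_linear_inner _ _)).
  by rewrite scalerA.
case=> s [_ [[_ _ [c _ <-] [d _ <-]|_ _ [c _ <-] [d _ <-]] ->]].
  rewrite frename_comp_right H; by do 5!eexists.
rewrite ftree_comp_left swap_com frename_comp_right H; by do 5!eexists.
Qed.

Lemma free21_generator g : orbits (compositions (@ops2 K E1 E2) (@ops1 K E1 E2)) g ->
  exists a i j k (U : uniq [:: i; j; k]), g = a *: lie_com U.
Proof.
have H i j k (U : uniq [:: i; j; k]) (c : E1) (d : E2) :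
    ftree (comp_right (inr_op E1 d) (inl_op E2 c) U) = ((d : K) * (c : K)) *: lie_com U.
  rewrite inr_op_scale (linear_funZ _ _ (ftree_comp_right_linear_root _ _)).
  rewrite inl_op_scale (linear_funZ _ _ (ftree_comp_right_linear_inner _ _)).
  by rewrite scalerA.
case=> s [_ [[_ _ [d _ <-] [c _ <-]|_ _ [d _ <-] [c _ <-]] ->]].
  rewrite frename_comp_right H; by do 5!eexists.
rewrite ftree_comp_left -inr_op_swap frename_comp_right H; by do 5!eexists.
Qed.

Lemma com_lie_in i j k (U : uniq [:: i; j; k]) :
  com_lie U \in spanb (orbits (compositions (@ops1 K E1 E2) (@ops2 K E1 E2))).
Proof.
have [s [si sj sk]] := perm_arg3 U.
apply/asboolP; apply: sub_span; exists s, (ftree (@comp_right E m b 0 1 2%:R isT)).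
split; first by constructor; [exists (1 : E1)|exists (1 : E2)].
rewrite frename_comp_right /com_lie; move: (uniq3_perm s _); rewrite si sj sk => U'.
exact: ftree_comp_right_irr.
Qed.

Let x0 : free12 E1 E2 := SubSpace (com_lie_in (isT : uniq [:: 0; 1; 2%:R : 'I_3])).

(** [free12] is spanned by the orbit of [x0], which is a[b,c], and equivariance carries the
    vanishing along the orbit. *)
Lemma trivial_on_generator : D x0 = 0 -> forall x, D x = 0.
Proof.
move=> Dx0 x.
(* [span] lives in the free operad while [D] is defined on a subspace, so the property asks for a
   lift [y] of [w]. *)
pose U (w : free E 'I_3) := exists2 y : free12 E1 E2, sub_val y = w & D y = 0.
have [y yx <-] : U (sub_val x); last by congr (D _); exact: val_inj.
have : span (orbits (compositions (@ops1 K E1 E2) (@ops2 K E1 E2))) (sub_val x).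
  by case: x => x /= /asboolP.
apply: span_ind => [|_ /free12_generator[a [i [j [k [V ->]]]]]].
  split=> [|a u v [y yu Dy] [z zv Dz]]; first by exists 0; rewrite ?linear0.
  by exists (a *: y + z); [rewrite -yu -zv|rewrite linearP Dy Dz scaler0 addr0].
have [s [si sj sk]] := perm_arg3 V.
pose y : free12 E1 E2 := SubSpace (com_lie_in V).
exists (a *: y) => //; rewrite linearZ /=.
suff -> : D y = 0 by rewrite scaler0.
apply: val_inj; rewrite /= (@eqD s x0 y) ?Dx0.
  exact: linear_fun0 (@frename_is_linear K E _ _ (perm_renaming s)).
rewrite /= /com_lie frename_comp_right; move: (uniq3_perm s _); rewrite si sj sk => U'.
by rewrite (bool_irrelevance V U').
Qed.

(** With a, b, c for the labels 0, 1, 2, these are [b,ac] and [c,ab]; [tau] exchanges b and c. *)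
Let t1 := lie_com (isT : uniq [:: 1; 0; 2%:R : 'I_3]).
Let t2 := lie_com (isT : uniq [:: 2%:R; 0; 1 : 'I_3]).
Let tau : 'S_3 := tperm 1 2%:R.

(** [tau] fixes [a,bc] and exchanges [b,ac] with [c,ab], so the scalar is 0, 1 or -1. *)
Lemma lie_com_antisym i j k (U : uniq [:: i; j; k]) :
  exists a, lie_com U - frename (perm_renaming tau) (lie_com U) = a *: (t1 - t2).
Proof.
have sm : swap m = m by exact: swap_com.
have := uniq3_mem i (isT : uniq [:: 0; 1; 2%:R : 'I_3]); rewrite !inE.
rewrite /lie_com frename_comp_right.
case/or3P=> /eqP e; move: (uniq3_perm tau U); move: U; rewrite e.
- rewrite tpermD // => U U'; exists 0.
  by rewrite (ftree_comp_right_sym b U U' sm) subrr scale0r.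
- rewrite tpermL => U U'; exists 1; rewrite scale1r.
  by congr (_ - _); exact: ftree_comp_right_sym.
- rewrite tpermR => U U'; exists (-1); rewrite scaleN1r opprB.
  by congr (_ - _); exact: ftree_comp_right_sym.
Qed.

(** [tau] sends a[b,c] to its opposite, hence also w = D(a[b,c]). So w minus its image under [tau]
    is 2w, and any such difference is a multiple of [t1 - t2]. *)
Lemma distributive_coefficient : exists lam, sub_val (D x0) = lam *: (t1 - t2).
Proof.
have tauD : sub_val (D (- x0)) = frename (perm_renaming tau) (sub_val (D x0)).
  apply: eqD; rewrite /= /com_lie frename_comp_right; move: (uniq3_perm tau _).
  rewrite tpermL tpermR tpermD // => U.
  rewrite ftree_comp_right_swap swap_lie.
  rewrite (linear_funZ _ _ (ftree_comp_right_linear_inner _ _)) scaleN1r.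
  by rewrite opprK (bool_irrelevance (uniq3_swap _) U).
have : span (orbits (compositions (@ops2 K E1 E2) (@ops1 K E1 E2))) (sub_val (D x0)).
  by case: (D x0) => x /= /asboolP.
pose S w := exists a, w - frename (perm_renaming tau) w = a *: (t1 - t2).
have renlin := @frename_is_linear K E _ _ (perm_renaming tau).
move=> /(span_ind (U := S))[|_ /free21_generator[a [i [j [k [U ->]]]]]|a].
- split=> [|a u v [p up] [q vq]]; first by exists 0; rewrite (linear_fun0 renlin) subr0 scale0r.
  exists (a * p + q); have -> := renlin a u v.
  by rewrite opprD addrACA -scalerBr up vq scalerDl scalerA.
- have [p pE] := lie_com_antisym U; exists (a * p).
  rewrite (linear_funZ _ _ renlin); exact: scale_difference.
rewrite -tauD linearN /= opprK => e.
(* The characteristic enters here, to divide by 2. *)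
have two : (2%:R : K) != 0 by have := charK 2; rewrite !inE /= => ->.
by exists (2%:R^-1 * a); exact: halve.
Qed.

Let R := rel_total (@R_com K) (@R_lie K) D.

Lemma null_distributive lam (T : eqType) (x y z : tree E T) :
  sub_val (D x0) = lam *: (t1 - t2) ->
  null R [:: (1, Node m x (Node b y z)); (- lam, Node b y (Node m x z));
             (lam, Node b z (Node m x y))].
Proof.
move=> DE.
apply: (@null_relation K E R T
  [:: (1, @comp_right E m b 0 1 2%:R isT); (- lam, @comp_right E b m 1 0 2%:R isT);
      (lam, @comp_right E b m 2%:R 0 1 isT)] (arg3 x y z)).
apply: sub_span; left; right; exists x0 => //.
rewrite DE !big_cons big_nil; exact: subtract_scaled_difference.
Qed.

Lemma null_total_assoc (T : eqType) (x y z : tree E T) :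
  null R [:: (1, Node m (Node m x y) z); (-1, Node m x (Node m y z))].
Proof.
apply: (@null_relation K E R T
  [:: (1, @comp_left E m m 0 1 2%:R isT); (-1, @comp_right E m m 0 1 2%:R isT)]
  (arg3 x y z)).
pose l : free E1 'I_3 := ftree (@comp_left E1 1 1 0 1 2%:R isT).
pose r : free E1 'I_3 := ftree (@comp_right E1 1 1 0 1 2%:R isT).
apply: sub_span; left; left; exists (l - r).
  by apply: sub_span; exact: orbits_self.
have flin := fmap_op_linear (@inl_op_linear K E1 E2) (@inl_op_swap K E1 E2) (A := 'I_3).
rewrite (linear_funB _ _ flin) /l /r.
rewrite !(fmap_op_tree (@inl_op_linear K E1 E2) (@inl_op_swap K E1 E2)).
rewrite !big_cons big_nil.
have -> : mtmap_op (inl_op E2) (@comp_left E1 1 1 0 1 2%:R isT) =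
    @comp_left E m m 0 1 2%:R isT by exact: val_inj.
have -> : mtmap_op (inl_op E2) (@comp_right E1 1 1 0 1 2%:R isT) =
    @comp_right E m m 0 1 2%:R isT by exact: val_inj.
exact: subtract_signed.
Qed.

Let i0 := @Ordinal 4 0 isT.
Let i1 := @Ordinal 4 1 isT.
Let i2 := @Ordinal 4 2 isT.
Let i3 := @Ordinal 4 3 isT.
Notation x_ i := (Leaf i : tree E1 'I_4).
Let com (x y : tree E1 'I_4) : tree E1 'I_4 := Node (1 : E1) x y.
Let lie (x y : tree E1 'I_4) : tree E2 (tree E1 'I_4) := Node (1 : E2) (Leaf x) (Leaf y).

(** With a, b, c, d for the labels 0 to 3, [p1] to [p6] are [c,(ab)d], [d,(ab)c], [c,a(bd)],
    [bd,ac], [d,a(bc)] and [bc,ad]. *)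
Let p1 := lie (x_ i2) (com (com (x_ i0) (x_ i1)) (x_ i3)).
Let p2 := lie (x_ i3) (com (com (x_ i0) (x_ i1)) (x_ i2)).
Let p3 := lie (x_ i2) (com (x_ i0) (com (x_ i1) (x_ i3))).
Let p4 := lie (com (x_ i1) (x_ i3)) (com (x_ i0) (x_ i2)).
Let p5 := lie (x_ i3) (com (x_ i0) (com (x_ i1) (x_ i2))).
Let p6 := lie (com (x_ i1) (x_ i2)) (com (x_ i0) (x_ i3)).

Lemma expansion_gap_relation lam : sub_val (D x0) = lam *: (t1 - t2) ->
  let C p := tree_class R (pure_tree p) in
  expansion_gap lam (C p1) (C p2) (C p3) (C p4) (C p5) (C p6) = 0.
Proof.
move=> DE C.
pose a : tree E 'I_4 := Leaf i0; pose b' : tree E 'I_4 := Leaf i1.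
pose c : tree E 'I_4 := Leaf i2; pose d : tree E 'I_4 := Leaf i3.
have := null_combination (null_distributive (Node m a b') c d DE).
have := null_combination (null_total_assoc a b' (Node b c d)).
have := null_combination (null_node_r m a (null_distributive b' c d DE)).
have := null_combination (null_distributive a c (Node m b' d) DE).
have := null_combination (null_distributive a d (Node m b' c) DE).
rewrite /combination !big_cons !big_nil => e5 e4 e3 e2 e1.
exact: expansion_gap_eq0 e1 e2 e3 e4 e5.
Qed.

Lemma multilinear_uniq (G : Type) (t : tree G 'I_4) :
  uniq (leaves t) -> size (leaves t) = 4 -> multilinear t.
Proof.
move=> Ut st; rewrite /multilinear Ut; apply/forallP => i.
have [||_ ->] := uniq_min_size Ut (s2 := enum 'I_4).
- by move=> j _; rewrite mem_enum.
- by rewrite size_enum_ord st.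
by rewrite mem_enum.
Qed.

Lemma expansion_gap_free lam : distributive_law (@R_com K) (@R_lie K) D ->
  sub_val (D x0) = lam *: (t1 - t2) -> lam = 0.
Proof.
move=> xi_bij DE.
pose C (p : tree E2 (tree E1 'I_4)) := tree_composite (@R_com K) (@R_lie K) p.
pose z := expansion_gap lam (C p1) (C p2) (C p3) (C p4) (C p5) (C p6).
(* [xi] for [D] kills [z] by the two expansions, and it is injective in arity 4. *)
have z0 : z = 0.
  have xilin := @xi_linear K E1 E2 (@R_com K) (@R_lie K) D 4.
  apply: (bij_inj (xi_bij 4 isT)); rewrite (linear_fun0 xilin) /z.
  rewrite (expansion_gap_linear _ _ _ _ _ _ _ xilin) !xi_tree_composite.
  exact: expansion_gap_relation.
(* The composite product is the same for every law, so [z = 0] can be read through [xi] for the zero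
   law, over which an explicit algebra is available. *)
pose D0 (x : free12 E1 E2) : free21 E1 E2 := 0.
have D00 x : D0 x = 0 by [].
pose R0 := rel_total (@R_com K) (@R_lie K) D0.
have xilin := @xi_linear K E1 E2 (@R_com K) (@R_lie K) D0 4.
have := congr1 (@xi K E1 E2 (@R_com K) (@R_lie K) D0 4) z0.
rewrite (linear_fun0 xilin) /z (expansion_gap_linear _ _ _ _ _ _ _ xilin).
rewrite !xi_tree_composite.
pose V := ((K^o * K^o) * (K^o * K^o) * K^o)%type.
(* b and d take the first generator, a and c the second: bd and ac are the two squares, while bc and
   ad vanish. *)
pose v (i : 'I_4) : V :=
  if odd i then (((1 : K^o), (0 : K^o)), ((0 : K^o), (0 : K^o)), (0 : K^o))
  else (((0 : K^o), (1 : K^o)), ((0 : K^o), (0 : K^o)), (0 : K^o)).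
have evlin := @com_lie_eval_linear K _ _ _ (@graded_com_linearl K)
  (@graded_com_linearr K) (@graded_lie_linearl K) (@graded_lie_linearr K)
  (@graded_comC K) (@graded_comA K) (@graded_lieN K) (@graded_jacobi K)
  (@graded_com_lie K) D0 D00 _ v.
have evtree := @com_lie_eval_tree K _ _ _ (@graded_com_linearl K)
  (@graded_com_linearr K) (@graded_lie_linearl K) (@graded_lie_linearr K)
  (@graded_comC K) (@graded_comA K) (@graded_lieN K) (@graded_jacobi K)
  (@graded_com_lie K) D0 D00 _ v.
have evC (t : tree E 'I_4) : uniq (leaves t) -> size (leaves t) = 4 ->
    operad_eval (com_lie_op (@graded_com K) (@graded_lie K)) v (tree_class R0 t) =
    teval (com_lie_op (@graded_com K) (@graded_lie K)) v t.
  by move=> Ut st; rewrite -(evtree (MTree (multilinear_uniq Ut st))) -tree_classE.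
have ev_leaf i : teval (com_lie_op (@graded_com K) (@graded_lie K)) v
    (tmap_op (@inl_op K E1 E2) (x_ i)) = v i by [].
have ev_com x y : teval (com_lie_op (@graded_com K) (@graded_lie K)) v
    (tmap_op (@inl_op K E1 E2) (com x y)) =
    graded_com (teval (com_lie_op (@graded_com K) (@graded_lie K)) v (tmap_op (@inl_op K E1 E2) x))
      (teval (com_lie_op (@graded_com K) (@graded_lie K)) v (tmap_op (@inl_op K E1 E2) y)).
  by rewrite [LHS]/= /com_lie_op /= scale1r scale0r addr0.
have ev_lie x y : teval (com_lie_op (@graded_com K) (@graded_lie K)) v
    (pure_tree (lie x y)) =
    graded_lie (teval (com_lie_op (@graded_com K) (@graded_lie K)) v (tmap_op (@inl_op K E1 E2) x))
      (teval (com_lie_op (@graded_com K) (@graded_lie K)) v (tmap_op (@inl_op K E1 E2) y)).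
  by rewrite [LHS]/= /com_lie_op /= scale1r scale0r add0r.
have sndlin : linear (fun x : V => x.2) by [].
move/(congr1 (operad_eval (com_lie_op (@graded_com K) (@graded_lie K)) v)).
rewrite (expansion_gap_linear _ _ _ _ _ _ _ evlin) (linear_fun0 evlin).
rewrite !evC // => /(congr1 (fun x : V => x.2)).
rewrite (expansion_gap_linear _ _ _ _ _ _ _ sndlin).
rewrite !ev_lie !ev_com !ev_leaf.
move=> gap0; apply: expansion_gap_unit; rewrite -[RHS]gap0 /graded_lie.
(* In the last component only [bd,ac] contributes, with value 1, which leaves the coefficient
   [lam * lam]. *)
congr expansion_gap; rewrite /= ?mul0r ?mulr0 ?mulr1 ?subr0 //.
Qed.

Lemma distributive_law_trivial : distributive_law (@R_com K) (@R_lie K) D ->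
  forall x, D x = 0.
Proof.
move=> xi_bij; have [lam DE] := distributive_coefficient.
apply: trivial_on_generator; apply: val_inj; rewrite /= DE.
by rewrite (expansion_gap_free xi_bij DE) scale0r.
Qed.

End Forward.

Theorem theorem6p2 (K : fieldType) (charK : [pchar K] =i pred0)
    (D : {linear free12 (E_com K) (E_lie K) -> free21 (E_com K) (E_lie K)})
    (eqD : equivariant D) :
  distributive_law (@R_com K) (@R_lie K) D <-> (forall x, D x = 0).
Proof.
split=> [|D0 n _]; first exact: distributive_law_trivial.
exact: xi_trivial_bijective.
Qed.
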